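(* Let $(\xi_j)_{j\ge 0}$ be a sequence of independent and identically distributed non-degenerate real random variables such that, for some $M>0$, $\gamma>0$ and $q\in(0,1)$, $$\sup_{u\in\mathbb{R}}\mathbb{P}(|\xi_0-u|\le\gamma)\le 1-q\quad\text{and}\quad \mathbb{P}(|\xi_0|>M)\le \frac{q}{2}.$$ Assume that $\mathbb{E}[\xi_0]=0$ and $\mathbb{E}[\xi_0^2]<\infty$. For $n\in\mathbb{N}$ let $W_n(z)=\sum_{j=0}^{n-1}\xi_j z^j$, $z\in\mathbb{C}$. Then for every fixed $t\ge 1$, $$\mathbb{P}\Big(\min_{z\in\mathbb{C}:\,||z|-1|\le t n^{-2}(\log n)^{-3}}|W_n(z)|\le t n^{-1/2}(\log n)^{-2}\Big)=O\big((\log n)^{-1/2}\big)\quad\text{as } n\to\infty,$$ where the implicit constant depends on $t$ and the distribution of $\xi_0$.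
   Context: A real random variable is non-degenerate if it is not almost surely constant. *)

(* Defs.v *)
From HB Require Import structures.
From mathcomp Require Export all_boot all_order all_algebra.
From mathcomp Require Export all_classical all_reals all_analysis.
From mathcomp Require Export complex.

Set Implicit Arguments.
Unset Strict Implicit.
Unset Printing Implicit Defensive.

Export Order.TTheory GRing.Theory Num.Theory.
Export numFieldNormedType.Exports.

#[global] Open Scope classical_set_scope.
#[global] Open Scope ring_scope.
#[global] Open Scope complex_scope.

Section random_sequences.
Context (d : measure_display) (T : measurableType d) (R : realType).
Variable P : probability T R.

Definition mutually_independent (X : nat -> {RV P >-> R}) : Prop :=
  forall (s : seq nat) (B : nat -> set R),
    uniq s -> (forall j, measurable (B j)) ->
    P [set w | forall j, j \in s -> B j (X j w)] =
    (\prod_(j <- s) P (X j @^-1` B j))%E.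

Definition has_law (X : {RV P >-> R}) (mu : probability R R) : Prop :=
  forall B : set R, measurable B -> distribution P X B = mu B.

Definition iid_with_law (X : nat -> {RV P >-> R}) (mu : probability R R) :
    Prop :=
  mutually_independent X /\ forall j, has_law (X j) mu.

Definition non_degenerate (X : {RV P >-> R}) : Prop :=
  ~ exists c : R, {ae P, forall w, X w = c}.

Definition concentration_condition (X : {RV P >-> R}) (M gamma q : R) : Prop :=
  (ereal_sup [set P [set w | `|X w - u| <= gamma]%R | u in [set: R]]
     <= (1 - q)%:E)%E
  /\ (P [set w | (M < `|X w|)%R] <= (q / 2)%:E)%E.

Definition random_poly (X : nat -> {RV P >-> R}) (n : nat) (w : T) (z : R[i]) :
    R[i] :=
  \sum_(j < n) (X j w)%:C * z ^+ j.

End random_sequences.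

(* MathComp's `|z| on R[i] is again an element of R[i]; this is the real-valued
   modulus. *)
Definition modulus (R : realType) (z : R[i]) : R := ComplexField.Normc.normc z.

Definition annulus (R : realType) (delta : R) : set R[i] :=
  [set z | `|modulus z - 1| <= delta].

(* For delta >= 0 the annulus is compact and nonempty, and z |-> |f z| is
   continuous when f is a polynomial function; the infimum below is then
   attained, so it is the minimum. *)
Definition min_modulus (R : realType) (f : R[i] -> R[i]) (delta : R) : R :=
  inf [set modulus (f z) | z in annulus delta].

(* Main.v *)
Require Import Defs.
From mathcomp Require Import measurable_realfun ring lra zify.
Set Implicit Arguments.
Unset Strict Implicit.
Unset Printing Implicit Defensive.

(** Write [l = ln n] and [r = sqrt l], and let [W] be the random polynomial.
    The annulus has width about [n^-2 l^-3], so it is covered by discs of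
    comparable radius around [N ~ n^2 l^3] equally spaced points of the unit
    circle, the net. Taylor expansion at a net point shows ([small_min_near_net])
    that if [W] is tiny somewhere on the annulus then one of three things happens:
    the energy, the sum of the [(xi j)^2] for [j < n], exceeds [r n]; or the
    derivative of [W] exceeds [n^(3/2) l] at some net point; or [W] is of order
    [n^-1/2 l^-2] at some net point.

    The first event has probability [O(1/r)] by Markov's inequality, and this is
    where the rate [(ln n)^-1/2] comes from. Once the energy is bounded, a
    Chernoff bound keeping the quadratic variation in the exponent
    ([chernoff_lform], [majorized_deviation]) makes the second event negligible.

    For the third event one wants [P (|W (z)| <= eps) = O(eps^2 / n)] at a net
    point [z], since [eps ~ n^-1/2 l^-2] then gives [l^-4 n^-2] per point and
    [1/l] in total. By Esseen's inequality, used here in a discrete form with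
    finite exponential sums ([discrete_esseen]), such a bound follows from the
    decay of the characteristic function of [(Re W (z), Im W (z))] at all
    frequencies up to [1 / eps], far beyond the range [|(a, b)| ~ 1 / M] where a
    quadratic expansion is available. This characteristic function is a product
    over [j] of one-dimensional ones at the values of a wave
    [a cos (j th) + b sin (j th)], and the concentration hypothesis turns the
    product into [exp (- c E)], where [E] is the least value, for [v] of size
    between [gamma] and [2 M], of the sum over [j] of [sin^2 (v * wave j / 2)]
    ([chf2_prod_le]). To bound [E] below for waves of large amplitude, the wave is
    differenced along a step [s] for which [s th] is close to, but not too close
    to, a multiple of [2 pi]: each differencing costs a constant factor in [E] and
    divides the amplitude by a power of [n], so finitely many of them lead back
    to small amplitudes ([sin_energy_large]).

    A suitable step exists unless [th / (2 pi)] is extremely close to a rational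
    of small denominator ([window_step]). The exceptional net points are so few
    ([card_near_rational]) that the weaker bound [O(1/n)], up to a power of the
    conditioning, suffices for them. The points close to [1] and [-1], where the
    covariance of [W (z)] degenerates, are handled together: there [Re W (z)]
    differs little from [W 1] or [W (-1)], whose small-ball probability is that
    of a one-dimensional signed sum ([majorized_arcs]).

    All the intermediate events are bounded through the integral of a bounded
    measurable majorant, so that independence is only used for integrals of
    bounded functions and measurability matters for the final event alone. *)

(** * Bounded measurable functions *)

Section bounded_measurable.
Context (d : measure_display) (T : measurableType d) (R : realType).

(** Such functions are integrable for every probability measure and closed under
    sums and products, so that integrals can be manipulated algebraically. *)
Definition bm (f : T -> R) : Prop :=
  measurable_fun setT f /\ exists M : R, forall x, `|f x| <= M.

Lemma bm_measurable f : bm f -> measurable_fun setT f.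
Proof. by case. Qed.

Lemma bm_cst c : bm (fun=> c).
Proof. by split; [exact: measurable_cst | exists `|c|]. Qed.

Lemma bmD f g : bm f -> bm g -> bm (fun x => f x + g x).
Proof.
move=> [mf [M fM]] [mg [N gN]]; split; first exact: measurable_funD.
by exists (M + N) => x; rewrite (le_trans (ler_normD _ _)) ?lerD.
Qed.

Lemma bmM f g : bm f -> bm g -> bm (fun x => f x * g x).
Proof.
move=> [mf [M fM]] [mg [N gN]]; split; first exact: measurable_funM.
by exists (M * N) => x; rewrite normrM ler_pM.
Qed.

Lemma bmZ c f : bm f -> bm (fun x => c * f x).
Proof. exact: (@bmM (fun=> c) f (bm_cst c)). Qed.

Lemma bmN f : bm f -> bm (fun x => - f x).
Proof.
move=> bf; have := bmZ (-1) bf.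
by congr bm; apply/funext => x; rewrite mulN1r.
Qed.

Lemma bmB f g : bm f -> bm g -> bm (fun x => f x - g x).
Proof. by move=> bf bg; apply: bmD => //; exact: bmN. Qed.

Lemma bm_indic (A : set T) : measurable A -> bm (\1_A).
Proof.
move=> mA; split; first exact: measurable_indic.
by exists 1 => x; rewrite indicE; case: (x \in A); rewrite ?normr1 ?normr0.
Qed.

Lemma bm_sum (I : Type) (s : seq I) (f : I -> T -> R) :
  (forall i, bm (f i)) -> bm (fun x => \sum_(i <- s) f i x).
Proof.
move=> bf; elim: s => [|i s IH].
  by have := bm_cst 0; congr bm; apply/funext => x; rewrite big_nil.
have := bmD (bf i) IH.
by congr bm; apply/funext => x; rewrite big_cons.
Qed.

Lemma bm_prod (I : Type) (s : seq I) (f : I -> T -> R) :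
  (forall i, bm (f i)) -> bm (fun x => \prod_(i <- s) f i x).
Proof.
move=> bf; elim: s => [|i s IH].
  by have := bm_cst 1; congr bm; apply/funext => x; rewrite big_nil.
have := bmM (bf i) IH.
by congr bm; apply/funext => x; rewrite big_cons.
Qed.

Variable P : probability T R.

Lemma bm_integrable f : bm f -> P.-integrable setT (EFin \o f).
Proof.
move=> [mf [M fM]]; apply: measurable_bounded_integrable => //.
  by rewrite (le_lt_trans (probability_le1 _ _)) ?ltry.
exists M; split; first exact: num_real.
by move=> y My x _; apply: le_trans (fM x) (ltW My).
Qed.

Lemma bm_intD f g : bm f -> bm g ->
  \int[P]_x (f x + g x) = \int[P]_x f x + \int[P]_x g x.
Proof. by move=> bf bg; apply: RintegralD => //; exact: bm_integrable. Qed.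

Lemma bm_intB f g : bm f -> bm g ->
  \int[P]_x (f x - g x) = \int[P]_x f x - \int[P]_x g x.
Proof. by move=> bf bg; apply: RintegralB => //; exact: bm_integrable. Qed.

Lemma bm_intZ c f : bm f -> \int[P]_x (c * f x) = c * \int[P]_x f x.
Proof. by move=> bf; apply: RintegralZl => //; exact: bm_integrable. Qed.

Lemma prob_int_cst c : \int[P]_x (c : R) = c.
Proof. by rewrite Rintegral_cst //= probability_setT mulr1. Qed.

Lemma bm_int_sum (I : Type) (s : seq I) (f : I -> T -> R) :
  (forall i, bm (f i)) ->
  \int[P]_x (\sum_(i <- s) f i x) = \sum_(i <- s) \int[P]_x f i x.
Proof.
move=> bf; elim: s => [|i s IH].
  rewrite big_nil -[RHS](prob_int_cst 0).
  by apply: eq_Rintegral => x _; rewrite big_nil.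
rewrite big_cons -IH -bm_intD //; last exact: bm_sum.
by apply: eq_Rintegral => x _; rewrite big_cons.
Qed.

Lemma bm_int_le f g : bm f -> bm g -> (forall x, f x <= g x) ->
  \int[P]_x f x <= \int[P]_x g x.
Proof. by move=> bf bg fg; apply: le_Rintegral => //; exact: bm_integrable. Qed.

Lemma bm_int_norm f M : bm f -> (forall x, `|f x| <= M) ->
  `|\int[P]_x f x| <= M.
Proof.
move=> bf fM; rewrite ler_norml -[- M]prob_int_cst -[X in _ && (_ <= X)]prob_int_cst.
apply/andP; split; apply: bm_int_le => //; try exact: bm_cst;
  by move=> x; have := fM x; rewrite ler_norml => /andP[].
Qed.

Lemma int_indic (A : set T) : measurable A -> \int[P]_x (\1_A x) = fine (P A).
Proof. by move=> mA; rewrite /Rintegral integral_indic // setIT. Qed.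

(** The bridge from integrals of bounded majorants, in terms of which all the
    estimates are made, to the probability of an event. *)
Lemma prob_le_int (A : set T) (f : T -> R) : measurable A -> bm f ->
  (forall x, 0 <= f x) -> (forall x, A x -> 1 <= f x) ->
  (P A <= (\int[P]_x f x)%:E)%E.
Proof.
move=> mA bf f0 f1.
rewrite -[P A]fineK; last exact: fin_num_measure.
rewrite lee_fin -int_indic //; apply: bm_int_le => //; first exact: bm_indic.
move=> x; rewrite indicE; have [/set_mem /f1 //|_] := boolP (x \in A).
exact: f0.
Qed.

End bounded_measurable.

Section comp.
Context (d d' : measure_display) (T : measurableType d) (T' : measurableType d').
Context (R : realType).

Lemma bm_comp (f : T' -> R) (X : T -> T') :
  measurable_fun setT X -> bm f -> bm (fun x => f (X x)).
Proof.
move=> mX [mf [M fM]]; split; last by exists M => x; exact: fM.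
exact: (measurableT_comp mf mX).
Qed.

End comp.

Section approximation.
Context (R : realType).
Implicit Types f g : R -> R.

(** Bounded measurable functions are uniform limits of simple functions, obtained
    by slicing the range of [f] into layers of height [1/N]; the bounds by [C]
    make both functionals continuous for uniform convergence. *)
Lemma bm_functional_eq (L1 L2 : (R -> R) -> R) (C : R) :
  (forall f g, bm f -> bm g -> L1 (fun x => f x + g x) = L1 f + L1 g) ->
  (forall f g, bm f -> bm g -> L2 (fun x => f x + g x) = L2 f + L2 g) ->
  (forall c f, bm f -> L1 (fun x => c * f x) = c * L1 f) ->
  (forall c f, bm f -> L2 (fun x => c * f x) = c * L2 f) ->
  (forall f (M : R), bm f -> (forall x, `|f x| <= M) -> `|L1 f| <= C * M) ->
  (forall f (M : R), bm f -> (forall x, `|f x| <= M) -> `|L2 f| <= C * M) ->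
  (forall A : set R, measurable A -> L1 \1_A = L2 \1_A) ->
  forall f, bm f -> L1 f = L2 f.
Proof.
move=> D1 D2 Z1 Z2 B1 B2 E f bf; have [mf [M fM]] := bf.
pose sl (N i : nat) := (fun x => N%:R * (f x + M)) @^-1` `[i%:R, i.+1%:R[%classic.
have msl N i : measurable (sl N i).
  rewrite -[sl N i]setTI; apply: measurable_funM => //.
  exact: measurable_funD.
pose app (N K : nat) x := \sum_(i < K) ((i%:R / N%:R - M) * \1_(sl N i) x).
have bt N i : bm (fun x => (i%:R / N%:R - M) * \1_(sl N i) x).
  by apply: bmZ; exact: bm_indic.
have bapp N K : bm (app N K) by apply: bm_sum => i; exact: bt.
have Lapp N K : L1 (app N K) = L2 (app N K).
  elim: K => [|K IH].
    have -> : app N 0%N = (fun x => 0 * (cst 0 : R -> R) x).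
      by apply/funext => x; rewrite /app big_ord0 mul0r.
    by rewrite Z1 ?Z2 ?mul0r //; exact: bm_cst.
  have -> : app N K.+1 =
      (fun x => app N K x + (K%:R / N%:R - M) * \1_(sl N K) x).
    by apply/funext => x; rewrite /app big_ord_recr.
  by rewrite D1 // D2 // IH Z1 ?Z2 ?E //; exact: bm_indic.
have M0 : 0 <= M by exact: le_trans (normr_ge0 _) (fM 0).
have C0 : 0 <= C.
  have h : `|L1 (fun=> 0)| <= C * 1.
    by apply: B1 => [|x]; [exact: bm_cst | rewrite normr0].
  by move: h; rewrite mulr1; apply: le_trans; exact: normr_ge0.
have near N : (0 < N)%N -> exists K, forall x, `|f x - app N K x| <= N%:R^-1.
  move=> N0; have NR : 0 < N%:R :> R by rewrite ltr0n.
  exists (Num.truncn (N%:R * (M + M))).+1 => x.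
  have /andP[f1 f2] : - M <= f x <= M by rewrite -ler_norml.
  set y := N%:R * (f x + M).
  have y0 : 0 <= y by apply: mulr_ge0; lra.
  have /andP[t1 t2] := truncn_itv y0.
  have tK : (Num.truncn y < (Num.truncn (N%:R * (M + M))).+1)%N.
    rewrite ltnS; apply: le_truncn; apply: ler_wpM2l; lra.
  rewrite /app (bigD1 (Ordinal tK)) //= big1 ?addr0; last first.
    move=> i ne; rewrite indicE memNset ?mulr0 //.
    rewrite /sl /preimage /= in_itv /= -/y => /andP[i1 i2].
    move/eqP: ne; apply; apply: val_inj => /=; apply/esym.
    by apply: truncn_def; apply/andP.
  rewrite indicE mem_set ?mulr1; last by rewrite /sl /= in_itv /= t1.
  have -> : f x = y / N%:R - M by rewrite /y mulrAC divff ?mul1r ?addrK // gt_eqF.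
  rewrite (_ : _ - _ - _ = (y - (Num.truncn y)%:R) / N%:R); last by ring.
  rewrite normrM normfV (ger0_norm (ltW NR)).
  rewrite ler_piMl ?invr_ge0 ?ltW //.
  rewrite ger0_norm ?subr_ge0 //.
  by move: t2; rewrite -natr1; lra.
have key N : (0 < N)%N -> `|L1 f - L2 f| <= (C + C) / N%:R.
  move=> N0; have [K nK] := near N N0.
  have bd : bm (fun x => f x - app N K x) by exact: bmB.
  have fE : f = (fun x => (f x - app N K x) + app N K x).
    by apply/funext => x; rewrite subrK.
  have h1 := B1 _ _ bd nK; have h2 := B2 _ _ bd nK.
  rewrite [in L1 f]fE [in L2 f]fE D1 // D2 // Lapp.
  set u := L1 _ in h1 *; set v := L2 _ in h2 *; set w := L2 _.
  have -> : u + w - (v + w) = u - v by ring.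
  by rewrite (le_trans (ler_normB _ _)) // mulrDl lerD.
apply/eqP; rewrite -subr_eq0 -normr_le0; apply/ler_addgt0Pr => e e0.
rewrite add0r.
have [N hN] : exists N : nat, (C + C) / e < N%:R.
  exists (Num.truncn ((C + C) / e)).+1; exact: truncnS_gt.
have N0 : (0 < N)%N.
  by rewrite -(ltr0n R) (le_lt_trans _ hN) // divr_ge0 ?addr_ge0 // ltW.
apply: le_trans (key N N0) _.
by rewrite ler_pdivrMr ?ltr0n // -ler_pdivrMl // mulrC ltW.
Qed.

End approximation.

(** * Integrals of products of independent variables *)

Section independence.
Context (d : measure_display) (T : measurableType d) (R : realType).
Context (P : probability T R) (mu : probability R R).
Context (X : nat -> {RV P >-> R}).
Hypothesis iidX : iid_with_law X mu.

Lemma measurable_RV j : measurable_fun setT (X j).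
Proof. exact: measurable_funPT. Qed.

Lemma int_law j (f : R -> R) : bm f -> \int[P]_w f (X j w) = \int[mu]_x f x.
Proof.
move=> bf; have [_ /(_ j) lawj] := iidX.
rewrite /Rintegral; congr fine.
have mf : measurable_fun setT (EFin \o f).
  by apply/measurable_EFinP; exact: bm_measurable bf.
have bi := bm_integrable P (bm_comp (@measurable_RV j) bf).
rewrite -(@integral_distribution _ _ _ _ _ P (X j) (EFin \o f) mf bi).
by apply: eq_measure_integral => A mA _; exact: lawj.
Qed.

Lemma int_prod_indic n (B : nat -> set R) : (forall j, measurable (B j)) ->
  \int[P]_w (\prod_(j < n) \1_(B j) (X j w)) = \prod_(j < n) \int[mu]_x \1_(B j) x.
Proof.
move=> mB; have [indep law] := iidX.
pose A : set T := [set w | forall j, j \in iota 0 n -> B j (X j w)].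
have mA : measurable A.
  have -> : A = \bigcap_j (if j \in iota 0 n then X j @^-1` B j else setT).
    apply/seteqP; split => w /= h j.
      by move=> _; case: ifPn => // /h.
    by have := h j I; case: ifP.
  apply: bigcapT_measurable => j; case: ifP => // _.
  by rewrite -[X in measurable X]setTI; exact: measurable_RV.
have -> : \int[P]_w (\prod_(j < n) \1_(B j) (X j w)) = \int[P]_w (\1_A w).
  apply: eq_Rintegral => w _; rewrite indicE.
  have [/set_mem h|/negP h] := boolP (w \in A).
    rewrite big1 // => j _; rewrite indicE mem_set //.
    by apply: h; rewrite mem_iota add0n leq0n ltn_ord.
  have [j Bj] : exists j : 'I_n, ~ B j (X j w).
    apply: contrapT => /forallNP h'; apply: h; apply/mem_set => j.
    rewrite mem_iota add0n => /andP[_ jn].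
    by have /contrapT := h' (Ordinal jn).
  by rewrite (bigD1 j) //= indicE memNset // mul0r.
rewrite int_indic // /A indep ?iota_uniq //.
have e j : P (X j @^-1` B j) = (\int[mu]_x \1_(B j) x)%:E.
  rewrite int_indic // fineK; last exact: fin_num_measure.
  exact: law.
under eq_bigr do rewrite e.
rewrite prodEFin /=.
by have -> : iota 0 n = index_iota 0 n; rewrite ?big_mkord // /index_iota subn0.
Qed.

(** Independence upgrades from events to bounded functions one coordinate at a
    time: with the other factors fixed, both sides are bounded linear
    functionals of the remaining one. *)
Lemma int_prod_indep n (f : nat -> R -> R) : (forall j, bm (f j)) ->
  \int[P]_w (\prod_(j < n) f j (X j w)) = \prod_(j < n) \int[mu]_x f j x.
Proof.
move=> bf.
(* Induction on the number [k] of factors that need not be indicators. *)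
have H k : forall g : nat -> R -> R, (forall j, bm (g j)) ->
    (forall j, (k <= j)%N -> exists2 B, measurable B & g j = \1_B) ->
    \int[P]_w (\prod_(j < n) g j (X j w)) = \prod_(j < n) \int[mu]_x g j x.
  elim: k => [|k IH] g bg ind.
    have /choice[B BP] : forall j, exists B, measurable B /\ g j = \1_B.
      by move=> j; have [//|B mB gB] := ind j; exists B.
    have -> : g = (fun j => \1_(B j)) by apply/funext => j; case: (BP j).
    by apply: int_prod_indic => j; case: (BP j).
  have [kn|nk] := ltnP k n; last first.
    pose g' j := if (j < k)%N then g j else \1_setT : R -> R.
    have gE (j : 'I_n) : g j = g' j by rewrite /g' (leq_trans (ltn_ord j) nk).
    transitivity (\int[P]_w (\prod_(j < n) g' j (X j w))).
      by apply: eq_Rintegral => w _; apply: eq_bigr => j _; rewrite gE.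
    rewrite IH.
    - by apply: eq_bigr => j _; rewrite gE.
    - by move=> j; rewrite /g'; case: ifP => // _; exact: bm_indic.
    - by move=> j kj; rewrite /g' ltnNge kj; exists setT.
  pose K := Ordinal kn.
  pose up (phi : R -> R) j := if j == k then phi else g j.
  have bup phi j : bm phi -> bm (up phi j) by rewrite /up; case: ifP.
  pose G w := \prod_(j < n | j != K) g j (X j w).
  pose c := \prod_(j < n | j != K) \int[mu]_x g j x.
  have LE phi w : \prod_(j < n) up phi j (X j w) = phi (X k w) * G w.
    rewrite (bigD1 K) //= {1}/up eqxx; congr (_ * _).
    by apply: eq_bigr => j /negbTE jK; rewrite /up -[k]/(val K) val_eqE jK.
  have RE phi : \prod_(j < n) \int[mu]_x up phi j x = \int[mu]_x phi x * c.
    rewrite (bigD1 K) //= {1}/up eqxx; congr (_ * _).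
    by apply: eq_bigr => j /negbTE jK; rewrite /up -[k]/(val K) val_eqE jK.
  have bX j phi : bm phi -> bm (fun w => phi (X j w)).
    by move=> ?; apply: bm_comp => //; exact: measurable_RV.
  have bG : bm G.
    have -> : G = fun w => \prod_(j < n) if j != K then g j (X j w) else 1.
      by apply/funext => w; rewrite /G big_mkcond.
    apply: bm_prod => j; case: (j != K); last exact: bm_cst.
    exact: bX.
  have gup : g = up (g k) by apply/funext => j; rewrite /up; case: eqP => [->|].
  rewrite gup RE.
  under eq_Rintegral do rewrite LE.
  have [M0 GM] := bG.2.
  apply: (@bm_functional_eq _ (fun phi => \int[P]_w (phi (X k w) * G w))
    (fun phi => \int[mu]_x phi x * c) (`|c| + `|M0|)) => //.
  - move=> f1 f2 b1 b2; under eq_Rintegral do rewrite mulrDl.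
    by rewrite bm_intD //; apply: bmM => //; exact: bX.
  - by move=> f1 f2 b1 b2; rewrite bm_intD // mulrDl.
  - move=> a f1 b1; under eq_Rintegral do rewrite -mulrA.
    by rewrite bm_intZ //; apply: bmM => //; exact: bX.
  - by move=> a f1 b1; rewrite bm_intZ // mulrA.
  - move=> f1 M b1 fM; apply: bm_int_norm => [|w].
      by apply: bmM => //; exact: bX.
    rewrite normrM mulrC ler_pM // (le_trans (GM w)) //.
    by rewrite (le_trans (ler_norm _)) // lerDr.
  - move=> f1 M b1 fM; rewrite normrM mulrC ler_pM // ?lerDl //.
    exact: bm_int_norm.
  - move=> A mA; have := IH (up \1_A).
    rewrite RE => <-.
    + by apply: eq_Rintegral => w _; rewrite LE.
    + by move=> j; apply: bup; exact: bm_indic.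
    + move=> j kj; rewrite /up; case: eqP => [_|/eqP jk]; first by exists A.
      by apply: ind; rewrite ltn_neqAle eq_sym jk.
pose g j := if (j < n)%N then f j else \1_setT : R -> R.
have gE (j : 'I_n) : f j = g j by rewrite /g ltn_ord.
transitivity (\int[P]_w (\prod_(j < n) g j (X j w))).
  by apply: eq_Rintegral => w _; apply: eq_bigr => j _; rewrite gE.
rewrite (H n).
- by apply: eq_bigr => j _; rewrite gE.
- by move=> j; rewrite /g; case: ifP => // _; exact: bm_indic.
- by move=> j nj; rewrite /g ltnNge nj; exists setT.
Qed.

End independence.

(** * Trigonometric inequalities and characteristic functions *)

Section elementary.
Context (R : realType).
Implicit Types x y a b : R.

(** The product of the right-hand side with [1 - x + x^2] is
    [1 + x^2 + x^4 >= 1], and [1 - x + x^2 <= expR (x^2 - x)]. As the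
    left-hand side is bounded, this gives exponential estimates for variables with
    two moments only. *)
Lemma expR_sub_sqr_le x : expR (x - x ^+ 2) <= 1 + x + x ^+ 2.
Proof.
have h := expR_ge1Dx (x ^+ 2 - x).
have p : 0 < 1 - x + x ^+ 2 by nra.
have -> : x - x ^+ 2 = - (x ^+ 2 - x) by ring.
rewrite expRN -[leLHS]div1r ler_pdivrMr ?expR_gt0 //.
apply: (@le_trans _ _ ((1 + x + x ^+ 2) * (1 + (x ^+ 2 - x)))); first nra.
by apply: ler_wpM2l => //; nra.
Qed.

Lemma sin_le x : 0 <= x -> sin x <= x.
Proof.
rewrite le_eqVlt => /predU1P[<-|x0]; first by rewrite sin0.
have [c _] := @MVT R sin cos 0 x x0 (fun z _ => is_derive_sin z)
  (continuous_subspaceT (@continuous_sin R)).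
rewrite sin0 !subr0 => ->.
by rewrite ler_piMl ?cos_le1 // ltW.
Qed.

Lemma normr_sin_le x : `|sin x| <= `|x|.
Proof.
wlog x0 : x / 0 <= x.
  by move=> h; have [/h //|/ltW x0] := leP 0 x; rewrite -normrN -sinN -[leRHS]normrN h // oppr_ge0.
have [h|h] := leP 0 (sin x); first by rewrite ger0_norm // ger0_norm // sin_le.
have [x1|x1] := leP 1 x; first by rewrite (le_trans (sin_max x)) // ger0_norm.
have : 0 <= sin x; last by rewrite leNgt h.
apply: sin_ge0_pi; rewrite x0 /=; have := @pi_ge2 R; lra.
Qed.

Lemma cosE_half x : cos x = 1 - 2 * sin (x / 2) ^+ 2.
Proof.
have {1}-> : x = (x / 2) *+ 2 by rewrite mulr2n; field.
rewrite cos_mulr2n cos2sin2 mulr2n; ring.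
Qed.

Lemma onesubcos_le x : 1 - cos x <= x ^+ 2 / 2.
Proof.
rewrite cosE_half.
have : sin (x / 2) ^+ 2 <= (x / 2) ^+ 2.
  by rewrite -[leLHS]real_normK ?num_real // -[leRHS]real_normK ?num_real // ler_pXn2r ?nnegrE // normr_sin_le.
nra.
Qed.

Lemma cos_ge_half x : `|x| <= 1 -> 1 / 2 <= cos x.
Proof.
move=> h; have := onesubcos_le x.
have : x ^+ 2 <= 1 by rewrite -[leLHS]real_normK ?num_real // expr_le1.
lra.
Qed.

Lemma sin_ge_half x : 0 <= x <= 1 -> x / 2 <= sin x.
Proof.
case/andP; rewrite le_eqVlt => /predU1P[<-|x0] x1; first by rewrite sin0 mul0r.
have [c] := @MVT R sin cos 0 x x0 (fun z _ => is_derive_sin z)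
  (continuous_subspaceT (@continuous_sin R)).
rewrite in_itv /= => /andP[c0 cx]; rewrite sin0 !subr0 => ->.
have : 1 / 2 <= cos c by apply: cos_ge_half; rewrite ger0_norm; lra.
nra.
Qed.

Lemma normr_sin_ge_half x : `|x| <= 1 -> `|x| / 2 <= `|sin x|.
Proof.
wlog x0 : x / 0 <= x.
  by move=> h; have [/h //|/ltW x0] := leP 0 x; rewrite -normrN -(normrN (sin x)) -sinN; apply: h; rewrite oppr_ge0.
rewrite ger0_norm // => x1.
by apply: le_trans (ler_norm _); apply: sin_ge_half; rewrite x0.
Qed.

End elementary.

Section trig_measurable.
Context (d : measure_display) (T : measurableType d) (R : realType).

Lemma bm_cos (f : T -> R) : measurable_fun setT f -> bm (fun x => cos (f x)).
Proof.
move=> mf; split; last by exists 1 => x; exact: cos_max.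
apply: (measurableT_comp _ mf); apply: continuous_measurable_fun.
exact: continuous_cos.
Qed.

Lemma bm_sin (f : T -> R) : measurable_fun setT f -> bm (fun x => sin (f x)).
Proof.
move=> mf; split; last by exists 1 => x; exact: sin_max.
apply: (measurableT_comp _ mf); apply: continuous_measurable_fun.
exact: continuous_sin.
Qed.

Lemma measurable_scale (a : R) : measurable_fun setT (fun x : R => a * x).
Proof. exact: mulrl_measurable. Qed.

End trig_measurable.

Section characteristic.
Context (R : realType) (mu : probability R R).

(** The squared modulus of the characteristic function of [mu]. *)
Definition chf2 (u : R) : R :=
  (\int[mu]_x cos (u * x)) ^+ 2 + (\int[mu]_x sin (u * x)) ^+ 2.

Lemma chf2_ge0 u : 0 <= chf2 u.
Proof. by rewrite addr_ge0 ?sqr_ge0. Qed.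

Let bc u : bm (fun x : R => cos (u * x)).
Proof. by apply: bm_cos; exact: measurable_scale. Qed.
Let bs u : bm (fun x : R => sin (u * x)).
Proof. by apply: bm_sin; exact: measurable_scale. Qed.

Lemma int_cos_shift u x : \int[mu]_y (1 - cos (u * (x - y))) =
  1 - (cos (u * x) * \int[mu]_y cos (u * y) + sin (u * x) * \int[mu]_y sin (u * y)).
Proof.
rewrite -!bm_intZ // -bm_intD; [|exact: bmZ|exact: bmZ].
rewrite -[X in _ = X - _](prob_int_cst mu) -bm_intB; last 2 first.
- exact: bm_cst.
- by apply: bmD; exact: bmZ.
by apply: eq_Rintegral => y _; rewrite mulrBr cosB.
Qed.

(** [1 - |phi(u)|^2] is the mean of [1 - cos (u (x - y))] over independent
    [x], [y]; the inner integral is explicit, so no product measure occurs. *)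
Lemma onesub_chf2 u :
  1 - chf2 u = \int[mu]_x \int[mu]_y (1 - cos (u * (x - y))).
Proof.
under eq_Rintegral do rewrite int_cos_shift.
have b1 : bm (fun x : R => cos (u * x) * \int[mu]_y cos (u * y)).
  by apply: bmM => //; exact: bm_cst.
have b2 : bm (fun x : R => sin (u * x) * \int[mu]_y sin (u * y)).
  by apply: bmM => //; exact: bm_cst.
rewrite bm_intB; [|exact: bm_cst|exact: bmD].
rewrite bm_intD // prob_int_cst /chf2 !expr2.
by congr (_ - (_ + _)); rewrite -bm_intZ //; apply: eq_Rintegral => x _; rewrite mulrC.
Qed.

Variables (M gamma q : R).
Hypothesis q01 : 0 < q < 1.
Hypothesis conc : forall u, (mu [set x | `|x - u| <= gamma]%R <= (1 - q)%:E)%E.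
Hypothesis tail : (mu [set x | (M < `|x|)%R] <= (q / 2)%:E)%E.

Let mle (f : R -> R) (c : R) : measurable_fun setT f -> measurable [set x : R | f x <= c].
Proof.
move=> mf; rewrite -[X in measurable X]setTI.
have := measurable_fun_ler mf (measurable_cst c) measurableT (Y := [set true]).
by move=> /(_ I); congr measurable; apply/seteqP; split => x /=; case.
Qed.

Let mdist u : measurable_fun setT (fun x : R => `|x - u|).
Proof.
by apply: (measurableT_comp (@normr_measurable R setT)); apply: measurable_funB.
Qed.

Let mball : measurable [set x : R | `|x| <= M].
Proof. by apply: mle; exact: normr_measurable. Qed.

Let massM : 1 - q / 2 <= fine (mu [set x | `|x| <= M]).
Proof.
have -> : [set x : R | `|x| <= M] = ~` [set x | M < `|x|].
  by apply/seteqP; split => x /=; rewrite ltNge => /negP; rewrite ?negbK //; case: (_ <= _).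
have mC : measurable [set x : R | M < `|x|].
  rewrite (_ : [set x : R | M < `|x|] = ~` [set x | `|x| <= M]); last first.
    by apply/seteqP; split => x /=; rewrite ltNge; case: (_ <= _).
  exact: measurableC.
rewrite probability_setC // fineB ?fin_num_measure //= lerD2l lerN2 //.
by rewrite -lee_fin fineK ?fin_num_measure.
Qed.

Let far x : set R := [set y | `|y| <= M] `\` [set y | `|y - x| <= gamma].

Let mfar x : measurable (far x).
Proof. by apply: measurableD => //; exact: mle. Qed.

Let massfar x : q / 2 <= fine (mu (far x)).
Proof.
have h : fine (mu [set y | `|y| <= M]) <= fine (mu (far x)) + (1 - q).
  rewrite -lee_fin EFinD !fineK ?fin_num_measure //.
  apply: (@le_trans _ _ (mu (far x) + mu [set y | (`|y - x| <= gamma)%R])%E).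
    apply: (@le_trans _ _ (mu (far x `|` [set y | `|y - x| <= gamma])));
      last by apply: measureU2 => //; exact: mle.
    apply: le_measure; rewrite ?inE //.
    by apply: measurableU => //; exact: mle.
    by move=> y /= yM; have [h|/negP h] := boolP (`|y - x| <= gamma);
      [right|left].
  by apply: leeD2l; exact: conc.
have := massM; lra.
Qed.

(** A lower bound for the probability that two independent copies are at
    distance between [gamma] and [2 M]. *)
Definition pair_mass : R := (1 - q / 2) * (q / 2).

Lemma pair_mass_gt0 : 0 < pair_mass.
Proof. by case/andP: q01 => ? ?; rewrite /pair_mass mulr_gt0 //; lra. Qed.

(** Since [t <= exp (- (1 - t))], it suffices to bound the sum of the
    [1 - chf2 (u j)] below. By [onesub_chf2] this is the mean over independent
    [x] and [y] of the sum of the [1 - cos (u j * (x - y))], which is at least [B]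
    when [|x| <= M] and [y] is in [far x]: the tail bound gives mass [1 - q / 2]
    to such [x], and then concentration leaves mass [q / 2] to such [y]. *)
Lemma chf2_prod_le n (u : nat -> R) (B : R) : 0 <= B ->
  (forall v : R, gamma <= `|v| <= M + M -> B <= \sum_(j < n) (1 - cos (u j * v))) ->
  \prod_(j < n) chf2 (u j) <= expR (- (pair_mass * B)).
Proof.
move=> B0 hB; have [q0 q1] : 0 < q /\ q < 1 by apply/andP.
have cosm1 z : 0 <= 1 - cos z :> R by rewrite subr_ge0 cos_le1.
have b1 (v x : R) : bm (fun y : R => 1 - cos (v * (x - y))).
  apply: bmB; first exact: bm_cst.
  by apply: bm_cos; apply: measurable_funM => //; apply: measurable_funB.
pose I (x : R) := \int[mu]_y \sum_(j < n) (1 - cos (u j * (x - y))).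
have IE x : I x = \sum_(j < n) \int[mu]_y (1 - cos (u j * (x - y))).
  by rewrite /I bm_int_sum.
have bI1 (v : R) : bm (fun x : R => \int[mu]_y (1 - cos (v * (x - y)))).
  have := bmB (bm_cst _ 1) (bmD (bmM (bc v) (bm_cst _ (\int[mu]_y cos (v * y))))
    (bmM (bs v) (bm_cst _ (\int[mu]_y sin (v * y))))).
  by congr bm; apply/funext => x; rewrite int_cos_shift.
have bI : bm I.
  have := @bm_sum _ _ _ _ (index_enum 'I_n) _ (fun j : 'I_n => bI1 (u j)).
  by congr bm; apply/funext => x; rewrite IE.
have I0 x : 0 <= I x by apply: Rintegral_ge0 => y _; rewrite sumr_ge0.
have Ilow x : `|x| <= M -> q / 2 * B <= I x.
  move=> xM; apply: (@le_trans _ _ (\int[mu]_y (B * \1_(far x) y))).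
    rewrite bm_intZ ?int_indic //; last exact: bm_indic.
    by rewrite mulrC ler_wpM2l.
  apply: bm_int_le; first by apply: bmZ; exact: bm_indic.
    by apply: bm_sum => j.
  move=> y; rewrite indicE; have [/set_mem[/= yM /negP]|_] := boolP (y \in far x).
    rewrite -ltNge distrC mulr1 => xy; apply: hB; rewrite (ltW xy) /=.
    by rewrite (le_trans (ler_normB _ _)) // lerD.
  by rewrite mulr0 sumr_ge0.
have tot : pair_mass * B <= \sum_(j < n) (1 - chf2 (u j)).
  under eq_bigr do rewrite onesub_chf2.
  rewrite -bm_int_sum //; apply: (@le_trans _ _ (\int[mu]_x
      ((q / 2 * B) * \1_[set x | `|x| <= M] x))).
    rewrite bm_intZ ?int_indic //; last exact: bm_indic.
    rewrite /pair_mass (_ : _ * B = q / 2 * B * (1 - q / 2)); last by ring.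
    rewrite ler_wpM2l //.
    by rewrite mulr_ge0 // divr_ge0 // ltW.
  apply: bm_int_le; first by apply: bmZ; exact: bm_indic.
    by apply: bm_sum => j.
  move=> x; rewrite indicE -IE; have [/set_mem /= xM|_] := boolP (x \in _).
    by rewrite mulr1 Ilow.
  by rewrite mulr0.
apply: (@le_trans _ _ (\prod_(j < n) expR (- (1 - chf2 (u j))))).
  apply: ler_prod => j _; rewrite chf2_ge0 /=.
  by have := expR_ge1Dx (- (1 - chf2 (u j))); lra.
by rewrite -expR_sum ler_expR sumrN lerN2.
Qed.

End characteristic.

(** * Linear forms in independent variables *)

Section linear_forms.
Context (d : measure_display) (T : measurableType d) (R : realType).
Context (P : probability T R) (mu : probability R R).
Context (X : nat -> {RV P >-> R}).
Hypothesis iidX : iid_with_law X mu.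

Definition lform (n : nat) (a : nat -> R) (w : T) : R := \sum_(j < n) a j * X j w.

Lemma measurable_lform n a : measurable_fun setT (lform n a).
Proof.
rewrite /lform; apply: measurable_sum => j; by apply: measurable_funM.
Qed.

(** The class of functions to which independence of products extends by
    linearity; it contains [cos] and [sin] of linear forms. The list of summands
    consists of functions, whose equality is not decidable, hence [List.In]. *)
Definition separable (n : nat) (F : (nat -> R) -> R) : Prop :=
  exists s : seq (nat -> R -> R), (forall f, List.In f s -> forall j, bm (f j)) /\
    forall x, F x = \sum_(f <- s) \prod_(j < n) f j (x j).

Lemma separableD n F G : separable n F -> separable n G ->
  separable n (fun x => F x + G x).
Proof.
move=> [s [bs Fs]] [t [bt Gt]]; exists (s ++ t); split.
  by move=> f /List.in_app_iff[/bs|/bt].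
by move=> x; rewrite big_cat /= Fs Gt.
Qed.

Let extend n (phi : R -> R) (f : nat -> R -> R) j := if j == n then phi else f j.

Let extendE n phi f (x : nat -> R) :
  \prod_(j < n.+1) extend n phi f j (x j) = (\prod_(j < n) f j (x j)) * phi (x n).
Proof.
rewrite big_ord_recr /= /extend eqxx; congr (_ * _).
by apply: eq_bigr => j _; rewrite ltn_eqF.
Qed.

Lemma separable_extend n F phi : separable n F -> bm phi ->
  separable n.+1 (fun x => F x * phi (x n)).
Proof.
move=> [s [bs Fs]] bphi; exists (map (extend n phi) s); split.
  move=> f /List.in_map_iff[g [<- /bs bg] j].
  by rewrite /extend; case: ifP.
move=> x; rewrite Fs big_map mulr_suml; apply: eq_bigr => f _.
by rewrite extendE.
Qed.

Lemma separable_bm n F : separable n F -> bm (fun w => F (X ^~ w)).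
Proof.
move=> [s [bs Fs]].
rewrite (_ : (fun w => _) = (fun w => \sum_(f <- s) \prod_(j < n) f j (X j w)));
  last by apply/funext => w; rewrite Fs.
elim: s bs {Fs} => [|f s IH] bs.
  by have := bm_cst T (0 : R); congr bm; apply/funext => w; rewrite big_nil.
have bf : bm (fun w => \prod_(j < n) f j (X j w)).
  apply: bm_prod => j; apply: bm_comp; first exact: measurable_RV.
  by apply: bs; left.
have := bmD bf (IH (fun g gs => bs g (or_intror gs))).
by congr bm; apply/funext => w; rewrite big_cons.
Qed.

Lemma int_separable n F phi : separable n F -> bm phi ->
  \int[P]_w (F (X ^~ w) * phi (X n w)) =
  \int[P]_w F (X ^~ w) * \int[mu]_x phi x.
Proof.
move=> [s [bs Fs]] bphi.
under eq_Rintegral do rewrite Fs.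
under [in RHS]eq_Rintegral do rewrite Fs.
elim: s bs {Fs} => [|f s IH] bs.
  transitivity (\int[P]_w (0 : R)).
    by apply: eq_Rintegral => w _; rewrite big_nil mul0r.
  rewrite prob_int_cst (_ : \int[P]_w _ = 0) ?mul0r //.
  rewrite -[RHS](prob_int_cst P 0).
  by apply: eq_Rintegral => w _; rewrite big_nil.
have bfs : forall g, List.In g s -> forall j, bm (g j).
  by move=> g gs; apply: bs; right.
have bf j : bm (f j) by apply: bs; left.
have bsep (t : seq (nat -> R -> R)) : (forall g, List.In g t -> forall j, bm (g j)) ->
    bm (fun w => \sum_(g <- t) \prod_(j < n) g j (X j w)).
  move=> bt; apply: (@separable_bm n (fun x => \sum_(g <- t) \prod_(j < n) g j (x j))).
  by exists t.
have bX : bm (fun w => phi (X n w)).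
  by apply: bm_comp => //; exact: measurable_RV.
have bpf : bm (fun w => \prod_(j < n) f j (X j w)).
  by apply: bm_prod => j; apply: bm_comp => //; exact: measurable_RV.
have L : \int[P]_w ((\prod_(j < n) f j (X j w)) * phi (X n w)) =
    (\int[P]_w \prod_(j < n) f j (X j w)) * \int[mu]_x phi x.
  under eq_Rintegral do rewrite -(extendE n phi f (X ^~ _)).
  rewrite (int_prod_indep iidX) ?(int_prod_indep iidX) //; last first.
    by move=> j; rewrite /extend; case: ifP.
  rewrite big_ord_recr /= {2}/extend eqxx; congr (_ * _).
  by apply: eq_bigr => j _; rewrite /extend ltn_eqF.
transitivity (\int[P]_w ((\prod_(j < n) f j (X j w)) * phi (X n w) +
    (\sum_(g <- s) \prod_(j < n) g j (X j w)) * phi (X n w))).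
  by apply: eq_Rintegral => w _; rewrite big_cons mulrDl.
rewrite bm_intD ?L ?IH //; [|exact: bmM|by apply: bmM => //; exact: bsep].
rewrite -mulrDl -bm_intD //; last exact: bsep.
by congr (_ * _); apply: eq_Rintegral => w _; rewrite big_cons.
Qed.

Let bc u : bm (fun x : R => cos (u * x)).
Proof. by apply: bm_cos; exact: measurable_scale. Qed.
Let bs u : bm (fun x : R => sin (u * x)).
Proof. by apply: bm_sin; exact: measurable_scale. Qed.

Let sep_cs (a : nat -> R) n :
  separable n (fun x => cos (\sum_(j < n) a j * x j)) /\
  separable n (fun x => sin (\sum_(j < n) a j * x j)).
Proof.
elim: n => [|n [IHc IHs]].
  split.
    exists [:: fun _ _ => 1]; split.
      by move=> f [<-|//] j; exact: bm_cst.
    by move=> x; rewrite big_seq1 !big_ord0 cos0.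
  exists [::]; split => // x.
  by rewrite big_nil !big_ord0 sin0.
split.
  have := separableD (separable_extend IHc (bc (a n)))
     (separable_extend IHs (bmN (bs (a n)))).
  by congr separable; apply/funext => x; rewrite big_ord_recr /= cosD mulrN.
have := separableD (separable_extend IHs (bc (a n)))
   (separable_extend IHc (bs (a n))).
by congr separable; apply/funext => x; rewrite big_ord_recr /= sinD.
Qed.

Lemma bm_cos_lform n a : bm (fun w => cos (lform n a w)).
Proof. by apply: bm_cos; exact: measurable_lform. Qed.

Lemma bm_sin_lform n a : bm (fun w => sin (lform n a w)).
Proof. by apply: bm_sin; exact: measurable_lform. Qed.

(** By the addition formulas, adding a term to the form multiplies the complex
    number with real and imaginary parts the integrals of [cos] and [sin] by a
    complex number whose squared modulus is [chf2 mu (a n)]. *)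
Lemma chf2_lform n a :
  (\int[P]_w cos (lform n a w)) ^+ 2 + (\int[P]_w sin (lform n a w)) ^+ 2 =
  \prod_(j < n) chf2 mu (a j).
Proof.
elim: n => [|n IH].
  rewrite big_ord0.
  under eq_Rintegral do rewrite /lform big_ord0 cos0.
  under [X in _ + X ^+ 2]eq_Rintegral do rewrite /lform big_ord0 sin0.
  by rewrite !prob_int_cst expr1n expr0n addr0.
have [sc ss] := sep_cs a n.
have bX (phi : R -> R) : bm phi -> bm (fun w => phi (X n w)).
  by move=> ?; apply: bm_comp => //; exact: measurable_RV.
have bcX := bX _ (bc (a n)); have bsX := bX _ (bs (a n)).
have e w : lform n.+1 a w = lform n a w + a n * X n w.
  by rewrite /lform big_ord_recr.
under eq_Rintegral do rewrite e cosD.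
under [X in _ + X ^+ 2]eq_Rintegral do rewrite e sinD.
have bcl := bm_cos_lform n a; have bsl := bm_sin_lform n a.
rewrite bm_intB ?bm_intD; try exact: bmM.
rewrite (int_separable sc (bc _)) (int_separable ss (bs _)).
rewrite (int_separable ss (bc _)) (int_separable sc (bs _)).
rewrite big_ord_recr /= -IH /chf2 /lform; ring.
Qed.

Lemma int_cos_lform_le n a :
  \int[P]_w cos (lform n a w) <= Num.sqrt (\prod_(j < n) chf2 mu (a j)).
Proof.
rewrite -chf2_lform (le_trans (ler_norm _)) // -sqrtr_sqr.
by apply: ler_wsqrtr; rewrite lerDl sqr_ge0.
Qed.

(** A discrete form of Esseen's inequality. On the event that all the linear
    forms indexed by [I] are at most [1], every [cos] is at least [1/2], so the
    exponential sum over [I] has real part at least [#|I|/2]; the mean of its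
    squared modulus is a sum of characteristic functions at the differences. *)
Lemma discrete_esseen n (I : finType) (u : I -> nat -> R) (B : R) : (0 < #|I|)%N ->
  (forall i', \sum_(i : I) Num.sqrt (\prod_(j < n) chf2 mu (u i j - u i' j)) <= B) ->
  exists K : T -> R, [/\ bm K, forall w, 0 <= K w,
    forall w, (forall i, `|lform n (u i) w| <= 1) -> 1 <= K w
    & \int[P]_w K w <= 4 * B / #|I|%:R].
Proof.
move=> I0 hB; have NI0 : 0 < #|I|%:R :> R by rewrite ltr0n.
set N := #|I|%:R in NI0 *.
pose C w := \sum_(i : I) cos (lform n (u i) w).
pose S w := \sum_(i : I) sin (lform n (u i) w).
have bC : bm C by apply: bm_sum => i; exact: bm_cos_lform.
have bS : bm S by apply: bm_sum => i; exact: bm_sin_lform.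
exists (fun w => 4 / N ^+ 2 * (C w * C w + S w * S w)); split.
- by apply: bmZ; apply: bmD; apply: bmM.
- move=> w; rewrite mulr_ge0 ?divr_ge0 ?sqr_ge0 //.
  by rewrite addr_ge0 // -expr2 sqr_ge0.
- move=> w h; have C1 : N / 2 <= C w.
    have -> : N / 2 = \sum_(i : I) 1 / 2.
      by rewrite sumr_const -mulr_natr -/N; ring.
    by apply: ler_sum => i _; exact: cos_ge_half.
  rewrite mulrAC ler_pdivlMr ?exprn_gt0 // mul1r.
  have : (N / 2) * (N / 2) <= C w * C w by rewrite ler_pM // divr_ge0 // ltW.
  have : 0 <= S w * S w by rewrite -expr2 sqr_ge0.
  rewrite expr2; lra.
have E w : C w * C w + S w * S w =
    \sum_(i' : I) \sum_(i : I) cos (lform n (fun j => u i j - u i' j) w).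
  rewrite /C /S !mulr_sumr -big_split /=; apply: eq_bigr => i' _.
  rewrite !mulr_suml -big_split /=; apply: eq_bigr => i _.
  rewrite -cosB; congr cos; rewrite /lform -sumrB; apply: eq_bigr => j _.
  by rewrite mulrBl.
have b1 (i i' : I) : bm (fun w => cos (lform n (fun j => u i j - u i' j) w)).
  exact: bm_cos_lform.
have b2 (i' : I) : bm (fun w => \sum_(i : I) cos (lform n (fun j => u i j - u i' j) w)).
  by apply: bm_sum => i.
rewrite bm_intZ; last by apply: bmD; apply: bmM.
under eq_Rintegral do rewrite E.
rewrite bm_int_sum //.
have : \sum_(i' : I) \int[P]_w (\sum_(i : I) cos (lform n (fun j => u i j - u i' j) w))
    <= \sum_(i' : I) B.
  apply: ler_sum => i' _; rewrite bm_int_sum //; apply: le_trans (hB i').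
  by apply: ler_sum => i _; exact: int_cos_lform_le.
rewrite sumr_const -mulr_natr -/N => h.
apply: le_trans (ler_wpM2l _ h) _; first by rewrite divr_ge0 ?sqr_ge0.
by rewrite le_eqVlt; apply/predU1P; left; field; rewrite gt_eqF.
Qed.

Variable s2 : R.
Hypothesis intX2 : mu.-integrable setT (fun x => (x ^+ 2)%:E).
Hypothesis s2E : \int[mu]_x (x ^+ 2) = s2.
Hypothesis int1 : mu.-integrable setT (fun x => x%:E).
Hypothesis mean0 : \int[mu]_x x = 0.

Let fexp (b : R) (x : R) := expR (b * x - (b * x) ^+ 2).

Let bm_fexp b : bm (fexp b).
Proof.
have mb : measurable_fun setT (fun x : R => b * x) by exact: measurable_scale.
split.
  apply: (measurableT_comp (@measurable_expR R)).
  apply: measurable_funB => //; exact: measurable_funX.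
exists (expR 1) => x; rewrite ger0_norm ?expR_ge0 // ler_expR; nra.
Qed.

Let int_fexp b : \int[mu]_x fexp b x <= expR (b ^+ 2 * s2).
Proof.
apply: (@le_trans _ _ (1 + b ^+ 2 * s2)); last exact: expR_ge1Dx.
have i1 : mu.-integrable setT (EFin \o (fun x => 1 + b * x)).
  have := integrableD measurableT (bm_integrable mu (bm_cst _ 1))
    (integrableZl measurableT b int1).
  by apply: eq_integrable.
have i2 : mu.-integrable setT (EFin \o (fun x => b ^+ 2 * x ^+ 2)).
  have := integrableZl measurableT (b ^+ 2) intX2.
  by apply: eq_integrable.
have -> : 1 + b ^+ 2 * s2 = \int[mu]_x ((1 + b * x) + b ^+ 2 * x ^+ 2).
  rewrite RintegralD // RintegralD //; last 2 first.
  - by apply: bm_integrable; exact: bm_cst.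
  - by have := integrableZl measurableT b int1; apply: eq_integrable.
  by rewrite !RintegralZl // mean0 s2E mulr0 addr0 prob_int_cst.
apply: le_Rintegral => //.
- by apply: bm_integrable; exact: bm_fexp.
- by have := integrableD measurableT i1 i2; apply: eq_integrable.
move=> x _; rewrite /fexp (le_trans (expR_sub_sqr_le _)) //.
by rewrite exprMn.
Qed.

(** A Chernoff bound with the random quadratic variation kept in the exponent:
    the factors [exp (b x - (b x)^2)] are bounded, and have mean at most
    [1 + b^2 s2] by [expR_sub_sqr_le] as soon as the second moment exists. *)
Lemma chernoff_lform n (b : nat -> R) (x y : R) :
  exists K : T -> R, [/\ bm K, forall w, 0 <= K w,
    forall w, x <= lform n b w -> \sum_(j < n) (b j * X j w) ^+ 2 <= y -> 1 <= K w
    & \int[P]_w K w <= expR (y - x + s2 * \sum_(j < n) b j ^+ 2)].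
Proof.
pose F w := \prod_(j < n) fexp (b j) (X j w).
have bF : bm F.
  apply: bm_prod => j; apply: bm_comp; last exact: bm_fexp.
  exact: measurable_RV.
exists (fun w => expR (y - x) * F w); split.
- exact: bmZ.
- by move=> w; rewrite mulr_ge0 ?expR_ge0 // prodr_ge0 // => j _; exact: expR_ge0.
- move=> w h1 h2.
  rewrite /F /fexp -expR_sum -expRD -{1}expR0 ler_expR.
  by move: h1 h2; rewrite sumrB /lform; lra.
rewrite bm_intZ // (@int_prod_indep _ _ _ _ _ _ iidX n (fun j => fexp (b j))) //.
rewrite (expRD (y - x)) ler_wpM2l ?expR_ge0 // mulr_sumr expR_sum.
apply: ler_prod => j _; rewrite Rintegral_ge0 /=; last by move=> *; exact: expR_ge0.
by rewrite mulrC.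
Qed.

(** Markov's inequality for the quadratic variation, with truncated squares to
    stay among bounded functions. *)
Lemma markov_sqr n (A : R) : 0 < A ->
  exists K : T -> R, [/\ bm K, forall w, 0 <= K w,
    forall w, A < \sum_(j < n) (X j w) ^+ 2 -> 1 <= K w
    & \int[P]_w K w <= n%:R * s2 / A].
Proof.
move=> A0; pose g (x : R) := Num.min (x ^+ 2 / A) 1.
have g0 x : 0 <= g x by rewrite le_min ler01 divr_ge0 ?sqr_ge0 // ltW.
have bg : bm g.
  split; last by exists 1 => x; rewrite ger0_norm // ge_min lexx orbT.
  have mq : measurable_fun setT (fun x : R => x ^+ 2 / A).
    by apply: measurable_funM => //; exact: exprn_measurable.
  exact: (measurable_minr mq (measurable_cst (1 : R))).
have bX (j : 'I_n) : bm (fun w => g (X j w)).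
  by apply: bm_comp => //; exact: measurable_RV.
exists (fun w => \sum_(j < n) g (X j w)); split.
- exact: bm_sum.
- by move=> w; rewrite sumr_ge0.
- move=> w h.
  have [[j hj]|hall] := pselect (exists j : 'I_n, 1 <= (X j w) ^+ 2 / A).
    rewrite (bigD1 j) //= {1}/g min_r //.
    by rewrite lerDl sumr_ge0.
  have -> : \sum_(j < n) g (X j w) = (\sum_(j < n) (X j w) ^+ 2) / A.
    rewrite mulr_suml; apply: eq_bigr => j _; rewrite /g min_l //.
    by rewrite leNgt; apply/negP => /ltW ?; apply: hall; exists j.
  by rewrite ler_pdivlMr // mul1r ltW.
rewrite bm_int_sum //.
have h j : \int[P]_w g (X j w) <= s2 / A.
  rewrite (int_law iidX j bg) -s2E mulrC -RintegralZl //.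
  apply: le_Rintegral => //.
  - exact: bm_integrable.
  - by have := integrableZl measurableT (A^-1) intX2; apply: eq_integrable.
  by move=> x _; rewrite /g ge_min mulrC lexx.
apply: (@le_trans _ _ (\sum_(j < n) s2 / A)); first by apply: ler_sum.
by rewrite sumr_const card_ord -[leLHS]mulr_natl mulrA.
Qed.

End linear_forms.

(** * Energy of waves *)

Section waves.
Context (R : realType).
Implicit Types p q th x y : R.

Definition wave p q th (j : nat) : R := p * cos (j%:R * th) + q * sin (j%:R * th).

(** Half the sum of the [1 - cos (wave j)], which controls the
    characteristic function of a linear form with coefficients [wave j]. *)
Definition sin_energy p q th n : R := \sum_(j < n) sin (wave p q th j / 2) ^+ 2.

(** The squared distance from [1] to the point of angle [x] on the unit circle. *)
Definition chord2 x : R := 2 - 2 * cos x.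

Lemma chord2_ge0 x : 0 <= chord2 x.
Proof. by have := cos_le1 x; rewrite /chord2; lra. Qed.

Lemma sqr_sinB_le x y : sin (x - y) ^+ 2 <= 2 * sin x ^+ 2 + 2 * sin y ^+ 2.
Proof.
rewrite sinB; have := cos2Dsin2 x; have := cos2Dsin2 y.
set a := sin x; set b := sin y; set c := cos x; set d := cos y => h1 h2.
have : (a * d - c * b) ^+ 2 <= 2 * (a * d) ^+ 2 + 2 * (c * b) ^+ 2.
  by have := sqr_ge0 (a * d + c * b); nra.
rewrite !exprMn => h; apply: (le_trans h).
have : d ^+ 2 <= 1 by have := sqr_ge0 b; lra.
have : c ^+ 2 <= 1 by have := sqr_ge0 a; lra.
have := sqr_ge0 a; have := sqr_ge0 b; nra.
Qed.

Lemma wave_shift p q th s j : wave p q th (j + s) =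
  cos (s%:R * th) * wave p q th j
  + sin (s%:R * th) * (q * cos (j%:R * th) - p * sin (j%:R * th)).
Proof. rewrite /wave natrD mulrDl cosD sinD; ring. Qed.

(** Subtracting a wave from its translate by [s] gives a wave of the same
    frequency; these are its coefficients. *)
Definition diff_p p q th s : R := p * (cos (s%:R * th) - 1) + q * sin (s%:R * th).
Definition diff_q p q th s : R := q * (cos (s%:R * th) - 1) - p * sin (s%:R * th).

Lemma wave_diff p q th s j : wave p q th (j + s) - wave p q th j =
  wave (diff_p p q th s) (diff_q p q th s) th j.
Proof. rewrite wave_shift /wave /diff_p /diff_q; ring. Qed.

Lemma diff_norm p q th s :
  diff_p p q th s ^+ 2 + diff_q p q th s ^+ 2 =
  (p ^+ 2 + q ^+ 2) * chord2 (s%:R * th).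
Proof.
rewrite /diff_p /diff_q /chord2; have := cos2Dsin2 (s%:R * th).
set c := cos _; set t := sin _ => h.
have -> : 2 - 2 * c = (c - 1) ^+ 2 + t ^+ 2 by nra.
ring.
Qed.

Lemma sum_shift_le (F : nat -> R) s n : (forall j, 0 <= F j) ->
  \sum_(j < n) F (j + s)%N <= \sum_(j < n + s) F j.
Proof.
move=> F0; rewrite -(big_mkord xpredT (fun j => F (j + s)%N)).
rewrite -(big_mkord xpredT F) (big_cat_nat (leq0n s) (leq_addl n s)) /=.
have -> : \sum_(s <= j < n + s) F j = \sum_(0 <= j < n) F (j + s)%N.
  by rewrite -{1}[s]add0n big_addn addnK.
by rewrite lerDr sumr_ge0.
Qed.

Lemma sum_widen_le (F : nat -> R) m n : (m <= n)%N -> (forall j, 0 <= F j) ->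
  \sum_(j < m) F j <= \sum_(j < n) F j.
Proof.
move=> mn F0; rewrite -!(big_mkord xpredT) (big_cat_nat (leq0n m) mn) /=.
by rewrite lerDl sumr_ge0.
Qed.

(** Differencing along a step [s] costs a factor 4 since [|sin (x / 2)|] is
    subadditive, while it multiplies the amplitude by the chord of the step. *)
Lemma sin_energy_diff p q th s n :
  sin_energy (diff_p p q th s) (diff_q p q th s) th n <=
  4 * sin_energy p q th (n + s).
Proof.
rewrite /sin_energy.
pose F j := sin (wave p q th j / 2) ^+ 2.
have F0 j : 0 <= F j by exact: sqr_ge0.
apply: (@le_trans _ _ (\sum_(j < n) (2 * F (j + s)%N + 2 * F j))).
  apply: ler_sum => j _; rewrite -wave_diff mulrBl; exact: sqr_sinB_le.
rewrite big_split /= -!mulr_sumr.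
have := sum_shift_le s n F0; have := sum_widen_le (leq_addr s n) F0.
rewrite -/(F _); lra.
Qed.

Lemma wave_sqr_le p q th j : wave p q th j ^+ 2 <= p ^+ 2 + q ^+ 2.
Proof.
rewrite /wave; have := cos2Dsin2 (j%:R * th).
set c := cos _; set t := sin _ => h.
have -> : p ^+ 2 + q ^+ 2 = (p ^+ 2 + q ^+ 2) * (c ^+ 2 + t ^+ 2) by rewrite h mulr1.
have := sqr_ge0 (p * t - q * c); nra.
Qed.

(** Two samples of a wave at distance [h] cannot both be near a zero of it
    unless [h * th] is near a multiple of [pi]. *)
Lemma wave_pair p q th h j : (p ^+ 2 + q ^+ 2) * sin (h%:R * th) ^+ 2 / 2 <=
  wave p q th j ^+ 2 + wave p q th (j + h) ^+ 2.
Proof.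
rewrite wave_shift.
have -> : p ^+ 2 + q ^+ 2 = wave p q th j ^+ 2 +
    (q * cos (j%:R * th) - p * sin (j%:R * th)) ^+ 2.
  have := cos2Dsin2 (j%:R * th); rewrite /wave.
  set c := cos _; set t := sin _ => e.
  rewrite -[LHS]mulr1 -e; ring.
set a := wave _ _ _ _; set b := q * _ - _.
have := cos2Dsin2 (h%:R * th); set c := cos _; set t := sin _ => e.
have h1 : (t * b) ^+ 2 <= 2 * (c * a + t * b) ^+ 2 + 2 * (c * a) ^+ 2.
  by have := sqr_ge0 (2 * (c * a) + t * b); nra.
have c2 : c ^+ 2 = 1 - t ^+ 2 by lra.
rewrite !exprMn c2 in h1 *.
have := mulr_ge0 (sqr_ge0 t) (sqr_ge0 a); nra.
Qed.

Lemma wave_sum_sqr p q th h n : (2 * h <= n)%N ->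
  n%:R / 8 * (p ^+ 2 + q ^+ 2) * sin (h%:R * th) ^+ 2 <=
  \sum_(j < n) wave p q th j ^+ 2.
Proof.
move=> hn; have hn' : (h <= n)%N by lia.
pose F j := wave p q th j ^+ 2.
have F0 j : 0 <= F j by exact: sqr_ge0.
set E := (p ^+ 2 + q ^+ 2) * sin (h%:R * th) ^+ 2.
have E0 : 0 <= E by rewrite mulr_ge0 ?addr_ge0 ?sqr_ge0.
have h1 : \sum_(j < n - h) (E / 2) <= \sum_(j < n - h) (F j + F (j + h)%N).
  by apply: ler_sum => j _; exact: wave_pair.
have := sum_widen_le (leq_subr h n) F0.
have := sum_shift_le h (n - h) F0; rewrite subnK //.
move: h1; rewrite sumr_const card_ord big_split /=.
rewrite -[X in X <= _]mulr_natl natrB //.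
have : 2 * h%:R <= n%:R :> R by rewrite -natrM ler_nat.
rewrite -[_ * _ * sin _ ^+ 2]mulrA -/E; rewrite /F; nra.
Qed.

Lemma sqr_sin_ge x : x ^+ 2 <= 1 -> x ^+ 2 / 4 <= sin x ^+ 2.
Proof.
rewrite -[x ^+ 2]real_normK ?num_real // -[sin x ^+ 2]real_normK ?num_real //.
have x0 := normr_ge0 x => x1.
have : `|x| / 2 <= `|sin x| by apply: normr_sin_ge_half; nra.
nra.
Qed.

Lemma sin_energy_small p q th h n : (2 * h <= n)%N -> p ^+ 2 + q ^+ 2 <= 1 ->
  (p ^+ 2 + q ^+ 2) * (n%:R * sin (h%:R * th) ^+ 2 / 128) <= sin_energy p q th n.
Proof.
move=> hn r1.
have := wave_sum_sqr p q th hn.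
suff : \sum_(j < n) wave p q th j ^+ 2 <= 16 * sin_energy p q th n by lra.
rewrite /sin_energy mulr_sumr; apply: ler_sum => j _.
have w1 : wave p q th j ^+ 2 <= 1 by rewrite (le_trans (wave_sqr_le _ _ _ _)).
have : (wave p q th j / 2) ^+ 2 / 4 <= sin (wave p q th j / 2) ^+ 2.
  by apply: sqr_sin_ge; nra.
lra.
Qed.

(** A wave of large amplitude is differenced until its squared amplitude first
    drops below [1]; this squared amplitude is then still at least the squared
    chord of the step, by which the last differencing multiplied a quantity
    exceeding [1]. The first [m] terms remain available after [K] steps. *)
Lemma sin_energy_large th h s m K : (2 * h <= m)%N -> chord2 (s%:R * th) <= 1 ->
  forall n p q, (m + K * s <= n)%N ->
  (p ^+ 2 + q ^+ 2) * chord2 (s%:R * th) ^+ K <= 1 ->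
  chord2 (s%:R * th) <= p ^+ 2 + q ^+ 2 ->
  (4^-1) ^+ K * (chord2 (s%:R * th) * (m%:R * sin (h%:R * th) ^+ 2 / 128)) <=
  sin_energy p q th n.
Proof.
move=> hm; have := chord2_ge0 (s%:R * th); set D := chord2 _ => D0 D1.
set W := sin _ ^+ 2; have W0 : 0 <= W by exact: sqr_ge0.
have m0 : 0 <= m%:R :> R by exact: ler0n.
have Y0 : 0 <= m%:R * W / 128 by apply: divr_ge0; [exact: mulr_ge0 | exact: ler0n].
have YW n : (m <= n)%N -> m%:R * W / 128 <= n%:R * W / 128.
  by move=> mn; rewrite ler_wpM2r ?invr_ge0 ?ler0n // ler_wpM2r ?ler_nat.
elim: K => [|K IH] n p q mn rD Dr.
  rewrite expr0 mul1r; rewrite expr0 mulr1 in rD.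
  have hn : (2 * h <= n)%N := leq_trans hm (leq_trans (leq_addr _ _) mn).
  apply: le_trans (sin_energy_small _ hn rD).
  rewrite -/W; have mn' := YW n (leq_trans (leq_addr _ _) mn).
  exact: ler_pM.
have four0 : 0 <= (4^-1 : R) ^+ K by rewrite exprn_ge0 // invr_ge0.
have X0 : 0 <= D * (m%:R * W / 128) by exact: mulr_ge0.
have [r1|r1] := leP (p ^+ 2 + q ^+ 2) 1.
  apply: (@le_trans _ _ (D * (m%:R * W / 128))).
    by rewrite ler_piMl // exprn_ile1 // ?invr_ge0 //; lra.
  have hn : (2 * h <= n)%N := leq_trans hm (leq_trans (leq_addr _ _) mn).
  apply: le_trans (sin_energy_small _ hn r1); rewrite -/W.
  have mn' := YW n (leq_trans (leq_addr _ _) mn).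
  exact: ler_pM.
have mn' : (m + K * s <= n - s)%N by clear -mn; lia.
have := IH _ (diff_p p q th s) (diff_q p q th s) mn'.
rewrite diff_norm -/D -mulrA -exprS => /(_ rD).
have -> : D <= (p ^+ 2 + q ^+ 2) * D by rewrite ler_peMl // ltW.
move=> /(_ isT) h1; have := sin_energy_diff p q th s (n - s).
rewrite subnK; last by clear -mn; lia.
rewrite exprS; lra.
Qed.

End waves.

(** * Small-ball estimate on the unit circle *)

Section charfun_wave.
Context (R : realType) (mu : probability R R).
Variables (M gamma q : R).
Hypothesis gamma0 : 0 < gamma.
Hypothesis q01 : 0 < q < 1.
Hypothesis conc : forall u, (mu [set x | `|x - u| <= gamma]%R <= (1 - q)%:E)%E.
Hypothesis tail : (mu [set x | (M < `|x|)%R] <= (q / 2)%:E)%E.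

Let V := M + M.
Lemma sqrt_expRN2 (x : R) : Num.sqrt (expR (- (2 * x))) = expR (- x).
Proof.
have -> : - (2 * x) = - x + - x by lra.
by rewrite expRD -expr2 sqrtr_sqr ger0_norm ?expR_ge0.
Qed.

Lemma sum_onesubcos_wave n (a b th v : R) :
  \sum_(j < n) (1 - cos (wave a b th j * v)) = 2 * sin_energy (v * a) (v * b) th n.
Proof.
rewrite /sin_energy mulr_sumr; apply: eq_bigr => j _.
rewrite cosE_half opprB addrC subrK; congr (2 * sin _ ^+ 2).
rewrite /wave; ring.
Qed.

(** The exponential rate of decay of the characteristic function, per summand
    and per unit of squared frequency. *)
Definition nondeg : R := pair_mass q * gamma ^+ 2 / 128.

Lemma nondeg_gt0 : 0 < nondeg.
Proof. by rewrite /nondeg divr_gt0 // mulr_gt0 ?pair_mass_gt0 // exprn_gt0. Qed.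

Let sqrt_prod_le n (u : nat -> R) (B : R) : 0 <= B ->
  (forall v : R, gamma <= `|v| <= V -> 2 * B <= \sum_(j < n) (1 - cos (u j * v))) ->
  Num.sqrt (\prod_(j < n) chf2 mu (u j)) <= expR (- (pair_mass q * B)).
Proof.
move=> B0 hB; rewrite -sqrt_expRN2; apply: ler_wsqrtr.
rewrite mulrCA; apply: (chf2_prod_le q01 conc tail) => //.
by rewrite mulr_ge0.
Qed.

Let vsqr (v : R) : gamma <= `|v| <= V -> gamma ^+ 2 <= v ^+ 2 <= V ^+ 2.
Proof.
move=> /andP[h1 h2]; rewrite -[v ^+ 2]real_normK ?num_real //.
by have := ltW gamma0 => g0; apply/andP; split; nra.
Qed.

Lemma charfun_wave_small n h (a b th : R) : (2 * h <= n)%N ->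
  V ^+ 2 * (a ^+ 2 + b ^+ 2) <= 1 ->
  Num.sqrt (\prod_(j < n) chf2 mu (wave a b th j)) <=
  expR (- (nondeg * n%:R * sin (h%:R * th) ^+ 2 * (a ^+ 2 + b ^+ 2))).
Proof.
move=> hn Vr; set S := sin _ ^+ 2; have S0 : 0 <= S by exact: sqr_ge0.
have r0 : 0 <= a ^+ 2 + b ^+ 2 by rewrite addr_ge0 ?sqr_ge0.
have n0 : 0 <= n%:R :> R by exact: ler0n.
have nS : 0 <= n%:R * S by exact: mulr_ge0.
have -> : nondeg * n%:R * S * (a ^+ 2 + b ^+ 2) =
    pair_mass q * (gamma ^+ 2 * (a ^+ 2 + b ^+ 2) * (n%:R * S / 128)).
  by rewrite /nondeg; ring.
have X0 : 0 <= (a ^+ 2 + b ^+ 2) * (n%:R * S / 128).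
  by rewrite mulr_ge0 // divr_ge0 // ler0n.
apply: sqrt_prod_le => [|v /vsqr/andP[v1 v2]].
  by rewrite -mulrA mulr_ge0 // sqr_ge0.
rewrite sum_onesubcos_wave ler_wpM2l //.
have vr : (v * a) ^+ 2 + (v * b) ^+ 2 = v ^+ 2 * (a ^+ 2 + b ^+ 2) by ring.
apply: le_trans (sin_energy_small _ hn _); rewrite vr.
  apply: ler_wpM2r; first by rewrite divr_ge0 ?ler0n.
  by apply: ler_wpM2r.
by apply: le_trans Vr; apply: ler_wpM2r.
Qed.

(** The minimum of the two bounds on the energy, for small and for large
    amplitude, depends on the difference [v] of two independent copies; the sum
    of the two exponentials covers both cases. *)
Lemma charfun_wave_large n h s m K (a b th : R) : (2 * h <= m)%N ->
  (m + K * s <= n)%N -> chord2 (s%:R * th) <= 1 ->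
  V ^+ 2 * (a ^+ 2 + b ^+ 2) * chord2 (s%:R * th) ^+ K <= 1 ->
  Num.sqrt (\prod_(j < n) chf2 mu (wave a b th j)) <=
  expR (- (nondeg * n%:R * sin (h%:R * th) ^+ 2 * (a ^+ 2 + b ^+ 2))) +
  expR (- (pair_mass q * ((4^-1) ^+ K *
     (chord2 (s%:R * th) * (m%:R * sin (h%:R * th) ^+ 2 / 128))))).
Proof.
move=> hm mn D1 Vr.
have hn : (2 * h <= n)%N := leq_trans hm (leq_trans (leq_addr _ _) mn).
set S := sin _ ^+ 2; have S0 : 0 <= S by exact: sqr_ge0.
have D0 := chord2_ge0 (s%:R * th); set D := chord2 _ in D0 D1 Vr *.
have r0 : 0 <= a ^+ 2 + b ^+ 2 by rewrite addr_ge0 ?sqr_ge0.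
have n0 : 0 <= n%:R :> R by exact: ler0n.
have nS : 0 <= n%:R * S / 128 by rewrite divr_ge0 ?ler0n // mulr_ge0.
have mS : 0 <= m%:R * S / 128 by rewrite divr_ge0 ?ler0n // mulr_ge0 ?ler0n.
set B1 := gamma ^+ 2 * (a ^+ 2 + b ^+ 2) * (n%:R * S / 128).
have -> : nondeg * n%:R * S * (a ^+ 2 + b ^+ 2) = pair_mass q * B1.
  by rewrite /nondeg /B1; ring.
set B2 := (4^-1) ^+ K * _.
have B10 : 0 <= B1 by rewrite mulr_ge0 // mulr_ge0 // sqr_ge0.
have B20 : 0 <= B2.
  by rewrite mulr_ge0 // ?exprn_ge0 ?invr_ge0 ?ler0n // mulr_ge0.
pose B := Num.min B1 B2.
have hB : Num.sqrt (\prod_(j < n) chf2 mu (wave a b th j)) <=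
    expR (- (pair_mass q * B)).
  apply: sqrt_prod_le => [|v /vsqr/andP[v1 v2]]; first by rewrite /B le_min B10.
  rewrite sum_onesubcos_wave ler_wpM2l // /B ge_min.
  have vr : (v * a) ^+ 2 + (v * b) ^+ 2 = v ^+ 2 * (a ^+ 2 + b ^+ 2) by ring.
  have [r1|r1] := leP (v ^+ 2 * (a ^+ 2 + b ^+ 2)) 1.
    apply/orP; left.
    apply: le_trans (sin_energy_small _ hn _); rewrite vr; last exact: r1.
    rewrite /B1; apply: ler_wpM2r; first exact: nS.
    by apply: ler_wpM2r.
  apply/orP; right; apply: (sin_energy_large hm D1) => //; rewrite vr.
    apply: le_trans Vr; apply: ler_wpM2r; first exact: exprn_ge0.
    exact: ler_wpM2r.
  exact: le_trans D1 (ltW r1).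
apply: (le_trans hB); rewrite /B minEle; case: ifP => _.
  by rewrite lerDl expR_ge0.
by rewrite lerDr expR_ge0.
Qed.

End charfun_wave.

Section small_ball.
Context (R : realType).

Lemma geometric_sum_le (b : R) n : 0 < b ->
  \sum_(0 <= k < n) expR (- b) ^+ k <= 1 + b^-1.
Proof.
move=> b0; rewrite big_mkord; set x := expR (- b).
have x1 : x <= (1 + b)^-1.
  by rewrite /x expRN lef_pV2 ?posrE ?expR_gt0 ?addr_gt0 // expR_ge1Dx.
have x0 : 0 < x by exact: expR_gt0.
have b1 : 0 < 1 + b by lra.
have e : (1 + b)^-1 = 1 - b / (1 + b) by field; rewrite gt_eqF.
have bb : 0 < b / (1 + b) by rewrite divr_gt0.
have := subrX1 x n; set G := \sum_(_ < _) _ => hG.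
have xn : 0 < x ^+ n by rewrite exprn_gt0.
have h : (1 - x) * G <= 1.
  by rewrite -[1 - x]opprB mulNr -hG opprB; lra.
have G0 : 0 <= G by apply: sumr_ge0 => i _; rewrite exprn_ge0 // ltW.
have h2 : b / (1 + b) * G <= 1 by apply: le_trans h; apply: ler_wpM2r => //; lra.
have -> : 1 + b^-1 = (b / (1 + b))^-1 by field; rewrite !gt_eqF.
by rewrite -[leRHS]mul1r ler_pdivlMr // mulrC.
Qed.

Lemma gauss_sum_le (b : R) L (l' : 'I_L) : 0 < b ->
  \sum_(l < L) expR (- (b * (l%:R - l'%:R) ^+ 2)) <= 2 * (1 + b^-1).
Proof.
move=> b0; pose F l : R := expR (- (b * (l%:R - l'%:R) ^+ 2)).
rewrite -(big_mkord xpredT F) (big_cat_nat (leq0n l') (ltnW (ltn_ord l'))) /=.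
have sq (k : nat) : expR (- (b * k%:R ^+ 2)) <= expR (- b) ^+ k.
  have kk : k%:R <= k%:R ^+ 2 :> R.
    by rewrite -natrX ler_nat expnS expn1; case: k => // k; rewrite leq_pmulr.
  rewrite -expRM_natl ler_expR; nra.
have h1 : \sum_(0 <= l < l') F l <= 1 + b^-1.
  rewrite big_nat_rev /= add0n; apply: le_trans (geometric_sum_le l' b0).
  rewrite !big_nat; apply: ler_sum => k /andP[_ kl].
  have -> : F (l' - k.+1)%N = expR (- (b * k.+1%:R ^+ 2)).
    by rewrite /F natrB //; congr (expR (- (b * _))); ring.
  apply: (le_trans (sq k.+1)); rewrite exprS ler_piMl ?exprn_ge0 ?expR_ge0 //.
  by rewrite -expR0 ler_expR; lra.
have h2 : \sum_(l' <= l < L) F l <= 1 + b^-1.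
  apply: le_trans (geometric_sum_le (L - l') b0).
  rewrite -{1}[l' : nat]add0n big_addn; apply: ler_sum => k _.
  by rewrite /F natrD addrK.
lra.
Qed.

Context (d : measure_display) (T : measurableType d).
Context (P : probability T R) (mu : probability R R).
Context (X : nat -> {RV P >-> R}).
Hypothesis iidX : iid_with_law X mu.

Definition re_poly n (th : R) := lform X n (fun j => cos (j%:R * th)).
Definition im_poly n (th : R) := lform X n (fun j => sin (j%:R * th)).

Lemma lform_wave n (a b th : R) w :
  lform X n (wave a b th) w = a * re_poly n th w + b * im_poly n th w.
Proof.
rewrite /re_poly /im_poly /lform !mulr_sumr -big_split /=.
by apply: eq_bigr => j _; rewrite /wave; ring.
Qed.

Lemma wave_sub (a b a' b' th : R) j :
  wave a b th j - wave a' b' th j = wave (a - a') (b - b') th j.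
Proof. rewrite /wave; ring. Qed.

(** Esseen's inequality for the real and imaginary parts, with frequencies in
    the lattice of step [tau] and side [L]. The Gaussian part of the bound is
    summable over the lattice, which gives a probability of order [L^-2], and the
    error [nu] is only multiplied by [4]. *)
Lemma small_ball n (th tau beta nu : R) L : (0 < L)%N -> 0 < tau -> 0 < beta ->
  0 <= nu ->
  (forall a b, a ^+ 2 + b ^+ 2 <= 2 * (tau * L%:R) ^+ 2 ->
    Num.sqrt (\prod_(j < n) chf2 mu (wave a b th j)) <=
    expR (- (beta * (a ^+ 2 + b ^+ 2))) + nu) ->
  exists K : T -> R, [/\ bm K, forall w, 0 <= K w,
    forall w eps, 2 * tau * L%:R * eps <= 1 ->
      `|re_poly n th w| <= eps -> `|im_poly n th w| <= eps -> 1 <= K w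
    & \int[P]_w K w <=
      4 * ((2 * (1 + (beta * tau ^+ 2)^-1)) ^+ 2 / L%:R ^+ 2 + nu)].
Proof.
move=> L0 tau0 beta0 nu0 hphi.
pose I : finType := ('I_L * 'I_L)%type.
pose u (i : I) := wave (tau * i.1%:R) (tau * i.2%:R) th.
have LR : 0 < L%:R :> R by rewrite ltr0n.
have cI : #|I| = (L * L)%N by rewrite card_prod card_ord.
set G := 2 * (1 + _).
have hB i' : \sum_(i : I) Num.sqrt (\prod_(j < n) chf2 mu (u i j - u i' j)) <=
    G ^+ 2 + L%:R ^+ 2 * nu.
  have b0 : 0 < beta * tau ^+ 2 by rewrite mulr_gt0 // exprn_gt0.
  pose e (l l' : 'I_L) := expR (- (beta * tau ^+ 2 * (l%:R - l'%:R) ^+ 2)) : R.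
  have diff (l l' : 'I_L) : (l%:R - l'%:R : R) ^+ 2 <= L%:R ^+ 2.
    have : l%:R <= L%:R :> R by rewrite ler_nat ltnW.
    have : l'%:R <= L%:R :> R by rewrite ler_nat ltnW.
    have : 0 <= l%:R :> R by exact: ler0n.
    have : 0 <= l'%:R :> R by exact: ler0n.
    nra.
  apply: (@le_trans _ _ (\sum_(i : I) (e i.1 i'.1 * e i.2 i'.2 + nu))).
    apply: ler_sum => i _.
    have -> : \prod_(j < n) chf2 mu (u i j - u i' j) =
        \prod_(j < n) chf2 mu (wave (tau * (i.1%:R - i'.1%:R))
          (tau * (i.2%:R - i'.2%:R)) th j).
      by apply: eq_bigr => j _; rewrite /u wave_sub !mulrBr.
    apply: (le_trans (hphi _ _ _)).
      rewrite !exprMn -mulrDr mulrCA ler_wpM2l ?sqr_ge0 //.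
      by have := diff i.1 i'.1; have := diff i.2 i'.2; lra.
    rewrite lerD2r /e -expRD ler_expR le_eqVlt; apply/predU1P; left; ring.
  rewrite big_split /= sumr_const cI lerD //; last first.
    by rewrite -[X in X <= _]mulr_natl natrM expr2.
  rewrite -(pair_big xpredT xpredT (fun l m => e l i'.1 * e m i'.2)) /=.
  under eq_bigr do rewrite -mulr_sumr.
  rewrite -mulr_suml expr2; apply: ler_pM; try exact: gauss_sum_le.
    by apply: sumr_ge0 => *; exact: expR_ge0.
  by apply: sumr_ge0 => *; exact: expR_ge0.
have I0 : (0 < #|I|)%N by rewrite cI muln_gt0 L0.
have [K [bK K0 K1 Kint]] := discrete_esseen iidX I0 hB.
exists K; split => // [w eps hL hX hY|].
  apply: K1 => i; rewrite /u lform_wave.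
  apply: le_trans (ler_normD _ _) _.
  have bnd (l : 'I_L) (x : R) : `|x| <= eps -> `|tau * l%:R * x| <= 1 / 2.
    move=> hx; rewrite normrM [`|tau * _|]ger0_norm; last by rewrite mulr_ge0 ?ler0n // ltW.
    have lL : l%:R <= L%:R :> R by rewrite ler_nat ltnW.
    have eps0 : 0 <= eps by exact: le_trans (normr_ge0 x) hx.
    have : tau * l%:R * `|x| <= tau * L%:R * eps.
      by rewrite ler_pM ?mulr_ge0 ?ler0n ?ler_wpM2l // ltW.
    lra.
  by have := bnd i.1 _ hX; have := bnd i.2 _ hY; lra.
apply: (le_trans Kint); rewrite cI natrM -mulrA ler_wpM2l //.
rewrite mulrDl -expr2 lerD //.
by rewrite mulrAC divff ?mul1r // expf_neq0 // gt_eqF.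
Qed.

End small_ball.

(** * Rational approximation of the net points *)

Section residues.
Variable N : nat.
Hypothesis N0 : (0 < N)%N.

(** The two cases are the two signs of the distance to the nearest multiple. *)
Definition residue (x e : nat) : Prop :=
  exists q, x = (q * N + e)%N \/ (x + e)%N = (q * N)%N.

Lemma residue_mul x e l : residue x e -> residue (l * x) (l * e).
Proof.
move=> [q [->|h]]; exists (l * q)%N; [left|right]; first by lia.
by rewrite -mulnDr h mulnA.
Qed.

Lemma residue_nearest x : exists2 e, (2 * e <= N)%N & residue x e.
Proof.
have := divn_eq x N; have := ltn_pmod x N0.
set r := (x %% N)%N; set q := (x %/ N)%N => rN xE.
have [h|h] := leqP (2 * r) N.
  by exists r => //; exists q; left.
exists (N - r)%N; first by lia.
by exists q.+1; right; lia.
Qed.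

(** Dirichlet's approximation theorem: two of the [S + 1] residues of the [k * i]
    fall into the same of [S] bins. *)
Lemma dirichlet k S : (0 < S)%N ->
  exists s e, [/\ (0 < s)%N, (s <= S)%N, (e * S <= N)%N & residue (k * s) e].
Proof.
move=> S0.
have binP (i : 'I_S.+1) : ((k * i) %% N * S %/ N < S)%N.
  by rewrite ltn_divLR // mulnC ltn_pmul2l // ltn_pmod.
pose bin (i : 'I_S.+1) : 'I_S := Ordinal (binP i).
have /injectivePn[i1 [i2 ne eb]] : ~~ injectiveb bin.
  apply/injectiveP => /leq_card; by rewrite !card_ord ltnn.
wlog lt : i1 i2 ne eb / (i1 < i2)%N.
  move=> h; have [|//|e] := ltngtP i1 i2; first exact: h.
    by apply: (h i2 i1); rewrite // eq_sym.
  by move/eqP: ne; case; exact: val_inj.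
have {}eb : ((k * i1) %% N * S %/ N = (k * i2) %% N * S %/ N)%N by case: eb.
have l1 := ltn_pmod (k * i1) N0; have l2 := ltn_pmod (k * i2) N0.
have d1 := divn_eq (k * i1) N; have d2 := divn_eq (k * i2) N.
have i2S := ltn_ord i2.
have kk : (k * i1 <= k * i2)%N by rewrite leq_mul2l ltnW ?orbT.
have q12 : ((k * i1) %/ N <= (k * i2) %/ N)%N by exact: leq_div2r.
move: l1 l2 d1 d2 eb q12.
set r1 := ((k * i1) %% N)%N; set r2 := ((k * i2) %% N)%N.
set q1 := ((k * i1) %/ N)%N; set q2 := ((k * i2) %/ N)%N => l1 l2 d1 d2 eb q12.
have b1 := divn_eq (r1 * S) N; have b2 := divn_eq (r2 * S) N.
have c1 := ltn_pmod (r1 * S) N0; have c2 := ltn_pmod (r2 * S) N0.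
rewrite eb in b1.
exists (i2 - i1)%N; exists (if (r1 <= r2)%N then r2 - r1 else r1 - r2)%N.
split; first by rewrite subn_gt0.
- by apply: leq_trans (leq_subr _ _) _.
- by case: ifP => _; rewrite mulnBl b2 b1 subnDl (leq_trans (leq_subr _ _)) // ltnW.
- rewrite mulnBr; exists (q2 - q1)%N; rewrite mulnBl.
  have qq : (q1 * N <= q2 * N)%N by rewrite leq_mul2r q12 orbT.
  move: kk; rewrite d1 d2; clear -qq.
  by move: (q1 * N)%N (q2 * N)%N qq => u v uv kk; case: leqP => h; [left|right]; lia.
Qed.

(** The Dirichlet step of [k] has a residue [e] above [V] and at most [N / S]. If
    [e < T], the least multiple of this step whose residue reaches [T] does not
    overshoot [2 T], and it is small because [e > V]. *)
Lemma window_step k S T V : (0 < S)%N ->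
  (forall s e, (0 < s)%N -> (s <= S)%N -> residue (k * s) e -> (V < e)%N) ->
  exists s e, [/\ (s <= S * (T %/ V.+1).+1)%N, (T <= e)%N,
    (e <= 2 * T)%N \/ (e * S <= N)%N & residue (k * s) e].
Proof.
move=> S0 far; have [s [e [s0 sS eS res]]] := dirichlet k S0.
have Ve := far _ _ s0 sS res.
have [Te|eT] := leqP T e.
  exists s, e; split => //; last by right.
  by apply: (leq_trans sS); rewrite leq_pmulr.
have e0 : (0 < e)%N by apply: leq_ltn_trans Ve.
have d := divn_eq T e; have c := ltn_pmod T e0.
exists ((T %/ e).+1 * s)%N, ((T %/ e).+1 * e)%N; split.
- rewrite mulnC; apply: leq_mul => //; rewrite ltnS.
  by apply: leq_div2l.
- by rewrite mulSn; lia.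
- by left; rewrite mulSn; lia.
- by rewrite mulnCA; exact: residue_mul.
Qed.

(** That is, [k / N] is within [V / (s N)] of a rational of denominator [s]. *)
Definition near_rational (S V k : nat) : Prop :=
  exists s e, [/\ (0 < s)%N, (s <= S)%N, (e <= V)%N & residue (k * s) e].

(** The denominator, the numerator, the distance and its sign determine [k]. *)
Lemma card_near_rational (S V : nat) (B : {set 'I_N}) : (V < N)%N ->
  (forall k : 'I_N, k \in B -> near_rational S V k) ->
  (#|B| <= S * S.+2 * V.+1 * 2)%N.
Proof.
move=> VN hB.
pose f (x : 'I_S * 'I_S.+2 * 'I_V.+1 * bool) : nat :=
  let: (s, q, e, b) := x in
  if b then ((q * N + e) %/ s.+1)%N else ((q * N - e) %/ s.+1)%N.
have sub : {subset map val (enum B) <= codom f}.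
  move=> _ /mapP[k kB ->]; rewrite mem_enum in kB.
  have [s' [e [s0 sS eV [q hq]]]] := hB k kB.
  case: s' s0 sS hq => [//|s] _ sS hq.
  have kN := ltn_ord k.
  have ksN : (k * s.+1 < N * S.+1)%N.
    apply: (@leq_trans (N * s.+1)); first by rewrite ltn_pmul2r.
    by rewrite leq_mul2l ltnS (ltnW sS) orbT.
  have qS : (q < S.+2)%N.
    rewrite -(ltn_pmul2r N0) mulSn [(S.+1 * N)%N]mulnC.
    by case: hq => hq; lia.
  have eV' : (e < V.+1)%N by [].
  apply/codomP; exists (Ordinal sS, Ordinal qS, Ordinal eV', `[< (k * s.+1 = q * N + e)%N >]).
  rewrite /f /=; case: asboolP => h; first by rewrite -h mulnK.
  have {}hq : (k * s.+1 + e = q * N)%N by case: hq.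
  by rewrite -hq addnK mulnK.
have := uniq_leq_size _ sub.
rewrite map_inj_uniq ?enum_uniq; last exact: val_inj.
move=> /(_ isT); rewrite size_map -cardE size_codom !card_prod !card_ord.
by rewrite card_bool.
Qed.

End residues.

Section angles.
Context (R : realType).
Variable N : nat.
Hypothesis N0 : (0 < N)%N.

Definition angle (k : nat) : R := k%:R * (pi *+ 2 / N%:R).

Let NR : (N%:R : R) != 0.
Proof. by rewrite pnatr_eq0 -lt0n. Qed.

Lemma cos_residue x e : residue N x e -> cos (angle x) = cos (angle e).
Proof.
have per (q : nat) (y : R) : cos (y + q%:R * (pi *+ 2)) = cos y.
  by rewrite mulr_natl; exact: (periodicn (@cosD2pi R)).
move=> [q [->|h]].
  rewrite -(per q (angle e)) /angle natrD natrM; congr cos; field.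
  exact: NR.
have -> : angle x = - angle e + q%:R * (pi *+ 2).
  have : (x%:R : R) = q%:R * N%:R - e%:R by rewrite -natrM -h natrD addrK.
  by rewrite /angle => ->; field; exact: NR.
by rewrite per cosN.
Qed.

Lemma angleM s k : s%:R * angle k = angle (k * s).
Proof. by rewrite /angle natrM; ring. Qed.

Lemma pi_lt4 : pi < 4 :> R.
Proof. by have := @pihalf_lt2 R; lra. Qed.

Lemma sqr_sin_chord2 (x : R) : sin x ^+ 2 = chord2 (2 * x) / 4.
Proof.
rewrite /chord2 cosE_half.
have -> : 2 * x / 2 = x by field.
lra.
Qed.

Lemma chord2_angle_le e : chord2 (angle e) <= 64 * (e%:R / N%:R) ^+ 2.
Proof.
have := onesubcos_le (angle e).
have -> : angle e ^+ 2 = 4 * pi ^+ 2 * (e%:R / N%:R) ^+ 2.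
  by rewrite /angle mulr2n; field; exact: NR.
have := pi_lt4; have := @pi_gt0 R => p0 p4.
have pp : pi ^+ 2 <= 16 :> R by nra.
rewrite /chord2; have := sqr_ge0 (e%:R / N%:R : R); nra.
Qed.

Lemma sqr_sin_pi_ge (x : R) : `|x| <= 1 / 4 -> x ^+ 2 <= sin (pi * x) ^+ 2.
Proof.
move=> x4; have p4 := pi_lt4; have p2 := @pi_ge2 R.
have xx : x ^+ 2 <= 1 / 16.
  by rewrite -[x ^+ 2]real_normK ?num_real //; have := normr_ge0 x; nra.
have pp : pi ^+ 2 <= 16 :> R by nra.
have pp4 : 4 <= pi ^+ 2 :> R by nra.
have x20 := sqr_ge0 x.
have := @sqr_sin_ge _ (pi * x).
rewrite exprMn => h; apply: le_trans (h _); nra.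
Qed.

Lemma chord2_angleE e : chord2 (angle e) = 4 * sin (pi * (e%:R / N%:R)) ^+ 2.
Proof.
rewrite sqr_sin_chord2 [RHS]mulrC divfK ?pnatr_eq0 //; congr chord2.
by rewrite /angle mulr2n; field; exact: NR.
Qed.

Lemma chord2_angle_ge e : (4 * e <= N)%N ->
  4 * (e%:R / N%:R) ^+ 2 <= chord2 (angle e).
Proof.
move=> eN; rewrite chord2_angleE ler_wpM2l // sqr_sin_pi_ge //.
rewrite ger0_norm ?divr_ge0 ?ler0n // ler_pdivrMr ?ltr0n //.
have : 4 * e%:R <= N%:R :> R by rewrite -natrM ler_nat.
lra.
Qed.

(** The lag [h] makes the samples of a wave at distance [h] well conditioned: by
    [wave_pair] the quality is the squared sine of [h * angle k], that is, of
    [pi h e / N]. The best choice is the largest [h] with [h * e / N] at most a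
    quarter, subject to [4 * h <= n]. *)
Lemma separation_step n k e : (8 <= n)%N -> (0 < e)%N -> (2 * e <= N)%N ->
  residue N (2 * k) e ->
  exists2 h, (4 * h <= n)%N &
    (1 / 64 <= sin (h%:R * angle k) ^+ 2) \/
    ((n%:R * (e%:R / N%:R) / 8) ^+ 2 <= sin (h%:R * angle k) ^+ 2).
Proof.
move=> n8 e0 eN res.
have sE h : sin (h%:R * angle k) ^+ 2 = sin (pi * (h%:R * (e%:R / N%:R))) ^+ 2.
  rewrite sqr_sin_chord2.
  have -> : 2 * (h%:R * angle k) = angle (h * (2 * k)).
    by rewrite /angle !natrM; ring.
  have := cos_residue (residue_mul N0 h res).
  rewrite /chord2 => ->; rewrite -/(chord2 (angle (h * e))) chord2_angleE.
  rewrite mulrAC divff ?mul1r ?pnatr_eq0 // natrM.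
  by congr (sin (pi * _) ^+ 2); rewrite mulrA.
set x : R := e%:R / N%:R in sE *.
have x0 : 0 < x by rewrite divr_gt0 ?ltr0n.
have x2 : x <= 1 / 2.
  rewrite /x ler_pdivrMr ?ltr0n //.
  have : 2 * e%:R <= N%:R :> R by rewrite -natrM ler_nat.
  lra.
have p4 := pi_lt4; have p0 := @pi_gt0 R.
have [x4|x4] := leP (1 / 4) x.
  exists 1%N; first by apply: leq_trans n8.
  left; rewrite sE (_ : 1%:R * x = x); last by rewrite mul1r.
  have -> : sin (pi * x) = cos (pi * (x - 1 / 2)).
    rewrite -cosBpihalf; congr cos; lra.
  have := cosE_half (pi * (x - 1 / 2)).
  have := @normr_sin_le R (pi * (x - 1 / 2) / 2).
  have y1 : - 1 <= pi * (x - 1 / 2) by nra.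
  have y2 : pi * (x - 1 / 2) <= 0 by nra.
  move: y1 y2; set y := pi * (x - 1 / 2) => y1 y2 hs.
  have hy : `|y / 2| <= 1 / 2 by rewrite ler_norml; apply/andP; split; lra.
  have {}hs : `|sin (y / 2)| <= 1 / 2 by exact: le_trans hy.
  have s4 : sin (y / 2) ^+ 2 <= 1 / 4.
    rewrite -[sin _ ^+ 2]real_normK ?num_real //.
    by have := normr_ge0 (sin (y / 2)); nra.
  move=> cy; have : 1 / 2 <= cos y by lra.
  nra.
have n0 : 0 <= n%:R :> R by exact: ler0n.
have [nx|nx] := leP (n%:R * x) 1.
  exists (n %/ 4)%N; first by lia.
  right; rewrite sE.
  have h1 : n%:R / 8 <= (n %/ 4)%:R :> R.
    rewrite ler_pdivrMr ?ltr0n // -natrM ler_nat; lia.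
  have h2 : (n %/ 4)%:R <= n%:R / 4 :> R.
    rewrite ler_pdivlMr ?ltr0n // -natrM ler_nat; lia.
  have h0 : 0 <= (n %/ 4)%:R :> R by exact: ler0n.
  move: h0 h1 h2; set g : R := (n %/ 4)%:R => h0 h1 h2.
  apply: le_trans (sqr_sin_pi_ge _); last first.
    rewrite ger0_norm; last by rewrite mulr_ge0 // ltW.
    nra.
  have h3 : n%:R * x / 8 <= g * x by nra.
  rewrite ler_pXn2r ?nnegrE //.
    by rewrite divr_ge0 ?ler0n // mulr_ge0 // ltW.
  by rewrite mulr_ge0 // ltW.
pose h := Num.truncn ((4 * x)^-1).
have x40 : 0 < 4 * x by lra.
have i0 : 0 <= (4 * x)^-1 by rewrite invr_ge0 ltW.
have /andP[t1 t2] := truncn_itv i0; rewrite -/h in t1 t2.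
have e1 : (4 * x)^-1 * (4 * x) = 1 by rewrite mulVf // gt_eqF.
have hx1 : h%:R * (4 * x) <= 1 by rewrite -[leRHS]e1 ler_wpM2r // ltW.
have hx2 : 1 < (h%:R + 1) * (4 * x) by rewrite -[ltLHS]e1 ltr_pM2r // natr1.
have h1 : 1 <= h%:R :> R.
  rewrite ler1n lt0n; apply: contraTN hx2 => /eqP ->.
  rewrite -leNgt add0r mul1r; lra.
have hx0 : 0 <= h%:R * x by rewrite mulr_ge0 ?ler0n // ltW.
exists h.
  rewrite -(ler_nat R) natrM -(ler_pM2r x0).
  lra.
left; rewrite sE; apply: le_trans (sqr_sin_pi_ge _); last first.
  by rewrite ger0_norm //; lra.
have h8 : 1 / 8 <= h%:R * x by nra.
have -> : 1 / 64 = (1 / 8) ^+ 2 :> R by field.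
by rewrite ler_pXn2r ?nnegrE.
Qed.

End angles.

(** * Majorized events *)

Lemma ler_sqr_pos (R : realType) (x y : R) : 0 <= x -> x <= y -> x ^+ 2 <= y ^+ 2.
Proof. by move=> x0 xy; rewrite ler_pXn2r ?nnegrE // (le_trans x0). Qed.

Section majorants.
Context (d : measure_display) (T : measurableType d) (R : realType).
Context (P : probability T R) (mu : probability R R).
Context (X : nat -> {RV P >-> R}).
Hypothesis iidX : iid_with_law X mu.

(** An upper bound on the outer probability of [A], monotone and subadditive,
    which makes sense for sets not known to be measurable. *)
Definition majorized (A : set T) (c : R) : Prop :=
  exists K : T -> R, [/\ bm K, forall w, 0 <= K w, forall w, A w -> 1 <= K w
    & \int[P]_w K w <= c].

Lemma majorized_le (A B : set T) (c c' : R) :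
  A `<=` B -> c <= c' -> majorized B c -> majorized A c'.
Proof.
move=> AB cc' [K [bK K0 K1 Kc]]; exists K; split => //.
  by move=> w /AB /K1.
exact: le_trans cc'.
Qed.

Lemma majorizedU (A B : set T) (a b : R) :
  majorized A a -> majorized B b -> majorized (A `|` B) (a + b).
Proof.
move=> [K [bK K0 K1 Kc]] [L [bL L0 L1 Lc]].
exists (fun w => K w + L w); split.
- exact: bmD.
- by move=> w; rewrite addr_ge0.
- by move=> w [/K1 h|/L1 h]; [have := L0 w | have := K0 w]; lra.
- by rewrite bm_intD // lerD.
Qed.

Lemma majorized0 (c : R) : 0 <= c -> majorized set0 c.
Proof.
move=> c0; exists (fun=> 0); split => //; first exact: bm_cst.
by rewrite prob_int_cst.
Qed.

Lemma majorized_bigcup (I : finType) (A : I -> set T) (c : I -> R) :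
  (forall i, majorized (A i) (c i)) ->
  majorized [set w | exists i, A i w] (\sum_i c i).
Proof.
move=> h.
have : forall s : seq I,
    majorized [set w | exists2 i, i \in s & A i w] (\sum_(i <- s) c i).
  elim=> [|i s IH].
    rewrite big_nil; apply: majorized_le (lexx _) (majorized0 (lexx 0)).
    by move=> w [].
  rewrite big_cons; apply: majorized_le (lexx _) (majorizedU (h i) IH).
  move=> w [j]; rewrite inE => /predU1P[->|js] Aj; first by left.
  by right; exists j.
move=> /(_ (index_enum I)); apply: majorized_le => //.
by move=> w [i Ai]; exists i => //; exact: mem_index_enum.
Qed.

Lemma majorized_prob (A : set T) (c : R) : measurable A -> majorized A c ->
  (P A <= c%:E)%E.
Proof.
move=> mA [K [bK K0 K1 Kc]]; apply: le_trans (prob_le_int P mA bK K0 K1) _.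
by rewrite lee_fin.
Qed.

Section deviation.
Variable s2 : R.
Hypothesis intX2 : mu.-integrable setT (fun x => (x ^+ 2)%:E).
Hypothesis s2E : \int[mu]_x (x ^+ 2) = s2.
Hypothesis int1 : mu.-integrable setT (fun x => x%:E).
Hypothesis mean0 : \int[mu]_x x = 0.

(** The exponential parameter [la] is optimal, up to constants, for a quadratic
    variation [r * n] and a deviation of [r ^+ 2] standard units. The exponent is
    then [- r^3 / 8], hence at most [- 3 r^2] for [r >= 24]; with
    [r = sqrt (ln n)] the bound is [2 n^-3], small enough for a union over the
    net. *)
Lemma majorized_deviation n (a : nat -> R) (A r : R) : (0 < n)%N -> 0 < A ->
  (forall j, (j < n)%N -> `|a j| <= A) -> 24 <= r -> s2 <= r ->
  majorized [set w | A * Num.sqrt n%:R * r ^+ 2 <= `|lform X n a w| /\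
      \sum_(j < n) (X j w) ^+ 2 <= r * n%:R] (2 * expR (- (3 * r ^+ 2))).
Proof.
move=> n0 A0 aA r24 s2r.
have nR : 0 < n%:R :> R by rewrite ltr0n.
have s0 : 0 < Num.sqrt n%:R :> R by rewrite sqrtr_gt0.
have ss : Num.sqrt n%:R ^+ 2 = n%:R :> R by rewrite sqr_sqrtr // ltW.
have s2_0 : 0 <= s2 by rewrite -s2E Rintegral_ge0 // => *; exact: sqr_ge0.
set u := A * Num.sqrt n%:R.
have u0 : 0 < u by rewrite mulr_gt0.
have uu : u ^+ 2 = A ^+ 2 * n%:R by rewrite exprMn ss.
pose la := r / (4 * u).
have lau : la * u = r / 4 by rewrite /la; field; rewrite gt_eqF.
have la2 : la ^+ 2 * (A ^+ 2 * n%:R) = r ^+ 2 / 16.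
  by rewrite -uu -exprMn lau; field.
have la0 : 0 < la by rewrite divr_gt0 ?mulr_gt0 //; lra.
clearbody la.
have asq j : (j < n)%N -> a j ^+ 2 <= A ^+ 2.
  by move=> /aA; rewrite -[a j ^+ 2]real_normK ?num_real //; have := normr_ge0 (a j); nra.
have side (sg : R) : sg ^+ 2 = 1 ->
    majorized [set w | u * r ^+ 2 <= sg * lform X n a w /\
      \sum_(j < n) (X j w) ^+ 2 <= r * n%:R] (expR (- (3 * r ^+ 2))).
  move=> sg2; pose b j := la * sg * a j.
  have [K [bK K0 K1 Kc]] := chernoff_lform iidX intX2 s2E int1 mean0 n b
    (la * (u * r ^+ 2)) (la ^+ 2 * (A ^+ 2 * n%:R) * r).
  exists K; split => //.
    move=> w [h1 h2]; apply: K1.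
      have -> : lform X n b w = la * (sg * lform X n a w).
        by rewrite /lform !mulr_sumr; apply: eq_bigr => j _; rewrite /b; ring.
      by rewrite ler_wpM2l // ltW.
    apply: (@le_trans _ _ (\sum_(j < n) la ^+ 2 * A ^+ 2 * (X j w) ^+ 2)).
      apply: ler_sum => j _; rewrite /b !exprMn sg2 mulr1.
      by rewrite ler_wpM2r ?sqr_ge0 // ler_wpM2l ?sqr_ge0 //; exact: asq.
    rewrite -mulr_sumr.
    have -> : la ^+ 2 * (A ^+ 2 * n%:R) * r = la ^+ 2 * A ^+ 2 * (r * n%:R) by ring.
    by rewrite ler_wpM2l // mulr_ge0 ?sqr_ge0.
  apply: (le_trans Kc); rewrite ler_expR.
  have b2 : \sum_(j < n) b j ^+ 2 <= r ^+ 2 / 16.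
    apply: (@le_trans _ _ (\sum_(j < n) la ^+ 2 * A ^+ 2)).
      apply: ler_sum => j _; rewrite /b !exprMn sg2 mulr1.
      by rewrite ler_wpM2l ?sqr_ge0 //; exact: asq.
    by rewrite sumr_const card_ord -[X in X <= _]mulr_natr -la2 mulrA.
  have b0 : 0 <= \sum_(j < n) b j ^+ 2 by apply: sumr_ge0 => *; exact: sqr_ge0.
  rewrite la2 mulrA lau.
  have h : s2 * \sum_(j < n) b j ^+ 2 <= r * (r ^+ 2 / 16) by apply: ler_pM.
  have : r ^+ 2 * 24 <= r ^+ 2 * r by rewrite ler_wpM2l // sqr_ge0.
  lra.
have m1 : (-1) ^+ 2 = 1 :> R by rewrite sqrrN expr1n.
have := majorizedU (side 1 (expr1n _ _)) (side (-1) m1).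
move=> h12; apply: majorized_le h12; last by lra.
move=> w /= [h1 h2].
move: h1; rewrite ler_normr => /orP[h|h]; [left|right]; split => //.
  by rewrite mul1r.
by rewrite mulN1r.
Qed.

End deviation.

Variables (M gamma q : R).
Hypothesis M0 : 0 < M.
Hypothesis gamma0 : 0 < gamma.
Hypothesis q01 : 0 < q < 1.
Hypothesis conc : forall u, (mu [set x | `|x - u| <= gamma]%R <= (1 - q)%:E)%E.
Hypothesis tail : (mu [set x | (M < `|x|)%R] <= (q / 2)%:E)%E.

(** Signed sums are the values of the polynomial at [1] and [-1]. The frequencies
    [l / sqrt n] stay in the range where the quadratic expansion of the cosine
    holds. *)
Lemma majorized_sign_sum n (sg : nat -> R) L : (0 < n)%N -> (0 < L)%N ->
  (forall j, sg j ^+ 2 = 1) -> (M + M) * L%:R <= Num.sqrt n%:R ->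
  majorized [set w | `|lform X n sg w| * L%:R <= Num.sqrt n%:R]
    (8 * (1 + (nondeg gamma q)^-1) / L%:R).
Proof.
move=> n0 L0 sg2 ML.
have nR : 0 < n%:R :> R by rewrite ltr0n.
have LR : 0 < L%:R :> R by rewrite ltr0n.
have s0 : 0 < Num.sqrt n%:R :> R by rewrite sqrtr_gt0.
have ss : Num.sqrt n%:R ^+ 2 = n%:R :> R by rewrite sqr_sqrtr // ltW.
set rt := Num.sqrt _ in ML s0 ss *.
pose u (l : 'I_L) j := l%:R / rt * sg j.
have I0 : (0 < #|'I_L|)%N by rewrite card_ord.
have hB (l' : 'I_L) : \sum_(l < L) Num.sqrt (\prod_(j < n) chf2 mu (u l j - u l' j))
    <= 2 * (1 + (nondeg gamma q)^-1).
  apply: le_trans (gauss_sum_le l' (nondeg_gt0 gamma0 q01)); apply: ler_sum => l _.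
  have dl : (l%:R - l'%:R : R) ^+ 2 <= L%:R ^+ 2.
    have : l%:R <= L%:R :> R by rewrite ler_nat ltnW.
    have : l'%:R <= L%:R :> R by rewrite ler_nat ltnW.
    have : 0 <= l%:R :> R by exact: ler0n.
    have : 0 <= l'%:R :> R by exact: ler0n.
    nra.
  pose v := (l%:R - l'%:R) / rt : R.
  have uv j : u l j - u l' j = wave v 0 (if sg j == 1 then 0 else pi) 1.
    rewrite /u /wave mul0r addr0 mul1r -mulrBl -mulrBl -/v; congr (_ * _).
    case: eqP => [->|/eqP ne]; first by rewrite cos0.
    by have /eqP := sg2 j; rewrite sqrf_eq1 (negbTE ne) /= cospi => /eqP.
  have v2 : v ^+ 2 = (l%:R - l'%:R) ^+ 2 / n%:R by rewrite /v exprMn exprVn ss.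
  rewrite -sqrt_expRN2; apply: ler_wsqrtr.
  have -> : 2 * (nondeg gamma q * (l%:R - l'%:R) ^+ 2) =
      pair_mass q * (gamma ^+ 2 * (l%:R - l'%:R) ^+ 2 / 64).
    by rewrite /nondeg; field.
  apply: (chf2_prod_le q01 conc tail (u := fun j => u l j - u l' j)).
    by rewrite divr_ge0 ?ler0n // mulr_ge0 ?sqr_ge0.
  move=> x /andP[x1 x2].
  have xx : gamma ^+ 2 <= x ^+ 2 <= (M + M) ^+ 2.
    rewrite -[x ^+ 2]real_normK ?num_real //; have := ltW gamma0 => g0.
    apply/andP; split; nra.
  have /andP[xx1 xx2] := xx.
  have y1 : (v * x) ^+ 2 <= 1.
    rewrite exprMn v2 mulrAC ler_pdivrMr // mul1r -ss.
    apply: (@le_trans _ _ (L%:R ^+ 2 * (M + M) ^+ 2)).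
      by apply: ler_pM; rewrite ?sqr_ge0.
    rewrite mulrC -exprMn; apply: ler_sqr_pos => //.
    by rewrite mulr_ge0 ?ler0n // addr_ge0 // ltW.
  have term (j : 'I_n) : (gamma ^+ 2 * (l%:R - l'%:R) ^+ 2 / 64) / n%:R <=
      1 - cos ((u l j - u l' j) * x).
    have -> : (u l j - u l' j) * x = sg j * (v * x).
      by rewrite /u -mulrBl /v; ring.
    have -> : cos (sg j * (v * x)) = cos (v * x).
      have /eqP := sg2 j; rewrite sqrf_eq1 => /orP[] /eqP ->.
        by rewrite mul1r.
      by rewrite mulN1r cosN.
    rewrite cosE_half.
    have h := @sqr_sin_ge _ (v * x / 2).
    have {}h : (v * x / 2) ^+ 2 / 4 <= sin (v * x / 2) ^+ 2.
      by apply: h; rewrite exprMn; have := sqr_ge0 (v * x); nra.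
    have e : (v * x / 2) ^+ 2 = x ^+ 2 * ((l%:R - l'%:R) ^+ 2 / n%:R) / 4.
      by rewrite -v2; field.
    have p : 0 <= (l%:R - l'%:R) ^+ 2 / n%:R :> R by rewrite divr_ge0 ?sqr_ge0 // ltW.
    have := ler_wpM2r p xx1; rewrite e in h; nra.
  have := ler_sum (index_enum 'I_n) (fun j (_ : true) => term j).
  rewrite sumr_const card_ord => h; apply: le_trans h.
  by rewrite -[leRHS]mulr_natr divfK // gt_eqF.
have [K [bK K0 K1 Kc]] := discrete_esseen iidX I0 hB.
exists K; split => //.
  move=> w /= hw; apply: K1 => l.
  have -> : lform X n (u l) w = l%:R / rt * lform X n sg w.
    by rewrite /lform mulr_sumr; apply: eq_bigr => j _; rewrite /u; ring.
  rewrite normrM ger0_norm; last by rewrite divr_ge0 ?ler0n // ltW.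
  rewrite mulrAC ler_pdivrMr // mul1r mulrC; apply: le_trans hw.
  by rewrite ler_wpM2l // ler_nat ltnW.
move: Kc; rewrite card_ord => h; apply: (le_trans h).
by rewrite le_eqVlt; apply/predU1P; left; ring.
Qed.

Definition in_ball n th eps : set T :=
  [set w | `|re_poly X n th w| <= eps /\ `|im_poly X n th w| <= eps].

(** In units of the standard deviation [sqrt n], the frequencies form the lattice
    of side [L], so that [1 / L] is the resolution at which the ball is seen;
    [sigma] bounds the conditioning of the covariance of the value at [th]. *)
Lemma majorized_ball n h (th eps sigma nu : R) L : (0 < n)%N -> (0 < L)%N ->
  0 < sigma -> sigma <= sin (h%:R * th) ^+ 2 -> 0 <= nu ->
  2 * L%:R * eps <= Num.sqrt n%:R ->
  (forall a b : R, (a ^+ 2 + b ^+ 2) * n%:R <= 2 * L%:R ^+ 2 ->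
    Num.sqrt (\prod_(j < n) chf2 mu (wave a b th j)) <=
    expR (- (nondeg gamma q * n%:R * sin (h%:R * th) ^+ 2 * (a ^+ 2 + b ^+ 2))) + nu) ->
  majorized (in_ball n th eps)
    (16 * (1 + (nondeg gamma q * sigma)^-1) ^+ 2 / L%:R ^+ 2 + 4 * nu).
Proof.
move=> n0 L0 sg0 sgS nu0 hL hphi.
have nR : 0 < n%:R :> R by rewrite ltr0n.
have LR : 0 < L%:R :> R by rewrite ltr0n.
have s0 : 0 < Num.sqrt n%:R :> R by rewrite sqrtr_gt0.
have ss : Num.sqrt n%:R ^+ 2 = n%:R :> R by rewrite sqr_sqrtr // ltW.
have k0 := nondeg_gt0 gamma0 q01.
set S := sin _ ^+ 2 in sgS hphi *; have S0 : 0 < S by exact: lt_le_trans sgS.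
pose tau : R := (Num.sqrt n%:R)^-1.
have tau0 : 0 < tau by rewrite invr_gt0.
have tau2 : tau ^+ 2 = n%:R^-1 by rewrite /tau exprVn ss.
have b0 : 0 < nondeg gamma q * n%:R * S by apply: mulr_gt0 => //; exact: mulr_gt0.
have [|K [bK K0 K1 Kc]] := small_ball iidX L0 tau0 b0 nu0 (th := th) (n := n).
  move=> a b hab; apply: hphi.
  rewrite -ler_pdivlMr //; apply: le_trans hab _.
  by rewrite exprMn tau2 le_eqVlt; apply/predU1P; left; ring.
exists K; split => // [w [hx hy]|].
  apply: (K1 w eps) => //.
  have -> : 2 * tau * L%:R * eps = 2 * L%:R * eps / Num.sqrt n%:R.
    by rewrite /tau; ring.
  by rewrite ler_pdivrMr // mul1r.
apply: (le_trans Kc).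
have -> : nondeg gamma q * n%:R * S * tau ^+ 2 = nondeg gamma q * S.
  by rewrite tau2; field; rewrite gt_eqF.
rewrite mulrDr lerD2r mulrA ler_wpM2r ?invr_ge0 ?sqr_ge0 //.
rewrite exprMn mulrA.
have -> : 4 * 2 ^+ 2 = 16 :> R by ring.
have kS : 0 < nondeg gamma q * S by exact: mulr_gt0.
have ks : 0 < nondeg gamma q * sigma by exact: mulr_gt0.
rewrite ler_wpM2l //; apply: ler_sqr_pos.
  by rewrite addr_ge0 // invr_ge0 ltW.
by rewrite lerD2l lef_pV2 // ler_wpM2l // ltW.
Qed.

(** Without any arithmetic condition on the angle, only the frequencies where the
    cosine can be expanded are available, hence the limit on [L]. *)
Lemma majorized_ball_small n h (th eps sigma : R) L : (0 < n)%N -> (0 < L)%N ->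
  (2 * h <= n)%N -> 0 < sigma -> sigma <= sin (h%:R * th) ^+ 2 ->
  2 * L%:R * eps <= Num.sqrt n%:R ->
  2 * (M + M) ^+ 2 * L%:R ^+ 2 <= n%:R ->
  majorized (in_ball n th eps)
    (16 * (1 + (nondeg gamma q * sigma)^-1) ^+ 2 / L%:R ^+ 2).
Proof.
move=> n0 L0 hn sg0 sgS hL hV.
have nR : 0 < n%:R :> R by rewrite ltr0n.
have := @majorized_ball n h th eps sigma 0 L n0 L0 sg0 sgS (lexx _) hL.
rewrite mulr0 addr0; apply => a b hab.
rewrite addr0; apply: (charfun_wave_small gamma0 q01 conc tail) => //.
have r0 : 0 <= a ^+ 2 + b ^+ 2 by rewrite addr_ge0 ?sqr_ge0.
have V2 := sqr_ge0 (M + M).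
rewrite -(ler_pM2r nR) mul1r; apply: le_trans hV.
have -> : (M + M) ^+ 2 * (a ^+ 2 + b ^+ 2) * n%:R =
  (M + M) ^+ 2 * ((a ^+ 2 + b ^+ 2) * n%:R) by ring.
have -> : 2 * (M + M) ^+ 2 * L%:R ^+ 2 = (M + M) ^+ 2 * (2 * L%:R ^+ 2) by ring.
exact: ler_wpM2l.
Qed.

(** A step [s] with a small chord raises the limit on [L] by the power [K / 2] of
    the inverse squared chord, at the price of the error [nu]. *)
Lemma majorized_ball_large n h s m K (th eps sigma nu : R) L : (0 < n)%N ->
  (0 < L)%N -> (2 * h <= m)%N -> (m + K * s <= n)%N ->
  chord2 (s%:R * th) <= 1 ->
  0 < sigma -> sigma <= sin (h%:R * th) ^+ 2 ->
  2 * L%:R * eps <= Num.sqrt n%:R ->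
  2 * (M + M) ^+ 2 * L%:R ^+ 2 * chord2 (s%:R * th) ^+ K <= n%:R ->
  expR (- (pair_mass q * ((4^-1) ^+ K *
     (chord2 (s%:R * th) * (m%:R * sigma / 128))))) <= nu ->
  majorized (in_ball n th eps)
    (16 * (1 + (nondeg gamma q * sigma)^-1) ^+ 2 / L%:R ^+ 2 + 4 * nu).
Proof.
move=> n0 L0 hm mn D1 sg0 sgS hL hV hnu.
have nR : 0 < n%:R :> R by rewrite ltr0n.
have D0 := chord2_ge0 (s%:R * th); set D := chord2 _ in D0 D1 hV hnu *.
apply: (majorized_ball n0 L0 sg0 sgS _ hL).
  exact: le_trans (expR_ge0 _) hnu.
move=> a b hab.
apply: le_trans (charfun_wave_large gamma0 q01 conc tail hm mn D1 _) _.
  rewrite -/D -(ler_pM2r nR) mul1r; apply: le_trans hV.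
  have -> : (M + M) ^+ 2 * (a ^+ 2 + b ^+ 2) * D ^+ K * n%:R =
    (M + M) ^+ 2 * D ^+ K * ((a ^+ 2 + b ^+ 2) * n%:R) by ring.
  have -> : 2 * (M + M) ^+ 2 * L%:R ^+ 2 * D ^+ K =
    (M + M) ^+ 2 * D ^+ K * (2 * L%:R ^+ 2) by ring.
  by rewrite ler_wpM2l // mulr_ge0 ?sqr_ge0 ?exprn_ge0.
rewrite lerD2l; apply: le_trans hnu; rewrite ler_expR lerN2.
have pm := pair_mass_gt0 q01.
rewrite -/D; apply: ler_wpM2l; first exact: ltW.
apply: ler_wpM2l; first by rewrite exprn_ge0 ?invr_ge0 ?ler0n.
apply: ler_wpM2l => //; apply: ler_wpM2r; first by rewrite invr_ge0 ler0n.
by apply: ler_wpM2l.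
Qed.

End majorants.

(** * Small balls at the net points away from 1 and -1 *)

Section real_helpers.
Context (R : realType).

Lemma truncn_half (x : R) : 1 <= x ->
  (0 < Num.truncn x)%N /\ (x / 2 <= (Num.truncn x)%:R <= x).
Proof.
move=> x1; have x0 : 0 <= x by lra.
have /andP[h1 h2] := truncn_itv x0.
have p : (0 < Num.truncn x)%N by rewrite truncn_gt0.
split => //; rewrite h1 andbT.
have : 1 <= (Num.truncn x)%:R :> R by rewrite ler1n.
rewrite -natr1 in h2; lra.
Qed.

Lemma leq_4half k : (2 <= k)%N -> (k <= 4 * (k %/ 2))%N.
Proof. lia. Qed.

Lemma sqr_frac_ge0 (x y : R) : 0 <= 16 * x ^+ 2 / y ^+ 2.
Proof. by rewrite divr_ge0 ?sqr_ge0 // mulr_ge0 ?ler0n ?sqr_ge0. Qed.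

Lemma expR_ln_cube (k : nat) (y : R) : (0 < k)%N -> y ^+ 2 = ln k%:R ->
  expR (- (3 * y ^+ 2)) * k%:R ^+ 3 = 1.
Proof.
move=> k0 ->; rewrite -{2}(@lnK R k%:R) ?posrE ?ltr0n //.
rewrite -expRM_natl -expRD -[RHS]expR0; congr expR; ring.
Qed.

End real_helpers.

Section regime.
Context (d : measure_display) (T : measurableType d) (R : realType).
Context (P : probability T R) (mu : probability R R).
Context (X : nat -> {RV P >-> R}).
Hypothesis iidX : iid_with_law X mu.
Variables (M gamma q : R).
Hypothesis gamma0 : 0 < gamma.
Hypothesis q01 : 0 < q < 1.
Hypothesis conc : forall u, (mu [set x | `|x - u| <= gamma]%R <= (1 - q)%:E)%E.
Hypothesis tail : (mu [set x | (M < `|x|)%R] <= (q / 2)%:E)%E.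

Variables (n m N : nat) (r t B0 : R).
Hypothesis t1 : 1 <= t.
Hypothesis mn : (m ^ 24 <= n)%N.
Hypothesis nm : n%:R <= B0 * m%:R ^+ 24.
Hypothesis Nlow : n%:R ^+ 2 * r ^+ 6 <= N%:R.
Hypothesis Nupp : N%:R <= 2 * (n%:R ^+ 2 * r ^+ 6).
Hypothesis rn : r ^+ 2 = ln n%:R.
Hypothesis r24 : 24 <= r.

Let V := M + M.
Let kap := nondeg gamma q.

(** Here [m] is of the order of the 24th root of [n]. The largeness of [n] enters
    only through the fact that [m] exceeds fixed multiples of powers of
    [r = sqrt (ln n)]. *)
Hypothesis big1 : 100 * r ^+ 10 <= m%:R.
Hypothesis big2 : 42 * t <= m%:R.
Hypothesis bigV : 4 * V <= m%:R.
Hypothesis bigV' : 42 * t <= V * m%:R.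
Hypothesis big3 : 2 * V ^+ 2 * B0 * 64 ^+ 13 * r ^+ 8 <= m%:R.
Hypothesis big4 : 3 * r ^+ 2 * (4 ^+ 13 * 4 * 64 * 128) <= pair_mass q * m%:R.

Let r1 : 1 <= r. Proof. by apply: le_trans r24; rewrite ler1n. Qed.
Let t0 : 0 < t. Proof. exact: lt_le_trans t1. Qed.

Let m100 : (100 <= m)%N.
Proof.
rewrite -(ler_nat R); apply: le_trans big1.
have : 1 <= r ^+ 10 by rewrite exprn_ege1.
lra.
Qed.

Let m0 : (0 < m)%N. Proof. exact: leq_trans m100. Qed.

Let mX0 k : (0 < m ^ k)%N. Proof. by rewrite expn_gt0 m0. Qed.

Let mXle k l : (k <= l)%N -> (m ^ k <= m ^ l)%N.
Proof. by move=> kl; rewrite leq_pexp2l. Qed.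

Let mleX k : (0 < k)%N -> (m <= m ^ k)%N.
Proof. by move=> k0; rewrite -{1}[m]expn1 mXle. Qed.

Let m_le_n : (m <= n)%N. Proof. exact: leq_trans (mleX _) mn. Qed.

Let n0 : (0 < n)%N.
Proof. by apply: leq_trans mn; exact: mX0. Qed.

Let nR : 0 < n%:R :> R. Proof. by rewrite ltr0n. Qed.
Let mR : 100 <= m%:R :> R. Proof. by rewrite ler_nat. Qed.

Let m24n : m%:R ^+ 24 <= n%:R :> R.
Proof. by rewrite -natrX ler_nat. Qed.

Let r6 : 1 <= r ^+ 6. Proof. by rewrite exprn_ege1. Qed.

Let m1R : 1 <= m%:R :> R. Proof. by rewrite ler1n. Qed.
Let m0R : 0 < m%:R :> R. Proof. by rewrite ltr0n. Qed.

Let nN : (n ^ 2 <= N)%N.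
Proof.
rewrite -(ler_nat R) natrX; apply: le_trans Nlow.
by rewrite ler_peMr // sqr_ge0.
Qed.

Let mN k : (k <= 48)%N -> (m ^ k <= N)%N.
Proof.
move=> k48; apply: leq_trans nN.
apply: (@leq_trans ((m ^ 24) ^ 2)); last by rewrite leq_exp2r.
rewrite -expnM leq_pexp2l //; lia.
Qed.

Let N0 : (0 < N)%N.
Proof. exact: leq_trans (mN (leq0n 48)). Qed.

Let NR : 0 < N%:R :> R. Proof. by rewrite ltr0n. Qed.

Let eps := 21 * t / (Num.sqrt n%:R * r ^+ 4).
Let nu := expR (- (3 * r ^+ 2)).

Let nuE : nu * n%:R ^+ 3 = 1.
Proof. exact: expR_ln_cube. Qed.

(** For an arc point, [angle k] is within [pi / (n m)] of a multiple of [pi]. The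
    points [mid] are those at distance at most of order [1 / n] from them: off the
    arcs, the covariance is still conditioned polynomially in [m]. For the points
    that are not [bad], [window_step] provides a step [s <= m ^ 22] whose chord is
    between [m ^ -10] and [8 / m]. *)
Definition arc k : Prop := exists2 e, (e * (n * m) <= N)%N & residue N (2 * k) e.
Definition bad k : Prop := near_rational N m (N %/ m ^ 31) k.
Definition mid k : Prop := near_rational N 2 (N %/ n) k.

Let sig := (64 * m%:R ^+ 2)^-1 : R.

Let sig0 : 0 < sig.
Proof. by rewrite invr_gt0 mulr_gt0 ?ltr0n // exprn_gt0. Qed.

(** The lag of [separation_step] gives a conditioning of order [m ^ -2] at worst,
    and an absolute one away from the points [mid]. *)
Lemma nonarc_separation k : ~ arc k -> exists h, [/\ (4 * h <= n)%N,
  sig <= sin (h%:R * angle R N k) ^+ 2 &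
  ~ mid k -> 1 / 64 <= sin (h%:R * angle R N k) ^+ 2].
Proof.
move=> narc; have [e eN res] := residue_nearest N0 (2 * k).
have eA : (N < e * (n * m))%N by rewrite ltnNge; apply/negP => h; apply: narc; exists e.
have e0 : (0 < e)%N by case: (e) eA.
have n8 : (8 <= n)%N by apply: leq_trans m_le_n; exact: leq_trans m100.
have [h hn hs] := separation_step R N0 n8 e0 eN res; exists h; split => //.
  have sig64 : sig <= 1 / 64.
    rewrite /sig invfM div1r ler_piMr ?invr_ge0 ?ler0n //.
    by rewrite invf_le1 ?exprn_gt0 // exprn_ege1.
  case: hs => hs; first exact: le_trans hs.
  apply: le_trans hs.
  have h1 : m%:R^-1 <= n%:R * (e%:R / N%:R) :> R.
    rewrite mulrA ler_pdivlMr // mulrC ler_pdivrMr //.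
    by rewrite -!natrM ler_nat (mulnC n) -mulnA ltnW.
  have -> : sig = (m%:R^-1 / 8) ^+ 2.
    by rewrite /sig exprMn !exprVn invfM mulrC; congr (_ * _^-1); ring.
  apply: ler_sqr_pos; first by rewrite divr_ge0 ?invr_ge0 ?ler0n.
  by rewrite ler_wpM2r // invr_ge0 ler0n.
move=> nmid; case: hs => // hs; apply: le_trans hs.
have eE : (N < e * n)%N.
  rewrite ltnNge; apply/negP => h'; apply: nmid; exists 2%N, e; split => //.
    by rewrite leq_divRL.
  by rewrite mulnC.
have -> : 1 / 64 = (1 / 8) ^+ 2 :> R by field.
apply: ler_sqr_pos => //; rewrite ler_wpM2r ?invr_ge0 ?ler0n //.
by rewrite mulrA ler_pdivlMr // mul1r -natrM ler_nat mulnC ltnW.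
Qed.

Let Lg := Num.truncn (n%:R * r ^+ 4 / (42 * t)).

Let Lg_prop : (0 < Lg)%N /\
  (n%:R * r ^+ 4 / (42 * t) / 2 <= Lg%:R <= n%:R * r ^+ 4 / (42 * t)).
Proof.
apply: truncn_half; rewrite ler_pdivlMr ?mulr_gt0 ?ltr0n // mul1r.
have mn' : m%:R <= n%:R :> R by rewrite ler_nat.
apply: (le_trans big2); apply: (le_trans mn').
by rewrite ler_peMr ?ler0n // exprn_ege1.
Qed.

(** Thirteen differencings cost [13 * m ^ 22 <= n / 2] terms and multiply the
    squared amplitude by at most [(64 / m ^ 2) ^ 13]. The initial squared
    amplitude, in units where the bound is [1], is of order [n r ^ 8], which
    [m ^ 26] exceeds since [n] is of order [m ^ 24]. The remaining energy is of
    order [m ^ -20 * n * sig], that is, [m ^ 2], and beats [3 ln n]. *)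
Lemma majorized_good k h (sigma : R) : ~ bad k -> (4 * h <= n)%N ->
  sig <= sigma -> sigma <= sin (h%:R * angle R N k) ^+ 2 ->
  majorized P (in_ball X n (angle R N k) eps)
    (16 * (1 + (kap * sigma)^-1) ^+ 2 / Lg%:R ^+ 2 + 4 * nu).
Proof.
move=> nbad hn sgs sgS.
have m31 := mX0 31; have m10 := mX0 10.
have far s e : (0 < s)%N -> (s <= m)%N -> residue N (k * s) e ->
    (N %/ m ^ 31 < e)%N.
  move=> s0 sm res; rewrite ltnNge; apply/negP => h'; apply: nbad.
  by exists s, e.
have [s [e [sS Te eS res]]] := @window_step N N0 k m (N %/ m ^ 10) _ m0 far.
have s22 : (s <= m ^ 22)%N.
  apply: (leq_trans sS); rewrite [X in (_ <= X)%N]expnS leq_mul2l.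
  apply/orP; right; rewrite ltn_divLR //.
  have h1 : (N < (N %/ m ^ 31).+1 * m ^ 31)%N by rewrite -ltn_divLR.
  have h2 : (N %/ m ^ 10 * m ^ 10 <= N)%N by exact: leq_divM.
  rewrite -(ltn_pmul2r m10); apply: (leq_ltn_trans h2); apply: (leq_trans h1).
  have -> : (m ^ 31 = m ^ 21 * m ^ 10)%N by rewrite -expnD.
  by rewrite mulnA [X in (X * m ^ 10 <= _)%N]mulnC.
(* Half of the terms are kept for the final energy, the other half pays for
   the differencings. *)
pose ml := (n %/ 2)%N.
have hml : (2 * h <= ml)%N by rewrite /ml leq_divRL // mulnC mulnA.
have mln : (ml + 13 * s <= n)%N.
  have h1 : (26 * m ^ 22 <= n)%N.
    apply: leq_trans mn; rewrite (expnD m 2 22) leq_mul2r; apply/orP; right.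
    by apply: leq_trans (mleX (k := 2) isT); exact: leq_trans m100.
  have h2 : (ml * 2 <= n)%N by exact: leq_divM.
  rewrite -(leq_pmul2r (_ : 0 < 2)%N) // mulnDl.
  apply: (@leq_trans (n + n)); last by rewrite addnn muln2.
  apply: leq_add => //; apply: leq_trans h1.
  by rewrite mulnAC leq_mul.
have x0 : 0 <= e%:R / N%:R :> R by rewrite divr_ge0 ?ler0n.
have xm : e%:R / N%:R <= m%:R^-1 :> R.
  rewrite ler_pdivrMr // mulrC ler_pdivlMr //.
  rewrite -natrM ler_nat; case: eS => // e2.
  apply: leq_trans (leq_divM N (m ^ 10)).
  apply: leq_trans (leq_mul e2 (leqnn m)) _.
  rewrite mulnAC mulnC leq_mul2l; apply/orP; right.
  rewrite expnS mulnC leq_mul2l; apply/orP; right.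
  apply: leq_trans (mleX (k := 9) isT); exact: leq_trans m100.
have xl : (m%:R ^+ 10)^-1 / 2 <= e%:R / N%:R :> R.
  rewrite ler_pdivlMr // mulrAC ler_pdivrMr ?ltr0n // mulrC ler_pdivrMr ?exprn_gt0 //.
  rewrite -natrX -!natrM ler_nat.
  have h1 : (N < (N %/ m ^ 10).+1 * m ^ 10)%N by rewrite -ltn_divLR.
  have h2 : (0 < N %/ m ^ 10)%N by rewrite divn_gt0 //; exact: mN.
  apply: (leq_trans (ltnW h1)).
  rewrite leq_mul2r; apply/orP; right.
  by rewrite muln2 -addnn -addn1 leq_add // (leq_trans h2).
have sk : s%:R * angle R N k = angle R N (k * s) by exact: angleM.
have cE : chord2 (s%:R * angle R N k) = chord2 (angle R N e).
  by rewrite sk /chord2 (cos_residue _ N0 res).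
have Dup : chord2 (angle R N e) <= 64 / m%:R ^+ 2.
  apply: le_trans (chord2_angle_le R N0 e) _.
  rewrite ler_wpM2l //; rewrite -exprVn; exact: ler_sqr_pos.
have e4 : (4 * e <= N)%N.
  rewrite -(ler_nat R) natrM -ler_pdivlMl ?ltr0n // mulrC -ler_pdivrMl // mulrC.
  by apply: (le_trans xm); rewrite lef_pV2 ?posrE ?ltr0n // ler_nat (leq_trans _ m100).
have D0 := chord2_ge0 (angle R N e).
have Dlow : (m%:R ^+ 20)^-1 <= chord2 (angle R N e).
  apply: le_trans (chord2_angle_ge R N0 e4).
  have {}h' : (m%:R ^+ 20)^-1 / 2 ^+ 2 <= (e%:R / N%:R) ^+ 2 :> R.
    have p : 0 <= (m%:R ^+ 10)^-1 / 2 :> R by rewrite divr_ge0 ?invr_ge0 ?exprn_ge0 ?ler0n.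
    by have := ler_sqr_pos p xl; rewrite exprMn !exprVn -exprM.
  lra.
have [Lg0 /andP[Lg1 Lg2]] := Lg_prop.
have s0 : 0 < Num.sqrt n%:R :> R by rewrite sqrtr_gt0.
have ss : Num.sqrt n%:R * Num.sqrt n%:R = n%:R :> R.
  by rewrite -expr2 sqr_sqrtr // ltW.
have r0 : 0 < r by exact: lt_le_trans r1.
have r40 : 0 < r ^+ 4 by exact: exprn_gt0.
have sigma0 : 0 < sigma by exact: lt_le_trans sgs.
apply: (majorized_ball_large iidX gamma0 q01 conc tail n0 Lg0 hml mln (K := 13)
  (s := s) _ sigma0 sgS).
- rewrite cE; apply: (le_trans Dup); rewrite ler_pdivrMr ?exprn_gt0 // mul1r.
  apply: (@le_trans _ _ m%:R); last by rewrite -{1}[m%:R]expr1 ler_weXn2l.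
  by apply: le_trans mR; rewrite ler_nat.
- rewrite /eps mulrA ler_pdivrMr ?mulr_gt0 //.
  rewrite [X in _ <= X]mulrA ss; move: Lg2; rewrite ler_pdivlMr ?mulr_gt0 ?ltr0n // => h2.
  lra.
- rewrite cE; apply: (@le_trans _ _ (2 * V ^+ 2 * (n%:R * r ^+ 4) ^+ 2 *
    (64 ^+ 13 / (m%:R ^+ 24 * m%:R ^+ 2)))).
    apply: ler_pM.
    + by rewrite mulr_ge0 ?sqr_ge0 // mulr_ge0 ?sqr_ge0.
    + exact: exprn_ge0.
    + apply: ler_wpM2l; first by rewrite mulr_ge0 ?sqr_ge0.
      apply: ler_sqr_pos => //; apply: (le_trans Lg2).
      rewrite ler_pdivrMr ?mulr_gt0 ?ltr0n // ler_peMr //.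
        by rewrite mulr_ge0 // ltW.
      by have := t1; lra.
    + rewrite -exprD; have -> : (24 + 2 = 2 * 13)%N by [].
      by rewrite exprM -exprVn -exprMn; apply: lerXn2r => //; rewrite nnegrE // divr_ge0 ?sqr_ge0.
  rewrite mulrA ler_pdivrMr ?mulr_gt0 ?exprn_gt0 //.
  set c := 64 ^+ 13.
  have c0 : 0 <= c by rewrite exprn_ge0.
  have b3 : 2 * V ^+ 2 * B0 * c * r ^+ 8 <= m%:R by exact: big3.
  have -> : 2 * V ^+ 2 * (n%:R * r ^+ 4) ^+ 2 * c =
    n%:R * (2 * V ^+ 2 * c * r ^+ 8 * n%:R) by ring.
  apply: ler_wpM2l; first exact: ler0n.
  apply: (@le_trans _ _ (2 * V ^+ 2 * c * r ^+ 8 * (B0 * m%:R ^+ 24))).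
    apply: ler_wpM2l => //; rewrite mulr_ge0 ?exprn_ge0 // ?(ltW r0) //.
    by rewrite mulr_ge0 // mulr_ge0 ?sqr_ge0.
  have -> : 2 * V ^+ 2 * c * r ^+ 8 * (B0 * m%:R ^+ 24) =
    m%:R ^+ 24 * (2 * V ^+ 2 * B0 * c * r ^+ 8) by ring.
  apply: ler_wpM2l; first by rewrite exprn_ge0 ?ler0n.
  by apply: (le_trans b3); rewrite -{1}[m%:R]expr1 ler_weXn2l.
rewrite cE /nu ler_expR lerN2 exprVn; set c := 4 ^+ 13.
have c0 : 0 < c by rewrite exprn_gt0.
have pm := pair_mass_gt0 q01.
have b4 : 3 * r ^+ 2 * (c * 4 * 64 * 128) <= pair_mass q * m%:R by exact: big4.
have mlR : m%:R ^+ 24 / 4 <= ml%:R :> R.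
  apply: (@le_trans _ _ (n%:R / 4)); first by rewrite ler_wpM2r.
  have h2 : (n <= 4 * ml)%N.
    by apply: leq_4half; apply: leq_trans m_le_n; exact: leq_trans m100.
  by rewrite ler_pdivrMr // mulrC -natrM ler_nat.
apply: (@le_trans _ _ (pair_mass q * (c^-1 * ((m%:R ^+ 20)^-1 *
    (m%:R ^+ 24 / 4 * sig / 128))))).
  have -> : pair_mass q * (c^-1 * ((m%:R ^+ 20)^-1 * (m%:R ^+ 24 / 4 * sig / 128))) =
    pair_mass q * m%:R ^+ 2 / (c * 4 * 64 * 128).
    by rewrite /sig; field; rewrite !gt_eqF.
  rewrite ler_pdivlMr; last by rewrite !mulr_gt0 ?ltr0n.
  apply: (le_trans b4); rewrite ler_pM2l //.
  by rewrite -{1}[m%:R]expr1 ler_weXn2l.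
apply: ler_wpM2l; first exact: ltW.
apply: ler_wpM2l; first by rewrite invr_ge0 ltW.
have x24 : 0 <= m%:R ^+ 24 / 4 :> R by rewrite divr_ge0 ?exprn_ge0 ?ler0n.
apply: ler_pM; [by rewrite invr_ge0 exprn_ge0 ?ler0n | | exact: Dlow | ].
  by rewrite divr_ge0 ?ler0n // mulr_ge0 // ltW.
apply: ler_wpM2r; first by rewrite invr_ge0 ler0n.
by apply: ler_pM => //; exact: ltW.
Qed.

Hypothesis V0 : 0 < V.

Let Lb := Num.truncn (Num.sqrt n%:R / (2 * V)).

Let mm_n : m%:R ^+ 2 <= n%:R :> R.
Proof. by apply: le_trans m24n; rewrite ler_weXn2l. Qed.

Let m_sqrt : m%:R <= Num.sqrt n%:R :> R.
Proof. by rewrite -[leLHS](@ger0_norm R) // -sqrtr_sqr ler_wsqrtr. Qed.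

Let Lb_prop : (0 < Lb)%N /\
  (Num.sqrt n%:R / (2 * V) / 2 <= Lb%:R <= Num.sqrt n%:R / (2 * V)).
Proof.
apply: truncn_half; rewrite ler_pdivlMr ?mulr_gt0 ?ltr0n // mul1r.
by apply: le_trans m_sqrt; apply: le_trans bigV; rewrite ler_pM2r // ler_nat.
Qed.

Lemma majorized_bad k h (sigma : R) : (4 * h <= n)%N -> 0 < sigma ->
  sigma <= sin (h%:R * angle R N k) ^+ 2 ->
  majorized P (in_ball X n (angle R N k) eps)
    (16 * (1 + (kap * sigma)^-1) ^+ 2 / Lb%:R ^+ 2).
Proof.
move=> hn sg0 sgS; have [Lb0 /andP[_]] := Lb_prop.
have s0 : 0 < Num.sqrt n%:R :> R by rewrite sqrtr_gt0.
have ss : Num.sqrt n%:R * Num.sqrt n%:R = n%:R :> R.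
  by rewrite -expr2 sqr_sqrtr // ltW.
rewrite ler_pdivlMr ?mulr_gt0 ?ltr0n // => Lb2.
have hn2 : (2 * h <= n)%N.
  by apply: leq_trans hn; rewrite leq_mul2r orbT.
have LV0 : 0 <= Lb%:R * (2 * V) by rewrite mulr_ge0 ?ler0n // ltW ?mulr_gt0.
apply: (majorized_ball_small iidX gamma0 q01 conc tail n0 Lb0 hn2 sg0 sgS).
  have r40 : 1 <= r ^+ 4 by exact: exprn_ege1.
  rewrite /eps mulrA ler_pdivrMr; last first.
    by rewrite mulr_gt0 // (lt_le_trans _ r40).
  rewrite [X in _ <= X]mulrA ss.
  apply: (@le_trans _ _ n%:R); last by rewrite ler_peMr ?ler0n.
  apply: (@le_trans _ _ (Lb%:R * (V * m%:R))).
    have -> : 2 * Lb%:R * (21 * t) = Lb%:R * (42 * t) by ring.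
    by rewrite ler_wpM2l ?ler0n.
  apply: (@le_trans _ _ (Lb%:R * (2 * V) * m%:R)).
    have := mulr_ge0 (mulr_ge0 (ler0n R Lb) (ltW V0)) (ltW m0R); lra.
  by rewrite -ss; apply: ler_pM.
have -> : 2 * (M + M) ^+ 2 * Lb%:R ^+ 2 = (Lb%:R * (2 * V)) ^+ 2 / 2.
  by rewrite /V; field.
have := ler_sqr_pos LV0 Lb2; rewrite sqr_sqrtr ?(ltW nR) // => h1.
have := ltW nR; lra.
Qed.

Let g : R := 1 + 64 / kap.

Hypothesis big5 : 4096 * g ^+ 2 * V ^+ 2 * B0 * r ^+ 7 <= m%:R.
Hypothesis big6 : 64 * 16 * 84 ^+ 2 * g ^+ 2 * t ^+ 2 <= m%:R.

Let kap0 : 0 < kap. Proof. exact: nondeg_gt0. Qed.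

Let condition_sig : (1 + (kap * sig)^-1) ^+ 2 <= m%:R ^+ 4 * g ^+ 2.
Proof.
have m2 : 1 <= m%:R ^+ 2 :> R by exact: exprn_ege1.
have e : 1 + (kap * sig)^-1 = 1 + m%:R ^+ 2 * (64 / kap).
  by rewrite /sig; field; rewrite !gt_eqF.
have g0 : 0 <= 64 / kap by rewrite divr_ge0 ?ler0n // ltW.
have -> : m%:R ^+ 4 * g ^+ 2 = (m%:R ^+ 2 * g) ^+ 2 by ring.
rewrite e; apply: ler_sqr_pos.
  by rewrite addr_ge0 // mulr_ge0 // ?sqr_ge0.
by rewrite /g mulrDr mulr1 lerD2r.
Qed.

Let c_bad := 16 * (1 + (kap * sig)^-1) ^+ 2 / Lb%:R ^+ 2.
Let c_mid := 16 * (1 + (kap * sig)^-1) ^+ 2 / Lg%:R ^+ 2 + 4 * nu.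
Let c_core := 16 * g ^+ 2 / Lg%:R ^+ 2 + 4 * nu.

Let nu0 : 0 <= nu. Proof. exact: expR_ge0. Qed.

Let cb0 : 0 <= c_bad. Proof. exact: sqr_frac_ge0. Qed.
Let cm0 : 0 <= c_mid.
Proof. by rewrite addr_ge0 ?sqr_frac_ge0 // mulr_ge0 ?ler0n. Qed.
Let cc0 : 0 <= c_core.
Proof. by rewrite addr_ge0 ?sqr_frac_ge0 // mulr_ge0 ?ler0n. Qed.

(** Every point off the arcs is charged the sum of the costs of the types it
    belongs to. *)
Lemma majorized_net :
  majorized P [set w | exists k : 'I_N, ~ arc k /\ in_ball X n (angle R N k) eps w]
    (#|finset (fun k : 'I_N => `[< bad k >])|%:R * c_bad +
     #|finset (fun k : 'I_N => `[< mid k >])|%:R * c_mid + N%:R * c_core).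
Proof.
pose B := finset (fun k : 'I_N => `[< bad k >]); pose D := finset (fun k : 'I_N => `[< mid k >]).
pose c (k : 'I_N) : R := (if k \in B then c_bad else 0) +
  (if k \in D then c_mid else 0) + c_core.
have h (k : 'I_N) : majorized P
    [set w | ~ arc k /\ in_ball X n (angle R N k) eps w] (c k).
  have [ak|nak] := pselect (arc k).
    apply: (@majorized_le _ _ _ _ _ set0 0 (c k)).
    - by move=> w [].
    - by rewrite /c addr_ge0 // addr_ge0 //; case: ifP.
    - exact: majorized0.
  have [h [hn hs hs']] := nonarc_separation nak.
  rewrite /c /B /D !inE; case: asboolP => [bk|nbk].
    apply: majorized_le (majorized_bad hn sig0 hs); first by move=> w [].
    by rewrite -addrA lerDl addr_ge0 //; case: ifP.
  case: asboolP => [mk|nmk].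
    apply: majorized_le (majorized_good nbk hn (lexx _) hs); first by move=> w [].
    by rewrite add0r lerDl.
  rewrite !add0r; apply: majorized_le (majorized_good nbk hn _ (hs' nmk)).
  - by move=> w [].
  - rewrite /c_core lerD2r le_eqVlt; apply/predU1P; left.
    by congr (16 * _ ^+ 2 / _); rewrite /g; field; rewrite gt_eqF.
  - rewrite /sig invfM div1r ler_piMr ?invr_ge0 ?ler0n //.
    by rewrite invf_le1 ?exprn_gt0 // exprn_ege1.
apply: majorized_le (majorized_bigcup h); first by [].
rewrite /c !big_split /= -!big_mkcond /= !sumr_const card_ord.
by rewrite -mulrnDl -[_ *+ N]mulr_natl -[c_bad *+ _]mulr_natl -[c_mid *+ _]mulr_natl.
Qed.

Lemma card_bad_le : #|finset (fun k : 'I_N => `[< bad k >])|%:R <= 8 * m%:R ^+ 2 * (N%:R / m%:R ^+ 31) :> R.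
Proof.
have mN31 : (m ^ 31 <= N)%N by exact: mN.
have vN : (N %/ m ^ 31 < N)%N.
  by rewrite ltn_Pdiv // -(exp1n 31) ltn_exp2r //; exact: leq_trans m100.
have h := @card_near_rational N N0 m (N %/ m ^ 31) (finset (fun k : 'I_N => `[< bad k >])) vN _.
apply: (@le_trans _ _ (m * m.+2 * (N %/ m ^ 31).+1 * 2)%N%:R).
  by rewrite ler_nat; apply: h => k; rewrite inE => /asboolP.
have v1 : (N %/ m ^ 31)%:R + 1 <= 2 * (N%:R / m%:R ^+ 31) :> R.
  have a1 : (N %/ m ^ 31)%:R <= N%:R / m%:R ^+ 31 :> R.
    by rewrite ler_pdivlMr ?exprn_gt0 // -natrX -natrM ler_nat leq_divM.
  have a2 : 1 <= N%:R / m%:R ^+ 31 :> R.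
    by rewrite ler_pdivlMr ?exprn_gt0 // mul1r -natrX ler_nat.
  lra.
rewrite !natrM -[(N %/ m ^ 31).+1%:R]natr1.
have m2 : m.+2%:R <= 2 * m%:R :> R.
  rewrite -natrM ler_nat mul2n -addnn -addn2 leq_add2l; exact: leq_trans m100.
have vv0 : 0 <= (N %/ m ^ 31)%:R :> R by exact: ler0n.
have -> : 8 * m%:R ^+ 2 * (N%:R / m%:R ^+ 31) =
  m%:R * (2 * m%:R) * (2 * (N%:R / m%:R ^+ 31)) * 2 :> R by ring.
rewrite ler_wpM2r //; apply: ler_pM => //.
by rewrite ler_wpM2l ?ler0n.
Qed.

Lemma card_mid_le : #|finset (fun k : 'I_N => `[< mid k >])|%:R <= 32 * (N%:R / n%:R) :> R.
Proof.
have nN' : (n <= N)%N by apply: leq_trans nN; rewrite expnS expn1 leq_pmulr.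
have vN : (N %/ n < N)%N.
  by rewrite ltn_Pdiv //; apply: leq_trans m_le_n; exact: leq_trans m100.
have h := @card_near_rational N N0 2 (N %/ n) (finset (fun k : 'I_N => `[< mid k >])) vN _.
apply: (@le_trans _ _ (2 * 4 * (N %/ n).+1 * 2)%N%:R).
  by rewrite ler_nat; apply: h => k; rewrite inE => /asboolP.
have a1 : (N %/ n)%:R <= N%:R / n%:R :> R.
  by rewrite ler_pdivlMr // -natrM ler_nat leq_divM.
have a2 : 1 <= N%:R / n%:R :> R by rewrite ler_pdivlMr // mul1r ler_nat.
rewrite !natrM -[(N %/ n).+1%:R]natr1; lra.
Qed.

(** There are at most [N m ^ -29] bad points, up to constants, each of cost
    [m ^ 4 / n]: in total [r ^ 6 / m]. The [N / n] points [mid] cost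
    [m ^ 4 / (n ^ 2 r ^ 8)] each, and each of the [N] points at most
    [1 / (n ^ 2 r ^ 8)]; the latter contribution, of order [r ^ -2], dominates. *)
Lemma majorized_net_total :
  majorized P [set w | exists k : 'I_N, ~ arc k /\ in_ball X n (angle R N k) eps w]
    ((4 + 32 * (84 ^+ 2 * g ^+ 2 * t ^+ 2)) / r).
Proof.
apply: majorized_le majorized_net; first by [].
have r0 : 0 < r by exact: lt_le_trans r1.
have nuE' : nu = (n%:R ^+ 3)^-1.
  have n3 : n%:R ^+ 3 != 0 :> R by rewrite expf_neq0 // gt_eqF.
  by apply: (mulIf n3); rewrite nuE mulVf.
have m2 : 1 <= m%:R ^+ 2 :> R by exact: exprn_ege1.
have g2 : 0 <= g ^+ 2 by exact: sqr_ge0.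
have t2 : 0 <= t ^+ 2 by exact: sqr_ge0.
have bb : #|finset (fun k : 'I_N => `[< bad k >])|%:R * c_bad <= 1 / r.
  have [Lb0 /andP[Lb1 _]] := Lb_prop.
  have cb : c_bad <= 256 * m%:R ^+ 4 * g ^+ 2 * V ^+ 2 / n%:R.
    have LB : n%:R / (16 * V ^+ 2) <= Lb%:R ^+ 2 :> R.
      have -> : n%:R / (16 * V ^+ 2) = (Num.sqrt n%:R / (2 * V) / 2) ^+ 2.
        rewrite !exprMn !exprVn sqr_sqrtr ?(ltW nR) // exprMn.
        by field; rewrite gt_eqF.
      apply: ler_sqr_pos Lb1.
      by rewrite divr_ge0 // divr_ge0 ?sqrtr_ge0 // mulr_ge0 // ltW.
    have v2 : 0 < V ^+ 2 by exact: exprn_gt0.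
    have LB0 : 0 < n%:R / (16 * V ^+ 2) by rewrite divr_gt0 ?mulr_gt0 ?ltr0n.
    rewrite /c_bad; apply: (@le_trans _ _ (16 * (m%:R ^+ 4 * g ^+ 2) / (n%:R / (16 * V ^+ 2)))).
      apply: ler_pM; [by rewrite mulr_ge0 ?ler0n ?sqr_ge0 |
        by rewrite invr_ge0 sqr_ge0 | by apply: ler_wpM2l | ].
      by rewrite lef_pV2 ?posrE // exprn_gt0 // ltr0n.
    rewrite le_eqVlt; apply/predU1P; left; field; rewrite !gt_eqF //.
  apply: (@le_trans _ _ (8 * m%:R ^+ 2 * (N%:R / m%:R ^+ 31) *
      (256 * m%:R ^+ 4 * g ^+ 2 * V ^+ 2 / n%:R))).
    by apply: ler_pM => //; exact: card_bad_le.
  apply: (@le_trans _ _ (8 * m%:R ^+ 2 * ((2 * (n%:R * (B0 * m%:R ^+ 24) * r ^+ 6)) / m%:R ^+ 31) *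
      (256 * m%:R ^+ 4 * g ^+ 2 * V ^+ 2 / n%:R))).
    apply: ler_wpM2r.
      apply: divr_ge0 (ler0n _ _); apply: mulr_ge0 (sqr_ge0 _).
      by apply: mulr_ge0 g2; apply: mulr_ge0 (ler0n _ _) (exprn_ge0 _ (ler0n _ _)).
    apply: ler_wpM2l; first by rewrite mulr_ge0 ?sqr_ge0.
    apply: ler_wpM2r; first by rewrite invr_ge0 exprn_ge0 ?ler0n.
    apply: (le_trans Nupp); rewrite ler_wpM2l // ler_wpM2r ?(le_trans ler01 r6) //.
    by rewrite expr2 ler_wpM2l // ler0n.
  have -> : 8 * m%:R ^+ 2 * ((2 * (n%:R * (B0 * m%:R ^+ 24) * r ^+ 6)) / m%:R ^+ 31) *
      (256 * m%:R ^+ 4 * g ^+ 2 * V ^+ 2 / n%:R) =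
      4096 * g ^+ 2 * V ^+ 2 * B0 * r ^+ 6 / m%:R.
    by field; rewrite !gt_eqF.
  rewrite ler_pdivrMr // [leRHS]mulrAC mul1r ler_pdivlMr // -(mulrA _ (r ^+ 6) r) -exprSr.
  exact: big5.
have LG : (n%:R * r ^+ 4 / (84 * t)) ^+ 2 <= Lg%:R ^+ 2 :> R.
  have [_ /andP[Lg1 _]] := Lg_prop.
  have -> : n%:R * r ^+ 4 / (84 * t) = n%:R * r ^+ 4 / (42 * t) / 2.
    by field; rewrite gt_eqF.
  apply: ler_sqr_pos Lg1.
  by rewrite divr_ge0 // divr_ge0 ?mulr_ge0 ?ler0n ?exprn_ge0 ?(ltW t0) ?(ltW r0).
have [Lg0 _] := Lg_prop.
have LGpos : 0 < (n%:R * r ^+ 4 / (84 * t)) ^+ 2.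
  by rewrite exprn_gt0 // divr_gt0 ?mulr_gt0 ?ltr0n ?exprn_gt0.
have LGinv : (Lg%:R ^+ 2)^-1 <= 84 ^+ 2 * t ^+ 2 / (n%:R ^+ 2 * r ^+ 8) :> R.
  apply: (@le_trans _ _ ((n%:R * r ^+ 4 / (84 * t)) ^+ 2)^-1).
    by rewrite lef_pV2 ?posrE // exprn_gt0 // ltr0n.
  rewrite le_eqVlt; apply/predU1P; left; field; rewrite !gt_eqF //.
have N2 : N%:R / n%:R <= 2 * (n%:R * r ^+ 6) :> R.
  rewrite ler_pdivrMr //; apply: (le_trans Nupp).
  by rewrite le_eqVlt; apply/predU1P; left; ring.
have r7m : r ^+ 7 <= m%:R.
  apply: le_trans (le_trans _ big1); first exact: ler_weXn2l (_ : (7 <= 10)%N).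
  by rewrite ler_peMl ?exprn_ge0 ?(ltW r0) // ler1n.
have dd : #|finset (fun k : 'I_N => `[< mid k >])|%:R * c_mid <= 2 / r.
  pose u := 16 * (m%:R ^+ 4 * g ^+ 2) * (84 ^+ 2 * t ^+ 2 / (n%:R ^+ 2 * r ^+ 8)) + 4 * nu.
  have cmu : c_mid <= u.
    rewrite /c_mid /u lerD2r; apply: ler_pM; [by rewrite mulr_ge0 ?ler0n ?sqr_ge0 |
      by rewrite invr_ge0 sqr_ge0 | by apply: ler_wpM2l | exact: LGinv].
  apply: (@le_trans _ _ (32 * (2 * (n%:R * r ^+ 6)) * u)).
    apply: ler_pM => //; apply: (le_trans card_mid_le); exact: ler_wpM2l.
  have -> : 32 * (2 * (n%:R * r ^+ 6)) * u =
    64 * 16 * 84 ^+ 2 * g ^+ 2 * t ^+ 2 * (m%:R ^+ 4 / (n%:R * r ^+ 2)) +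
    16 * 16 * r ^+ 6 / n%:R ^+ 2.
    by rewrite /u nuE'; field; rewrite !gt_eqF.
  have m5n : m%:R ^+ 5 <= n%:R :> R.
    by apply: le_trans m24n; exact: ler_weXn2l.
  have p1 : 64 * 16 * 84 ^+ 2 * g ^+ 2 * t ^+ 2 * (m%:R ^+ 4 / (n%:R * r ^+ 2)) <= 1 / r.
    apply: (@le_trans _ _ (m%:R * (m%:R ^+ 4 / (n%:R * r ^+ 2)))).
      apply: ler_wpM2r big6.
      by rewrite divr_ge0 ?exprn_ge0 ?ler0n // mulr_ge0 ?ler0n ?sqr_ge0.
    rewrite mulrA -exprS ler_pdivrMr ?mulr_gt0 ?exprn_gt0 //.
    have -> : 1 / r * (n%:R * r ^+ 2) = n%:R * r by field; rewrite gt_eqF.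
    by apply: (le_trans m5n); rewrite ler_peMr ?ler0n.
  have p2 : 16 * 16 * r ^+ 6 / n%:R ^+ 2 <= 1 / r.
    rewrite ler_pdivrMr ?exprn_gt0 // [leRHS]mulrAC mul1r ler_pdivlMr // -(mulrA _ (r ^+ 6) r) -exprSr.
    apply: (@le_trans _ _ (n%:R * m%:R)); last first.
      by rewrite expr2 ler_wpM2l ?ler0n // ler_nat.
    apply: ler_pM => //; first exact: exprn_ge0 (ltW r0).
    apply: (@le_trans _ _ (m%:R ^+ 2)) => //.
    have := mR; rewrite expr2; nra.
  lra.
have ee : N%:R * c_core <= (1 + 32 * (84 ^+ 2 * g ^+ 2 * t ^+ 2)) / r.
  pose u := 16 * g ^+ 2 * (84 ^+ 2 * t ^+ 2 / (n%:R ^+ 2 * r ^+ 8)) + 4 * nu.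
  have ccu : c_core <= u.
    rewrite /c_core /u lerD2r; apply: ler_wpM2l => //.
    by rewrite mulr_ge0 ?ler0n.
  apply: (@le_trans _ _ (2 * (n%:R ^+ 2 * r ^+ 6) * u)); first exact: ler_pM.
  have -> : 2 * (n%:R ^+ 2 * r ^+ 6) * u =
    32 * (84 ^+ 2 * g ^+ 2 * t ^+ 2) / r ^+ 2 + 8 * r ^+ 6 / n%:R.
    by rewrite /u nuE'; field; rewrite !gt_eqF.
  have p1 : 32 * (84 ^+ 2 * g ^+ 2 * t ^+ 2) / r ^+ 2 <= 32 * (84 ^+ 2 * g ^+ 2 * t ^+ 2) / r.
    apply: ler_wpM2l; first by rewrite mulr_ge0 ?ler0n // mulr_ge0 // mulr_ge0 // sqr_ge0.
    by rewrite lef_pV2 ?posrE ?exprn_gt0 // -{1}[r]expr1 ler_weXn2l.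
  have p2 : 8 * r ^+ 6 / n%:R <= 1 / r.
    rewrite ler_pdivrMr // [leRHS]mulrAC mul1r ler_pdivlMr // -(mulrA _ (r ^+ 6) r) -exprSr.
    apply: (@le_trans _ _ (m%:R ^+ 2)) => //.
    have := mR; have := exprn_ge0 7 (ltW r0); rewrite expr2; nra.
  rewrite mulrDl; lra.
have -> : (4 + 32 * (84 ^+ 2 * g ^+ 2 * t ^+ 2)) / r =
  1 / r + 2 / r + (1 + 32 * (84 ^+ 2 * g ^+ 2 * t ^+ 2)) / r by ring.
by apply: lerD => //; apply: lerD.
Qed.

End regime.

(** * Derivatives, arcs around the real points, and energy *)

Section arcs.
Context (R : realType).

Definition sign_seq (b : bool) (j : nat) : R := (-1) ^+ (b * j).

Lemma sign_seq_sqr b j : sign_seq b j ^+ 2 = 1.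
Proof. by rewrite /sign_seq -exprM mulnC exprM sqrrN expr1n expr1n. Qed.

Lemma normr_sign_seq b j : `|sign_seq b j| = 1.
Proof. by rewrite /sign_seq normrX normrN1 expr1n. Qed.

Lemma cos_shift_pi (j q : nat) (y : R) :
  cos (j%:R * (q%:R * pi + y)) = sign_seq (odd q) j * cos (j%:R * y).
Proof.
have -> : j%:R * (q%:R * pi + y) = j%:R * y + pi *+ (q * j).
  by rewrite -[pi *+ _]mulr_natl natrM; ring.
rewrite (alternatingn (@cosDpi R)) /sign_seq; congr (_ * _).
by rewrite [LHS]exprM -signr_odd -exprM.
Qed.

(** The nearest multiple [q * pi] of [pi] to the angle only contributes the sign
    [(-1)^(q j)], the same alternating or constant sequence on the whole arc. *)
Lemma arc_angle N (N0 : (0 < N)%N) k e : residue N (2 * k) e ->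
  exists b, forall j, cos (j%:R * angle R N k) =
    sign_seq b j * cos (j%:R * (pi * (e%:R / N%:R))).
Proof.
have NR : (N%:R : R) != 0 by rewrite pnatr_eq0 -lt0n.
move=> [q [h|h]]; exists (odd q) => j.
  rewrite -cos_shift_pi; congr (cos (_ * _)).
  have {}h : 2 * k%:R = q%:R * N%:R + e%:R :> R by rewrite -!natrM h natrD.
  have -> : angle R N k = 2 * k%:R * (pi / N%:R) by rewrite /angle mulr2n; field.
  by rewrite h; field.
have -> : cos (j%:R * ((pi : R) * (e%:R / N%:R))) = cos (j%:R * (- (pi * (e%:R / N%:R)))).
  by rewrite -cosN; congr cos; ring.
rewrite -cos_shift_pi; congr (cos (_ * _)).
have {}h : 2 * k%:R = q%:R * N%:R - e%:R :> R by rewrite -!natrM -h natrD addrK.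
have -> : angle R N k = 2 * k%:R * (pi / N%:R) by rewrite /angle mulr2n; field.
by rewrite h; field.
Qed.

Context (d : measure_display) (T : measurableType d).
Context (P : probability T R) (mu : probability R R).
Context (X : nat -> {RV P >-> R}).
Hypothesis iidX : iid_with_law X mu.
Variables (M gamma q : R).
Hypothesis M0 : 0 < M.
Hypothesis gamma0 : 0 < gamma.
Hypothesis q01 : 0 < q < 1.
Hypothesis conc : forall u, (mu [set x | `|x - u| <= gamma]%R <= (1 - q)%:E)%E.
Hypothesis tail : (mu [set x | (M < `|x|)%R] <= (q / 2)%:E)%E.
Variable s2 : R.
Hypothesis intX2 : mu.-integrable setT (fun x => (x ^+ 2)%:E).
Hypothesis s2E : \int[mu]_x (x ^+ 2) = s2.
Hypothesis int1 : mu.-integrable setT (fun x => x%:E).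
Hypothesis mean0 : \int[mu]_x x = 0.

Variables (n m N : nat) (r t : R).
Hypothesis t1 : 1 <= t.
Hypothesis mn : (m ^ 24 <= n)%N.
Hypothesis Nupp : N%:R <= 2 * (n%:R ^+ 2 * r ^+ 6).
Hypothesis N0 : (0 < N)%N.
Hypothesis rn : r ^+ 2 = ln n%:R.
Hypothesis r24 : 24 <= r.
Hypothesis s2r : s2 <= r.
Hypothesis big1 : 100 * r ^+ 10 <= m%:R.
Hypothesis big2 : 42 * t <= m%:R.
Hypothesis bigV : 4 * (M + M) <= m%:R.
Hypothesis big7 : 288 * (1 + (nondeg gamma q)^-1) * r ^+ 3 <= m%:R.

Let eps := 21 * t / (Num.sqrt n%:R * r ^+ 4).
Let nu := expR (- (3 * r ^+ 2)).
Let energy : set T := [set w | \sum_(j < n) (X j w) ^+ 2 <= r * n%:R].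

Let r1 : 1 <= r. Proof. by apply: le_trans r24; rewrite ler1n. Qed.
Let r0 : 0 < r. Proof. exact: lt_le_trans r1. Qed.

Let m1R : 100 <= m%:R :> R.
Proof.
apply: le_trans big1; have : 1 <= r ^+ 10 by rewrite exprn_ege1.
lra.
Qed.

Let m0R : 0 < m%:R :> R. Proof. by apply: lt_le_trans m1R; rewrite ltr0n. Qed.
Let m1 : 1 <= m%:R :> R. Proof. by apply: le_trans m1R; rewrite ler1n. Qed.

Let m24n k : (k <= 24)%N -> m%:R ^+ k <= n%:R :> R.
Proof.
move=> k24; apply: (@le_trans _ _ (m%:R ^+ 24)); first exact: ler_weXn2l.
by rewrite -natrX ler_nat.
Qed.

Let nR : 0 < n%:R :> R.
Proof. by apply: lt_le_trans (m24n (leq0n _)). Qed.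
Let n0 : (0 < n)%N. Proof. by rewrite -(ltr_nat R). Qed.

Let s0 : 0 < Num.sqrt n%:R :> R. Proof. by rewrite sqrtr_gt0. Qed.
Let ss : Num.sqrt n%:R * Num.sqrt n%:R = n%:R :> R.
Proof. by rewrite -expr2 sqr_sqrtr // ltW. Qed.

Let r7n : 100 * r ^+ 7 <= n%:R.
Proof.
apply: le_trans (m24n (k := 1) isT); rewrite expr1; apply: le_trans big1.
by rewrite ler_wpM2l ?ler0n // ler_weXn2l.
Qed.

Let Nnu : N%:R * nu <= 1 / (50 * r).
Proof.
have n3 : n%:R ^+ 3 != 0 :> R by rewrite expf_neq0 // gt_eqF.
have nuE' : nu = (n%:R ^+ 3)^-1.
  by apply: (mulIf n3); rewrite (expR_ln_cube n0 rn) mulVf.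
apply: (@le_trans _ _ (2 * (n%:R ^+ 2 * r ^+ 6) * nu)).
  by apply: ler_wpM2r => //; exact: expR_ge0.
have -> : 2 * (n%:R ^+ 2 * r ^+ 6) * nu = 2 * r ^+ 6 / n%:R.
  by rewrite nuE'; field; rewrite gt_eqF.
rewrite ler_pdivrMr // mulrAC ler_pdivlMr ?mulr_gt0 ?ltr0n // mul1r.
by apply: le_trans r7n; rewrite le_eqVlt; apply/predU1P; left; ring.
Qed.

(* For [j = 0] the truncated predecessor is harmless, as the factor [j] is [0]. *)
Definition re_deriv n (th : R) := lform X n (fun j => j%:R * cos (j.-1%:R * th)).
Definition im_deriv n (th : R) := lform X n (fun j => j%:R * sin (j.-1%:R * th)).

(** Union bound over the net: there are of the order of [n ^ 2 r ^ 6] points, and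
    [majorized_deviation] costs [2 n ^ -3] at each of them. *)
Lemma majorized_deriv :
  majorized P [set w | energy w /\ exists k : 'I_N,
     n%:R * Num.sqrt n%:R * r ^+ 2 <= `|re_deriv n (angle R N k) w| \/
     n%:R * Num.sqrt n%:R * r ^+ 2 <= `|im_deriv n (angle R N k) w|] (1 / r).
Proof.
have coef (f : R -> R) (k : 'I_N) : (forall x, `|f x| <= 1) -> forall j, (j < n)%N ->
    `|j%:R * f (j.-1%:R * angle R N k)| <= n%:R.
  move=> f1 j jn; rewrite normrM normr_nat -[leRHS]mulr1.
  by apply: ler_pM => //; rewrite ler_nat ltnW.
have h (k : 'I_N) := majorizedU
  (majorized_deviation iidX intX2 s2E int1 mean0 n0 nR (coef cos k (@cos_max R)) r24 s2r)
  (majorized_deviation iidX intX2 s2E int1 mean0 n0 nR (coef sin k (@sin_max R)) r24 s2r).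
apply: majorized_le (majorized_bigcup h).
  by move=> w [ew [k [hk|hk]]]; exists k; [left|right].
rewrite sumr_const card_ord -[X in X <= _]mulr_natl -/nu.
have -> : N%:R * (2 * nu + 2 * nu) = 4 * (N%:R * nu) by ring.
apply: le_trans (ler_wpM2l _ Nnu) _; first exact: ler0n.
rewrite mulrA ler_pdivrMr ?mulr_gt0 ?ltr0n //.
have -> : 1 / r * (50 * r) = 50 by field; rewrite gt_eqF.
lra.
Qed.

(** On an arc the coefficients [cos (j th)] differ from a fixed sign sequence by
    at most [A], so the difference of the real part and the signed sum is a linear
    form with tiny coefficients, controlled by [majorized_deviation] at all points
    of the arc. What remains is that one of the two signed sums is small. *)
Lemma majorized_arcs :
  majorized P [set w | energy w /\ exists k : 'I_N, arc n m N k /\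
    `|re_poly X n (angle R N k) w| <= eps] (3 / r).
Proof.
pose A : R := 8 / m%:R ^+ 2.
have A0 : 0 < A by rewrite divr_gt0 ?ltr0n // exprn_gt0.
have m2 : 0 < m%:R ^+ 2 :> R by rewrite exprn_gt0.
have NR : 0 < N%:R :> R by rewrite ltr0n.
pose close (b : bool) (k : 'I_N) := forall j, (j < n)%N ->
  `|cos (j%:R * angle R N k) - sign_seq b j| <= A.
have arc_close (k : 'I_N) : arc n m N k -> exists b, close b k.
  move=> [e eA res]; have [b hb] := arc_angle N0 res; exists b => j jn.
  rewrite hb -[X in _ - X]mulr1 -mulrBr normrM normr_sign_seq mul1r.
  set y := _ * (pi * _).
  rewrite distrC ger0_norm; last by rewrite subr_ge0 cos_le1.
  apply: le_trans (onesubcos_le y) _.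
  have y0 : 0 <= y by rewrite /y mulr_ge0 ?ler0n // mulr_ge0 ?pi_ge0 // divr_ge0 ?ler0n.
  have ym : y <= 4 / m%:R.
    have -> : y = pi * (j%:R * e%:R / N%:R) by rewrite /y; ring.
    apply: ler_pM; [exact: pi_ge0 | by rewrite divr_ge0 ?mulr_ge0 ?ler0n | exact: ltW (pi_lt4 R) | ].
    rewrite ler_pdivrMr // [X in _ <= X]mulrC ler_pdivlMr // -!natrM ler_nat.
    apply: leq_trans eA; rewrite (mulnC j) -mulnA leq_mul2l leq_mul2r (ltnW jn).
    by rewrite !orbT.
  have := ler_sqr_pos y0 ym.
  have -> : (4 / m%:R) ^+ 2 = 2 * A by rewrite /A expr_div_n; ring.
  lra.
pose dev (b : bool) (k : 'I_N) : set T := [set w | close b k /\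
  A * Num.sqrt n%:R * r ^+ 2 <=
  `|lform X n (fun j => cos (j%:R * angle R N k) - sign_seq b j) w| /\ energy w].
have hdev b k : majorized P (dev b k) (2 * nu).
  have nu0 : 0 <= nu by exact: expR_ge0.
  have [cl|ncl] := pselect (close b k); last first.
    apply: (@majorized_le _ _ _ _ _ set0 0); first by move=> w [].
      by rewrite mulr_ge0.
    exact: majorized0.
  apply: majorized_le
    (majorized_deviation iidX intX2 s2E int1 mean0 n0 A0 cl r24 s2r) => //.
  by move=> w [].
pose L := Num.truncn (m%:R ^+ 2 / (9 * r ^+ 2) : R).
have r2m : 100 * r ^+ 2 <= m%:R.
  by apply: le_trans big1; rewrite ler_wpM2l ?ler0n // ler_weXn2l.
have r2 : 0 < r ^+ 2 by exact: exprn_gt0.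
have [L0 /andP[]] : (0 < L)%N /\
    (m%:R ^+ 2 / (9 * r ^+ 2) / 2 <= L%:R <= m%:R ^+ 2 / (9 * r ^+ 2)).
  apply: truncn_half; rewrite ler_pdivlMr ?mulr_gt0 ?ltr0n // mul1r.
  have := m1; rewrite expr2; nra.
rewrite ler_pdivlMr ?mulr_gt0 ?ltr0n // => L1 L2.
have m3s : m%:R ^+ 3 <= Num.sqrt n%:R :> R.
  have p3 : 0 <= m%:R ^+ 3 :> R by exact: exprn_ge0 (ltW m0R).
  by rewrite -[leLHS](@ger0_norm R) // -sqrtr_sqr ler_wsqrtr // -exprM m24n.
have VL : (M + M) * L%:R <= Num.sqrt n%:R.
  apply: le_trans m3s; rewrite exprS; apply: ler_pM; rewrite ?ler0n //.
  - by have := M0; lra.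
  - by have := bigV; have := M0; lra.
  - have l0 : 0 <= L%:R :> R by exact: ler0n.
    have r21 : 1 <= r ^+ 2 by exact: exprn_ege1.
    nra.
have hsg b := majorized_sign_sum iidX M0 gamma0 q01 conc tail n0 L0 (sign_seq_sqr b) VL.
have hall := majorizedU (majorizedU (majorized_bigcup (hdev true))
  (majorized_bigcup (hdev false))) (majorizedU (hsg true) (hsg false)).
apply: majorized_le hall.
  move=> w [ew [k [/arc_close[b cl] hk]]].
  pose D := lform X n (fun j => cos (j%:R * angle R N k) - sign_seq b j) w.
  have [hD|hD] := leP (A * Num.sqrt n%:R * r ^+ 2) `|D|.
    by left; case: b cl @D hD => cl D hD; [left|right]; exists k.
  have DE : lform X n (sign_seq b) w = re_poly X n (angle R N k) w - D.
    rewrite /D /re_poly /lform -sumrB; apply: eq_bigr => j _; ring.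
  have epsA : eps <= Num.sqrt n%:R * r ^+ 2 / m%:R ^+ 2.
    have r40 : 0 < r ^+ 4 by exact: exprn_gt0.
    rewrite /eps ler_pdivrMr ?mulr_gt0 // mulrAC ler_pdivlMr //.
    have -> : Num.sqrt n%:R * r ^+ 2 * (Num.sqrt n%:R * r ^+ 4) = n%:R * r ^+ 6.
      by rewrite -[in RHS]ss; ring.
    apply: (@le_trans _ _ (m%:R ^+ 3)).
      rewrite exprS; apply: ler_wpM2r; first exact: ltW.
      by have := big2; have := t1; lra.
    apply: (le_trans (m24n (k := 3) isT)).
    by rewrite ler_peMr ?ler0n // exprn_ege1.
  have small : `|lform X n (sign_seq b) w| <= 9 * (Num.sqrt n%:R * r ^+ 2 / m%:R ^+ 2).
    rewrite DE (le_trans (ler_normB _ _)) //.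
    have : A * Num.sqrt n%:R * r ^+ 2 = 8 * (Num.sqrt n%:R * r ^+ 2 / m%:R ^+ 2).
      by rewrite /A; ring.
    by move: hD epsA hk; set z := Num.sqrt _ * _ / _; lra.
  have fin : `|lform X n (sign_seq b) w| * L%:R <= Num.sqrt n%:R.
    apply: (@le_trans _ _ (9 * (Num.sqrt n%:R * r ^+ 2 / m%:R ^+ 2) * L%:R)).
      by apply: ler_wpM2r => //; exact: ler0n.
    have -> : 9 * (Num.sqrt n%:R * r ^+ 2 / m%:R ^+ 2) * L%:R =
      Num.sqrt n%:R * (L%:R * (9 * r ^+ 2)) / m%:R ^+ 2 by ring.
    by rewrite ler_pdivrMr // ler_wpM2l // ltW.
  by right; case: b fin {cl D hD DE small} => fin; [left|right].
rewrite !sumr_const card_ord -[2 * nu *+ N]mulr_natl.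
have a1 : N%:R * (2 * nu) <= 1 / (25 * r).
  have -> : N%:R * (2 * nu) = 2 * (N%:R * nu) by ring.
  apply: le_trans (ler_wpM2l _ Nnu) _; first exact: ler0n.
  by rewrite le_eqVlt; apply/predU1P; left; field; rewrite gt_eqF.
have k0 := nondeg_gt0 gamma0 q01.
have a2 : 8 * (1 + (nondeg gamma q)^-1) / L%:R <= 1 / r.
  rewrite ler_pdivrMr ?ltr0n // mulrAC ler_pdivlMr // mul1r.
  have Llow : m%:R ^+ 2 <= L%:R * (18 * r ^+ 2) :> R.
    by move: L1; rewrite !ler_pdivrMr ?mulr_gt0 ?ltr0n //; lra.
  have : 288 * (1 + (nondeg gamma q)^-1) * r ^+ 3 <= L%:R * (18 * r ^+ 2).
    by apply: le_trans Llow; apply: (le_trans big7); rewrite -{1}[m%:R]expr1 ler_weXn2l.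
  have -> : 288 * (1 + (nondeg gamma q)^-1) * r ^+ 3 =
    (16 * (1 + (nondeg gamma q)^-1) * r) * (18 * r ^+ 2) by ring.
  rewrite ler_pM2r ?mulr_gt0 ?ltr0n //.
  have : 0 <= (1 + (nondeg gamma q)^-1) * r.
    by rewrite mulr_ge0 ?(ltW r0) // addr_ge0 // invr_ge0 ltW.
  lra.
have a3 : 1 / (25 * r) <= 1 / r / 25.
  by rewrite le_eqVlt; apply/predU1P; left; field; rewrite gt_eqF.
have a4 : 0 <= 1 / r by rewrite divr_ge0 // ltW.
have -> : 3 / r = 3 * (1 / r) by ring.
lra.
Qed.

Lemma majorized_energy : majorized P (~` energy) (s2 / r).
Proof.
have A0 : 0 < r * n%:R by exact: mulr_gt0.
have [K [bK K0 K1 Kc]] := markov_sqr iidX intX2 s2E n A0.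
exists K; split => //.
  by move=> w /negP; rewrite -ltNge; exact: K1.
apply: (le_trans Kc); rewrite le_eqVlt; apply/predU1P; left; field.
by rewrite !gt_eqF.
Qed.

End arcs.

(** * Polynomials near the unit circle *)

Section modulus.
Context (R : realType).
Implicit Types z w : R[i].

Lemma modulusE z : modulus z = Num.sqrt (complex.Re z ^+ 2 + complex.Im z ^+ 2).
Proof. by case: z. Qed.

Lemma modulus_ge0 z : 0 <= modulus z.
Proof. by rewrite modulusE sqrtr_ge0. Qed.

Lemma modulusM z w : modulus (z * w) = modulus z * modulus w.
Proof. exact: ComplexField.Normc.normcM. Qed.

Lemma modulusD z w : modulus (z + w) <= modulus z + modulus w.
Proof. exact: complex.le_normcD. Qed.

Lemma modulusN z : modulus (- z) = modulus z.
Proof. by rewrite -mulN1r modulusM modulusE /= oppr0 expr0n addr0 sqrrN expr1n sqrtr1 mul1r. Qed.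

Lemma modulusB z w : modulus (z - w) <= modulus z + modulus w.
Proof. by rewrite (le_trans (modulusD _ _)) // modulusN. Qed.

Lemma modulus_real (x : R) : modulus x%:C = `|x|.
Proof. by rewrite modulusE /= expr0n addr0 sqrtr_sqr. Qed.

Lemma modulus0 : modulus (0 : R[i]) = 0.
Proof. by rewrite (modulus_real 0) normr0. Qed.

Lemma modulusX z j : modulus (z ^+ j) = modulus z ^+ j.
Proof.
elim: j => [|j IH]; last by rewrite !exprS modulusM IH.
by rewrite !expr0 (modulus_real 1) normr1.
Qed.

Lemma modulus_sum n (f : 'I_n -> R[i]) :
  modulus (\sum_(j < n) f j) <= \sum_(j < n) modulus (f j).
Proof.
elim/big_rec2: _ => [|j a b _ h]; first by rewrite modulus0.
by rewrite (le_trans (modulusD _ _)) // lerD2l.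
Qed.

Lemma Re_le_modulus z : `|complex.Re z| <= modulus z.
Proof. by rewrite modulusE -sqrtr_sqr ler_wsqrtr // lerDl sqr_ge0. Qed.

Lemma Im_le_modulus z : `|complex.Im z| <= modulus z.
Proof. by rewrite modulusE -sqrtr_sqr ler_wsqrtr // lerDr sqr_ge0. Qed.

Lemma modulus_le z : modulus z <= `|complex.Re z| + `|complex.Im z|.
Proof.
have h0 : 0 <= `|complex.Re z| + `|complex.Im z| by rewrite addr_ge0.
rewrite modulusE -[leRHS](ger0_norm h0) -sqrtr_sqr ler_wsqrtr //.
rewrite -[complex.Re z ^+ 2]real_normK ?num_real // -[complex.Im z ^+ 2]real_normK ?num_real //.
have := mulr_ge0 (normr_ge0 (complex.Re z)) (normr_ge0 (complex.Im z)); nra.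
Qed.

Lemma Re_sum n (f : 'I_n -> R[i]) :
  complex.Re (\sum_(j < n) f j) = \sum_(j < n) complex.Re (f j).
Proof.
elim/big_rec2: _ => [//|j a b _ <-].
by case: (f j) b => u v [].
Qed.

Lemma Im_sum n (f : 'I_n -> R[i]) :
  complex.Im (\sum_(j < n) f j) = \sum_(j < n) complex.Im (f j).
Proof.
elim/big_rec2: _ => [//|j a b _ <-].
by case: (f j) b => u v [].
Qed.

Lemma Re_scale (x : R) z : complex.Re (x%:C * z) = x * complex.Re z.
Proof. by case: z => a b /=; rewrite mul0r subr0. Qed.

Lemma Im_scale (x : R) z : complex.Im (x%:C * z) = x * complex.Im z.
Proof. by case: z => a b /=; rewrite mul0r addr0. Qed.

Definition cis (a : R) : R[i] := cos a +i* sin a.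

Lemma modulus_cis a : modulus (cis a) = 1.
Proof. by rewrite modulusE /= cos2Dsin2 sqrtr1. Qed.

Lemma cisX a j : cis a ^+ j = cis (j%:R * a).
Proof.
elim: j => [|j IH]; first by rewrite expr0 mul0r /cis cos0 sin0.
rewrite exprS IH -natr1 mulrDl mul1r addrC /cis cosD sinD.
by apply/eqP; rewrite eq_complex /=; apply/andP; split; apply/eqP; ring.
Qed.

Lemma modulus_cisB a b : modulus (cis a - cis b) <= `|a - b|.
Proof.
rewrite modulusE /= -sqrtr_sqr ler_wsqrtr //.
have := onesubcos_le (a - b); rewrite cosB.
have := cos2Dsin2 a; have := cos2Dsin2 b; nra.
Qed.

Lemma polar z : z != 0 -> exists a : R, 0 <= a <= pi *+ 2 /\ z = (modulus z)%:C * cis a.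
Proof.
move=> z0; set m := modulus z.
have m2 : m ^+ 2 = complex.Re z ^+ 2 + complex.Im z ^+ 2.
  by rewrite /m modulusE sqr_sqrtr // addr_ge0 // sqr_ge0.
have m0 : 0 < m.
  rewrite lt0r modulus_ge0 andbT; apply: contra z0 => /eqP m0.
  by apply/eqP; apply: ComplexField.Normc.eq0_normc.
pose c := complex.Re z / m; pose s := complex.Im z / m.
have cs : c ^+ 2 + s ^+ 2 = 1.
  by rewrite /c /s !expr_div_n -mulrDl -m2 divff // expf_neq0 // gt_eqF.
have c1 : -1 <= c <= 1.
  by rewrite -ler_norml -(@ler_pXn2r _ 2) ?nnegrE // real_normK ?num_real // expr1n -cs lerDl sqr_ge0.
have zE a : cos a = c -> sin a = s -> z = m%:C * cis a.
  move=> ca sa; apply/eqP; rewrite eq_complex Re_scale Im_scale /= ca sa /c /s.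
  by rewrite !(mulrC m) !divfK ?eqxx // gt_eqF.
have sq : 1 - c ^+ 2 = s ^+ 2 by rewrite -cs; ring.
have a0 := acos_ge0 c1; have api := acos_lepi c1; have p0 := @pi_ge0 R.
have [s0|s0] := leP 0 s.
  exists (acos c); split; first by rewrite a0 mulr2n /=; lra.
  apply: zE; first by rewrite acosK // in_itv.
  by rewrite sin_acos // sq sqrtr_sqr ger0_norm.
exists (pi *+ 2 - acos c); split.
  by rewrite mulr2n; apply/andP; split; lra.
have shift x : pi *+ 2 - x = - x + pi *+ 2 by rewrite addrC.
apply: zE; rewrite shift.
  by rewrite cosD2pi cosN acosK // in_itv.
by rewrite sinD2pi sinN sin_acos // sq sqrtr_sqr ltr0_norm // opprK.
Qed.

Lemma modulus_subX z w (b : R) j : modulus w <= b -> modulus z <= b -> 1 <= b ->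
  modulus (z ^+ j - w ^+ j) <= j%:R * b ^+ j * modulus (z - w).
Proof.
move=> wb zb b1; have b0 : 0 <= b by exact: le_trans b1.
have d0 := modulus_ge0 (z - w).
elim: j => [|j IH]; first by rewrite !expr0 subrr modulus0 !mul0r.
have -> : z ^+ j.+1 - w ^+ j.+1 = z * (z ^+ j - w ^+ j) + w ^+ j * (z - w).
  by rewrite !exprS; ring.
have bj : 1 <= b ^+ j by exact: exprn_ege1.
rewrite (le_trans (modulusD _ _)) // !modulusM modulusX.
have h1 : modulus z * modulus (z ^+ j - w ^+ j) <= b * (j%:R * b ^+ j * modulus (z - w)).
  by apply: ler_pM => //; exact: modulus_ge0.
have h2 : modulus w ^+ j * modulus (z - w) <= b ^+ j.+1 * modulus (z - w).
  apply: ler_wpM2r => //; apply: (@le_trans _ _ (b ^+ j)).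
    by apply: lerXn2r => //; rewrite nnegrE // modulus_ge0.
  by rewrite exprS ler_peMl // (le_trans ler01).
apply: (le_trans (lerD h1 h2)).
by rewrite -[j.+1%:R]natr1 exprS le_eqVlt; apply/predU1P; left; ring.
Qed.

(** The remainder at [j + 1] is [z] times the remainder at [j], plus
    [j * w ^ (j - 1) * (z - w) ^ 2]. *)
Lemma modulus_taylorX z w (b : R) j : modulus w <= 1 -> modulus z <= b -> 1 <= b ->
  modulus (z ^+ j - w ^+ j - j%:R * w ^+ j.-1 * (z - w)) <=
  j%:R ^+ 2 * b ^+ j * modulus (z - w) ^+ 2.
Proof.
move=> w1 zb b1; have b0 : 0 <= b by exact: le_trans b1.
have d0 := modulus_ge0 (z - w).
elim: j => [|j IH].
  by rewrite !expr0 subrr mul0r mul0r subr0 modulus0 expr0n /= !mul0r.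
have -> : z ^+ j.+1 - w ^+ j.+1 - j.+1%:R * w ^+ j.+1.-1 * (z - w) =
    z * (z ^+ j - w ^+ j - j%:R * w ^+ j.-1 * (z - w)) +
    j%:R * w ^+ j.-1 * (z - w) ^+ 2.
  rewrite /= -[j.+1%:R]natr1; case: j {IH} => [|j]; first by rewrite !expr0 !expr1; ring.
  by rewrite /= !exprS; ring.
rewrite (le_trans (modulusD _ _)) // !modulusM !modulusX.
have nj : modulus (j%:R : R[i]) = j%:R.
  have -> : (j%:R : R[i]) = (j%:R : R)%:C by rewrite rmorph_nat.
  by rewrite modulus_real normr_nat.
rewrite nj.
have bj : 1 <= b ^+ j.+1 by exact: exprn_ege1.
have j0 : 0 <= j%:R :> R by exact: ler0n.
have h1 : modulus z * modulus (z ^+ j - w ^+ j - j%:R * w ^+ j.-1 * (z - w)) <=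
    b * (j%:R ^+ 2 * b ^+ j * modulus (z - w) ^+ 2).
  by apply: ler_pM => //; exact: modulus_ge0.
have h2 : j%:R * modulus w ^+ j.-1 * modulus (z - w) ^+ 2 <=
    j%:R * b ^+ j.+1 * modulus (z - w) ^+ 2.
  apply: ler_wpM2r; first exact: sqr_ge0.
  apply: ler_wpM2l => //; apply: le_trans bj.
  by apply: exprn_ile1 => //; exact: modulus_ge0.
apply: (le_trans (lerD h1 h2)).
have -> : b * (j%:R ^+ 2 * b ^+ j * modulus (z - w) ^+ 2) +
  j%:R * b ^+ j.+1 * modulus (z - w) ^+ 2 =
  (j%:R ^+ 2 + j%:R) * (b ^+ j.+1 * modulus (z - w) ^+ 2) by rewrite !(exprS b j); ring.
rewrite -[leRHS]mulrA; apply: ler_wpM2r.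
  by rewrite mulr_ge0 ?sqr_ge0 // (le_trans ler01).
by rewrite -[j.+1%:R]natr1; nra.
Qed.

Definition poly_at (x : nat -> R) n z : R[i] := \sum_(j < n) (x j)%:C * z ^+ j.

Lemma Re_poly_cis x n a : complex.Re (poly_at x n (cis a)) = \sum_(j < n) cos (j%:R * a) * x j.
Proof.
rewrite /poly_at Re_sum; apply: eq_bigr => j _.
by rewrite cisX Re_scale mulrC.
Qed.

Lemma Im_poly_cis x n a : complex.Im (poly_at x n (cis a)) = \sum_(j < n) sin (j%:R * a) * x j.
Proof.
rewrite /poly_at Im_sum; apply: eq_bigr => j _.
by rewrite cisX Im_scale mulrC.
Qed.

(** The expansion is centred at the net point [cis a] rather than at [z], since
    the derivative is controlled on the net only; the crude bound on the second
    order term suffices because [eta] is of order [n ^ -2]. *)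
Lemma poly_at_net (x : nat -> R) n z a (b tau D1 D2 S eta : R) :
  modulus z <= b -> 1 <= b -> b ^+ n <= 2 ->
  modulus (poly_at x n z) <= tau -> modulus (z - cis a) <= eta ->
  `|\sum_(j < n) j%:R * cos (j.-1%:R * a) * x j| <= D1 ->
  `|\sum_(j < n) j%:R * sin (j.-1%:R * a) * x j| <= D2 ->
  \sum_(j < n) `|x j| <= S ->
  modulus (poly_at x n (cis a)) <= tau + (D1 + D2) * eta + 2 * n%:R ^+ 2 * S * eta ^+ 2.
Proof.
move=> zb b1 bn hz he h1 h2 hS.
have wm := modulus_cis a; set w := cis a in he wm *.
have w1 : modulus w <= 1 by rewrite wm.
have e0 : 0 <= eta by exact: le_trans (modulus_ge0 _) he.
pose W' := \sum_(j < n) (x j)%:C * (j%:R * w ^+ j.-1).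
pose E := \sum_(j < n) (x j)%:C * (z ^+ j - w ^+ j - j%:R * w ^+ j.-1 * (z - w)).
have -> : poly_at x n w = poly_at x n z - (W' * (z - w) + E).
  rewrite /poly_at /W' /E mulr_suml -big_split /= -sumrB; apply: eq_bigr => j _; ring.
have hE : modulus E <= 2 * n%:R ^+ 2 * S * eta ^+ 2.
  apply: le_trans (modulus_sum _) _.
  apply: (@le_trans _ _ (\sum_(j < n) `|x j| * (2 * n%:R ^+ 2 * eta ^+ 2))).
    apply: ler_sum => j _; rewrite modulusM modulus_real ler_wpM2l //.
    apply: (le_trans (modulus_taylorX j w1 zb b1)).
    have jn : j%:R ^+ 2 <= n%:R ^+ 2 :> R by apply: ler_sqr_pos; rewrite ?ler0n // ler_nat ltnW.
    have bj : b ^+ j <= 2.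
      by apply: le_trans bn; apply: ler_weXn2l => //; exact: ltnW.
    have ee : modulus (z - w) ^+ 2 <= eta ^+ 2 by apply: ler_sqr_pos => //; exact: modulus_ge0.
    rewrite (mulrC 2); apply: ler_pM; rewrite ?sqr_ge0 //.
      by rewrite mulr_ge0 ?sqr_ge0 // exprn_ge0 // (le_trans ler01).
    by apply: ler_pM; rewrite ?sqr_ge0 // exprn_ge0 // (le_trans ler01).
  rewrite -mulr_suml.
  have -> : 2 * n%:R ^+ 2 * S * eta ^+ 2 = S * (2 * n%:R ^+ 2 * eta ^+ 2) by ring.
  by apply: ler_wpM2r => //; rewrite mulr_ge0 ?sqr_ge0 // mulr_ge0 ?sqr_ge0.
have ReW : complex.Re W' = \sum_(j < n) j%:R * cos (j.-1%:R * a) * x j.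
  rewrite /W' Re_sum; apply: eq_bigr => j _.
  have -> : (j%:R : R[i]) = (j%:R : R)%:C by rewrite rmorph_nat.
  by rewrite !Re_scale /w cisX mulrC.
have ImW : complex.Im W' = \sum_(j < n) j%:R * sin (j.-1%:R * a) * x j.
  rewrite /W' Im_sum; apply: eq_bigr => j _.
  have -> : (j%:R : R[i]) = (j%:R : R)%:C by rewrite rmorph_nat.
  by rewrite !Im_scale /w cisX mulrC.
have hW : modulus (W' * (z - w)) <= (D1 + D2) * eta.
  rewrite modulusM; apply: ler_pM => //; try exact: modulus_ge0.
  by apply: (le_trans (modulus_le _)); rewrite ReW ImW lerD.
rewrite (le_trans (modulusB _ _)) // -addrA lerD //.
by rewrite (le_trans (modulusD _ _)) // lerD.
Qed.

End modulus.

(** * The annulus and measurability of the minimum *)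

Section annulus.
Context (R : realType).

Lemma annulus_modulus (delta : R) z : annulus delta z ->
  1 - delta <= modulus z <= 1 + delta.
Proof. by rewrite /annulus /= ler_norml => /andP[? ?]; apply/andP; split; lra. Qed.

Lemma annulus_polar (delta : R) z : delta < 1 -> annulus delta z ->
  exists a : R, 0 <= a <= pi *+ 2 /\ z = (modulus z)%:C * cis a.
Proof.
move=> d1 /annulus_modulus/andP[h _]; apply: polar.
by apply: contraTneq h => ->; rewrite modulus0 -ltNge subr_gt0.
Qed.

Lemma polar_dist (s s' a a' : R) :
  modulus (s%:C * cis a - s'%:C * cis a') <= `|s - s'| + `|s'| * `|a - a'|.
Proof.
have -> : s%:C * cis a - s'%:C * cis a' =
    (s - s')%:C * cis a + s'%:C * (cis a - cis a').
  by rewrite rmorphB /=; ring.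
rewrite (le_trans (modulusD _ _)) // !modulusM !modulus_real modulus_cis mulr1.
by rewrite lerD2l ler_wpM2l // modulus_cisB.
Qed.

Lemma annulus_net (delta : R) N z : (0 < N)%N -> delta < 1 -> annulus delta z ->
  exists k : 'I_N, modulus (z - cis (angle R N k)) <= delta + 8 / N%:R.
Proof.
move=> N0 d1 az; have [a [/andP[a0 a2] zE]] := annulus_polar d1 az.
have NR : 0 < N%:R :> R by rewrite ltr0n.
have p0 := @pi_gt0 R; have p4 := pi_lt4 R.
pose st : R := pi *+ 2 / N%:R.
have st0 : 0 < st by rewrite divr_gt0 // mulr2n addr_gt0.
have st8 : st <= 8 / N%:R.
  by rewrite ler_wpM2r ?invr_ge0 ?ler0n // mulr2n; lra.
have stN : st * N%:R = pi *+ 2 by rewrite divfK // gt_eqF.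
have as0 : 0 <= a / st by rewrite divr_ge0 // ltW.
have /andP[t1 t2] := truncn_itv as0.
have {}t1 : (Num.truncn (a / st))%:R * st <= a by rewrite -ler_pdivlMr.
have {}t2 : a < (Num.truncn (a / st)).+1%:R * st by rewrite -ltr_pdivrMr.
have [k hk] : exists k : 'I_N, `|a - k%:R * st| <= st.
  have [kN|Nk] := ltnP (Num.truncn (a / st)) N.
    exists (Ordinal kN) => /=; rewrite ler_norml; move: t2; rewrite -natr1 mulrDl mul1r => t2.
    by apply/andP; split; lra.
  have N1 : (N.-1 < N)%N by rewrite prednK.
  exists (Ordinal N1) => /=.
  have e : N.-1%:R * st = pi *+ 2 - st.
    by rewrite -stN -{2}(prednK N0) -natr1; ring.
  have : N%:R * st <= (Num.truncn (a / st))%:R * st.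
    by rewrite ler_wpM2r ?(ltW st0) // ler_nat.
  rewrite mulrC stN e => h; rewrite ler_norml; apply/andP; split; lra.
exists k; rewrite zE.
have -> : cis (angle R N k) = 1%:C * cis (k%:R * st) by rewrite mul1r.
apply: (le_trans (polar_dist _ _ _ _)); rewrite normr1 mul1r lerD //.
exact: le_trans st8.
Qed.

(** For rational [u] and [v] with [|u| <= 1], a countable dense family. *)
Definition annulus_point (delta u v : R) : R[i] := (1 + delta * u)%:C * cis v.

Lemma rat_close (s e : R) : 0 < e -> exists u : rat, `|s - ratr u| < e.
Proof.
move=> e0; have [|u] := @rat_in_itvoo R (s - e) (s + e); first by lra.
rewrite in_itv /= => /andP[h1 h2]; exists u.
by rewrite ltr_norml; apply/andP; split; lra.
Qed.

Lemma rat_close_unit (s e : R) : 0 < e -> `|s| <= 1 ->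
  exists u : rat, `|ratr u : R| <= 1 /\ `|s - ratr u| < e.
Proof.
move=> e0; rewrite ler_norml => /andP[s1 s2].
pose e' := Num.min e 1.
have e'0 : 0 < e' by rewrite lt_min e0 ltr01.
have [e'e e'1] : e' <= e /\ e' <= 1 by rewrite /e' !ge_min !lexx orbT.
have [s0|s0] := leP s 0.
  have [|u] := @rat_in_itvoo R s (s + e'); first by lra.
  rewrite in_itv /= => /andP[h1 h2]; exists u.
  by rewrite ler_norml ltr_norml; split; apply/andP; split; lra.
have [|u] := @rat_in_itvoo R (s - e') s; first by lra.
rewrite in_itv /= => /andP[h1 h2]; exists u.
by rewrite ler_norml ltr_norml; split; apply/andP; split; lra.
Qed.

Lemma annulus_pointP (delta u v : R) : 0 < delta < 1 -> `|u| <= 1 ->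
  annulus delta (annulus_point delta u v).
Proof.
move=> /andP[d0 d1]; rewrite ler_norml => /andP[u1 u2].
rewrite /annulus /mkset /annulus_point modulusM modulus_real modulus_cis mulr1.
have du1 : - delta <= delta * u by nra.
have du2 : delta * u <= delta by nra.
rewrite [`|1 + _|]ger0_norm; last by lra.
by rewrite ler_norml; apply/andP; split; lra.
Qed.

(** Polar coordinates make membership in the annulus a condition on the first
    parameter alone, so that the dense points stay in the annulus. *)
Lemma annulus_dense (delta e : R) z : 0 < delta < 1 -> 0 < e -> annulus delta z ->
  exists u v : rat, `|ratr u : R| <= 1 /\
    modulus (z - annulus_point delta (ratr u) (ratr v)) <= 3 * e.
Proof.
move=> /andP[d0 d1] e0 az; have [a [_ zE]] := annulus_polar d1 az.
pose s := (modulus z - 1) / delta.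
have s1 : `|s| <= 1.
  by rewrite /s normrM normfV (gtr0_norm d0) ler_pdivrMr // mul1r.
have [u [u1 ue]] := rat_close_unit e0 s1.
have [v ve] := rat_close a e0.
exists u, v; split => //.
have mz : modulus z = 1 + delta * s by rewrite /s mulrC divfK ?gt_eqF //; ring.
rewrite {1}zE mz; apply: (le_trans (polar_dist _ _ _ _)).
have -> : 1 + delta * s - (1 + delta * ratr u) = delta * (s - ratr u) by ring.
rewrite normrM (gtr0_norm d0).
have h1 : delta * `|s - ratr u| <= e.
  by apply: le_trans (ltW ue); rewrite ler_piMl // ltW.
have b2 : `|1 + delta * ratr u| <= 2.
  apply: (le_trans (ler_normD _ _)); rewrite normr1 normrM (gtr0_norm d0).
  have := normr_ge0 (ratr u : R); nra.
have h2 : `|1 + delta * ratr u| * `|a - ratr v| <= 2 * e.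
  by apply: ler_pM => //; exact: ltW.
lra.
Qed.

Lemma poly_at_lipschitz (x : nat -> R) n z w (b : R) : 1 <= b ->
  modulus z <= b -> modulus w <= b ->
  modulus (poly_at x n z - poly_at x n w) <=
  (\sum_(j < n) `|x j| * (j%:R * b ^+ j)) * modulus (z - w).
Proof.
move=> b1 zb wb; rewrite /poly_at -sumrB mulr_suml.
apply: (le_trans (modulus_sum _)); apply: ler_sum => j _.
rewrite -mulrBr modulusM modulus_real -mulrA ler_wpM2l //.
exact: modulus_subX.
Qed.

Section infimum.
Variables (x : nat -> R) (n : nat) (delta : R).
Hypothesis d01 : 0 < delta < 1.

Let E := [set modulus (poly_at x n z) | z in annulus delta].

Let E0 : has_inf E.
Proof.
split.
  exists (modulus (poly_at x n (annulus_point delta 0 0))).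
  exists (annulus_point delta 0 0) => //.
  by apply: annulus_pointP => //; rewrite normr0.
by exists 0 => _ [z _ <-]; exact: modulus_ge0.
Qed.

Lemma min_modulus_lt (tau c : R) : min_modulus (poly_at x n) delta <= tau -> tau < c ->
  exists2 z, annulus delta z & modulus (poly_at x n z) < c.
Proof.
move=> h tc; have [|_ [z az <-] hz] := @inf_adherent R E (c - tau) _ E0.
  by rewrite subr_gt0.
exists z => //; apply: (lt_le_trans hz); move: h; rewrite /min_modulus -/E; lra.
Qed.

(** The countable description of the event on which its measurability rests. *)
Lemma min_modulus_rat (tau : R) :
  min_modulus (poly_at x n) delta <= tau <->
  forall k : nat, exists u v : rat, `|ratr u : R| <= 1 /\
    modulus (poly_at x n (annulus_point delta (ratr u) (ratr v))) < tau + k.+1%:R^-1.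
Proof.
split => [h k|h].
  have k0 : 0 < k.+1%:R^-1 :> R by rewrite invr_gt0 ltr0n.
  have [|z az hz] := min_modulus_lt h (c := tau + k.+1%:R^-1 / 2).
    by rewrite ltrDl divr_gt0.
  pose G := \sum_(j < n) `|x j| * (j%:R * 2 ^+ j).
  have G0 : 0 <= G.
    by apply: sumr_ge0 => j _; rewrite mulr_ge0 // mulr_ge0 ?ler0n // exprn_ge0.
  pose e := k.+1%:R^-1 / (6 * (G + 1)).
  have e0 : 0 < e by rewrite divr_gt0 // mulr_gt0 ?ltr0n //; lra.
  have [u [v [u1 uv]]] := annulus_dense d01 e0 az.
  exists u, v; split => //; have /andP[d0 d1] := d01.
  have zb : modulus z <= 2 by have /andP[] := annulus_modulus az; lra.
  have au := annulus_pointP (ratr v) d01 u1.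
  have wb : modulus (annulus_point delta (ratr u) (ratr v)) <= 2.
    by have /andP[] := annulus_modulus au; lra.
  set w := annulus_point _ _ _ in uv wb *.
  have l12 : 1 <= 2 :> R by lra.
  have := poly_at_lipschitz x n l12 wb zb; rewrite -/G => hL.
  have Ge : G * modulus (w - z) <= k.+1%:R^-1 / 2.
    rewrite -modulusN opprB; apply: (@le_trans _ _ ((G + 1) * (3 * e))).
      by apply: ler_pM; [exact: G0|exact: modulus_ge0|rewrite lerDl|exact: uv].
    rewrite le_eqVlt; apply/predU1P; left; rewrite /e; field.
    by rewrite gt_eqF //; lra.
  have -> : poly_at x n w = poly_at x n z + (poly_at x n w - poly_at x n z) by ring.
  apply: le_lt_trans (modulusD _ _) _.
  have h2 := le_trans hL Ge; move: hz h2; set kk := k.+1%:R^-1.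
  set y1 := modulus (poly_at x n z); set y2 := modulus (_ - _); lra.
apply/ler_addgt0Pr => e e0.
have [k ke] : exists k : nat, k.+1%:R^-1 < e.
  exists (Num.truncn e^-1); rewrite invf_plt ?posrE ?ltr0n //; exact: truncnS_gt.
have [u [v [u1 hv]]] := h k.
have au := annulus_pointP (ratr v) d01 u1.
have : inf E <= modulus (poly_at x n (annulus_point delta (ratr u) (ratr v))).
  by apply: ge_inf; [case: E0 | exists (annulus_point delta (ratr u) (ratr v))].
move=> hE; apply: (le_trans hE); apply: ltW; apply: (lt_trans hv).
by rewrite ltrD2l.
Qed.

End infimum.

Section measurability.
Context (d : measure_display) (T : measurableType d) (P : probability T R).
Context (X : nat -> {RV P >-> R}).

Lemma measurable_lt (f : T -> R) (c : R) : measurable_fun setT f ->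
  measurable [set w | f w < c].
Proof.
move=> mf; have -> : [set w | f w < c] = f @^-1` `]-oo, c[%classic.
  by apply/seteqP; split => w /=; rewrite in_itv.
by rewrite -[X in measurable X]setTI; apply: mf => //; exact: measurable_itv.
Qed.

Lemma measurable_modulus_lt n z (c : R) : 0 < c ->
  measurable [set w | modulus (poly_at (X ^~ w) n z) < c].
Proof.
move=> c0.
have -> : [set w | modulus (poly_at (X ^~ w) n z) < c] =
  [set w | lform X n (fun j => complex.Re (z ^+ j)) w ^+ 2 +
    lform X n (fun j => complex.Im (z ^+ j)) w ^+ 2 < c ^+ 2].
  have e w : modulus (poly_at (X ^~ w) n z) ^+ 2 =
    lform X n (fun j => complex.Re (z ^+ j)) w ^+ 2 +
    lform X n (fun j => complex.Im (z ^+ j)) w ^+ 2.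
    rewrite modulusE sqr_sqrtr ?addr_ge0 ?sqr_ge0 // /poly_at Re_sum Im_sum /lform.
    congr (_ ^+ 2 + _ ^+ 2); apply: eq_bigr => j _.
      by rewrite Re_scale mulrC.
    by rewrite Im_scale mulrC.
  apply/seteqP; split => w /=; rewrite -e ltr_pXn2r ?nnegrE ?modulus_ge0 //; exact: ltW.
apply: measurable_lt; apply: measurable_funD; apply: measurable_funX; exact: measurable_lform.
Qed.

Lemma measurable_min_modulus n (delta tau : R) : 0 < delta < 1 -> 0 <= tau ->
  measurable [set w | min_modulus (random_poly X n w) delta <= tau].
Proof.
move=> d01 t0.
have -> : [set w | min_modulus (random_poly X n w) delta <= tau] =
  \bigcap_k \bigcup_(u : rat) \bigcup_(v : rat)
    (if `|ratr u : R| <= 1 then [set w | modulus (poly_at (X ^~ w) n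
        (annulus_point delta (ratr u) (ratr v))) < tau + k.+1%:R^-1] else set0).
  apply/seteqP; split => w /=.
    move/(min_modulus_rat (X ^~ w) n d01) => h k _.
    have [u [v [u1 hv]]] := h k; exists u => //; exists v => //.
    by rewrite u1.
  move=> h; apply/(min_modulus_rat (X ^~ w) n d01) => k.
  have [u _ [v _]] := h k I; case: ifP => // u1 hv.
  by exists u, v.
apply: bigcapT_measurable => k; apply: bigcupT_measurable_rat => u.
apply: bigcupT_measurable_rat => v; case: ifP => // _.
by apply: measurable_modulus_lt; rewrite ltr_wpDl // invr_gt0 ltr0n.
Qed.

End measurability.

End annulus.

(** * Reduction to the net and choice of the parameters *)

Section cover.
Context (R : realType).

Lemma expX_le2 (x : R) n : 0 <= x -> n%:R * x <= 1 / 2 -> (1 + x) ^+ n <= 2.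
Proof.
move=> x0 h; apply: (@le_trans _ _ (expR x ^+ n)).
  by apply: lerXn2r; rewrite ?nnegrE ?expR_ge0 ?expR_ge1Dx // addr_ge0.
rewrite -expRM_natl; apply: (@le_trans _ _ (expR (1 / 2))); first by rewrite ler_expR.
have := expR_ge1Dx (- (1 / 2) : R).
rewrite expRN => h2.
have e0 := expR_gt0 (1 / 2 : R).
have := ler_wpM2l (ltW e0) h2.
rewrite divff ?gt_eqF //; lra.
Qed.

Context (d : measure_display) (T : measurableType d) (P : probability T R).
Context (X : nat -> {RV P >-> R}).

(** Let [tau] be the bound on the minimum. Since the infimum need not be attained
    exactly, a point with value below [2 tau] is used; the net is within
    [eta = 9 delta] of it, [delta] for the modulus and [8 / N] for the angle. The
    derivative then contributes [18 tau] and the second order term at most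
    [tau]. *)
Lemma small_min_near_net (n m N : nat) (r t : R) (w : T) :
  1 <= t -> 42 * t <= m%:R -> (m ^ 24 <= n)%N -> 24 <= r -> (0 < N)%N ->
  n%:R ^+ 2 * r ^+ 6 <= N%:R ->
  min_modulus (random_poly X n w) (t / (n%:R ^+ 2 * r ^+ 6)) <=
    t / (Num.sqrt n%:R * r ^+ 4) ->
  \sum_(j < n) (X j w) ^+ 2 <= r * n%:R ->
  (forall k : 'I_N,
     `|re_deriv X n (angle R N k) w| <= n%:R * Num.sqrt n%:R * r ^+ 2 /\
     `|im_deriv X n (angle R N k) w| <= n%:R * Num.sqrt n%:R * r ^+ 2) ->
  exists k : 'I_N, in_ball X n (angle R N k) (21 * t / (Num.sqrt n%:R * r ^+ 4)) w.
Proof.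
move=> t1 tm mn r24 N0 Nlow hmin henergy hder.
have r1 : 1 <= r by lra.
have r0 : 0 < r by lra.
have t0 : 0 < t by lra.
have mk k : (k <= 24)%N -> m%:R ^+ k <= n%:R :> R.
  move=> k24; apply: (@le_trans _ _ (m%:R ^+ 24)).
    by apply: ler_weXn2l => //; lra.
  by rewrite -natrX ler_nat.
have m_n : m%:R <= n%:R :> R by have := mk 1%N isT; rewrite expr1.
have nR : 0 < n%:R :> R by lra.
set s := Num.sqrt n%:R in hmin hder *.
have s0 : 0 < s by rewrite sqrtr_gt0.
have ss : s * s = n%:R by rewrite -expr2 sqr_sqrtr // ltW.
have ms : m%:R <= s.
  by rewrite -[leLHS](@ger0_norm R) ?ler0n // -sqrtr_sqr ler_wsqrtr // mk.
have r6 : 1 <= r ^+ 6 by exact: exprn_ege1.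
have r60 : 0 < r ^+ 6 by lra.
have r40 : 0 < r ^+ 4 by exact: exprn_gt0.
have n20 : 0 < n%:R ^+ 2 :> R by exact: exprn_gt0.
set dl := t / _ in hmin; set tau := t / _ in hmin.
have nr : 0 < n%:R ^+ 2 * r ^+ 6 by exact: mulr_gt0.
have dl0 : 0 < dl by exact: divr_gt0.
have tau0 : 0 < tau by rewrite divr_gt0 // mulr_gt0.
have ndl : n%:R * dl <= 1 / 2.
  have -> : n%:R * dl = t / (n%:R * r ^+ 6) by rewrite /dl; field; rewrite !gt_eqF.
  rewrite ler_pdivrMr ?mulr_gt0 //.
  have : n%:R <= n%:R * r ^+ 6 by rewrite ler_peMr // ltW.
  lra.
have n1 : 1 <= n%:R :> R by lra.
have dl1 : dl < 1.
  have : dl <= n%:R * dl by rewrite ler_peMl // ltW.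
  lra.
have d01 : 0 < dl < 1 by rewrite dl0 dl1.
have [|z az hz] := @min_modulus_lt R (X ^~ w) n dl d01 tau (2 * tau) hmin.
  by lra.
have [k hk] := annulus_net N0 dl1 az; exists k.
pose eta := 9 * t / (n%:R ^+ 2 * r ^+ 6).
have heta : modulus (z - cis (angle R N k)) <= eta.
  apply: (le_trans hk).
  have : 8 / N%:R <= 8 / (n%:R ^+ 2 * r ^+ 6).
    by rewrite ler_wpM2l // lef_pV2 ?posrE ?ltr0n.
  have : 8 / (n%:R ^+ 2 * r ^+ 6) <= 8 * dl.
    rewrite /dl mulrA; apply: ler_wpM2r; first by rewrite invr_ge0 ltW.
    lra.
  have -> : eta = 9 * dl by rewrite /eta /dl; ring.
  lra.
have /andP[_ zb] := annulus_modulus az.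
have b1 : 1 <= 1 + dl by lra.
have bn := expX_le2 (ltW dl0) ndl.
have [h1 h2] := hder k.
have hS : \sum_(j < n) `|X j w| <= 2 * (r * n%:R).
  apply: (@le_trans _ _ (\sum_(j < n) (1 + (X j w) ^+ 2))).
    apply: ler_sum => j _; rewrite -[_ ^+ 2]real_normK ?num_real //.
    have := sqr_ge0 (`|X j w| - 1); have := normr_ge0 (X j w); nra.
  rewrite big_split /= sumr_const card_ord.
  have : n%:R <= r * n%:R by rewrite ler_peMl // ltW.
  lra.
have := @poly_at_net R (X ^~ w) n z (angle R N k) (1 + dl) (2 * tau) _ _ _ eta
  zb b1 bn (ltW hz) heta h1 h2 hS.
set W := modulus (poly_at _ _ _) => hW.
have {}hW : W <= 21 * t / (s * r ^+ 4).
  apply: (le_trans hW).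
  have e1 : (n%:R * s * r ^+ 2 + n%:R * s * r ^+ 2) * eta = 18 * tau.
    by rewrite /eta /tau -ss; field; rewrite !gt_eqF.
  have e2 : 2 * n%:R ^+ 2 * (2 * (r * n%:R)) * eta ^+ 2 <= tau.
    have -> : 2 * n%:R ^+ 2 * (2 * (r * n%:R)) * eta ^+ 2 =
      tau * (324 * t / (s * r ^+ 7)).
      by rewrite /eta /tau -ss; field; rewrite !gt_eqF.
    apply: ler_piMr; first exact: ltW.
    have r70 : 0 < s * r ^+ 7 by apply: mulr_gt0 => //; exact: exprn_gt0.
    rewrite ler_pdivrMr; last exact: r70.
    rewrite mul1r.
    have r7 : 24 <= r ^+ 7.
      by apply: (le_trans r24); rewrite -{1}[r]expr1 ler_weXn2l.
    have : s * 24 <= s * r ^+ 7 by rewrite ler_wpM2l // ltW.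
    lra.
  rewrite e1; have -> : 21 * t / (s * r ^+ 4) = 21 * tau by rewrite /tau; ring.
  lra.
split.
  have -> : re_poly X n (angle R N k) w =
      complex.Re (poly_at (X ^~ w) n (cis (angle R N k))) by rewrite Re_poly_cis.
  by apply: le_trans hW; exact: Re_le_modulus.
have -> : im_poly X n (angle R N k) w =
    complex.Im (poly_at (X ^~ w) n (cis (angle R N k))) by rewrite Im_poly_cis.
by apply: le_trans hW; exact: Im_le_modulus.
Qed.

End cover.

Section asymptotics.
Context (R : realType).

Lemma nat_root k n : (0 < k)%N -> exists m, (m ^ k <= n < m.+1 ^ k)%N.
Proof.
move=> k0.
have ex : exists m, (m ^ k <= n)%N by exists 0%N; rewrite exp0n.
have bd m : (m ^ k <= n)%N -> (m <= n)%N.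
  case: m => // m; apply: leq_trans.
  by rewrite -{1}[m.+1]expn1 leq_pexp2l.
case: (ex_maxnP ex bd) => m mn mmax; exists m; rewrite mn /= ltnNge.
by apply/negP => /mmax; rewrite ltnn.
Qed.

Lemma pow6_le_expR (y : R) : 0 <= y -> (y / 6) ^+ 6 <= expR y.
Proof.
move=> y0; have -> : expR y = expR (y / 6) ^+ 6.
  by rewrite -expRM_natl; congr expR; field.
apply: lerXn2r; rewrite ?nnegrE ?expR_ge0 ?divr_ge0 //.
by have := expR_ge1Dx (y / 6); lra.
Qed.

(** With [y = ln (m + 1)], the left-hand side is [K (ln n)^5 <= K (24 y)^5],
    while [m + 1 >= (y / 6)^6]. *)
Lemma logs_small (K : R) : 0 <= K -> exists n0 : nat, forall n m : nat, (n0 <= n)%N ->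
  (n < m.+1 ^ 24)%N -> K * Num.sqrt (ln n%:R) ^+ 10 <= m%:R.
Proof.
move=> K0; pose c : R := 24 ^+ 5; have c0 : 0 <= c by rewrite exprn_ge0.
pose c6 : R := 6 ^+ 6; have c60 : 1 <= c6 by rewrite exprn_ege1 // ler1n.
pose Y := c6 * (K * c + 1).
have Kc : 0 <= K * c by exact: mulr_ge0.
have Y1 : 1 <= Y by rewrite /Y; nra.
exists (Num.truncn (expR (24 * Y))).+1 => n m n0n nm.
have nE : expR (24 * Y) <= n%:R.
  apply: (le_trans (ltW (truncnS_gt _))); by rewrite ler_nat.
have nR : 0 < n%:R :> R by apply: lt_le_trans nE; exact: expR_gt0.
have lnn : 24 * Y <= ln n%:R by rewrite -[leLHS]expRK ler_ln ?posrE ?expR_gt0.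
set y := ln m.+1%:R : R.
have ny : ln n%:R <= 24 * y.
  have -> : 24 * y = ln (m.+1%:R ^+ 24) by rewrite lnXn ?ltr0n // mulr_natl.
  have h : n%:R <= m.+1%:R ^+ 24 :> R by rewrite -natrX ler_nat ltnW.
  by rewrite ler_ln // posrE // exprn_gt0 // ltr0n.
have yY : Y <= y by lra.
have y1 : 1 <= y by lra.
have y0 : 0 <= y by lra.
have l0 : 0 <= ln n%:R :> R by lra.
have -> : Num.sqrt (ln n%:R) ^+ 10 = ln n%:R ^+ 5 :> R.
  by rewrite (exprM _ 2 5) sqr_sqrtr.
have l5 : ln n%:R ^+ 5 <= c * y ^+ 5.
  by rewrite /c -exprMn; apply: lerXn2r; rewrite ?nnegrE // mulr_ge0 ?ler0n.
have y5 : 1 <= y ^+ 5 by exact: exprn_ege1.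
have := pow6_le_expR y0; rewrite {2}/y lnK ?posrE ?ltr0n // expr_div_n -/c6 -natr1 => h6.
have h : (K * c + 1) * y ^+ 5 <= y ^+ 6 / c6.
  rewrite ler_pdivlMr; last by lra.
  rewrite exprS mulrAC; apply: ler_wpM2r; first by lra.
  by rewrite mulrC.
have : K * ln n%:R ^+ 5 <= K * (c * y ^+ 5) by rewrite ler_wpM2l.
rewrite mulrA; lra.
Qed.

Lemma sqrt_ln_large (K : R) : exists n0 : nat, forall n, (n0 <= n)%N ->
  K <= Num.sqrt (ln n%:R).
Proof.
exists (Num.truncn (expR (K ^+ 2))).+1 => n n0n.
have nE : expR (K ^+ 2) <= n%:R.
  by apply: (le_trans (ltW (truncnS_gt _))); rewrite ler_nat.
have nR : 0 < n%:R :> R by apply: lt_le_trans nE; exact: expR_gt0.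
have : K ^+ 2 <= ln n%:R by rewrite -[leLHS]expRK ler_ln ?posrE ?expR_gt0.
move=> h; apply: (le_trans (ler_norm K)); rewrite -sqrtr_sqr; exact: ler_wsqrtr.
Qed.

End asymptotics.

Section fixed_law.
Context (R : realType) (mu : probability R R).
Variables (M gamma q t s2 : R).
Hypothesis t1 : 1 <= t.
Hypothesis M0 : 0 < M.
Hypothesis gamma0 : 0 < gamma.
Hypothesis q01 : 0 < q < 1.
Hypothesis conc : forall u, (mu [set x | `|x - u| <= gamma]%R <= (1 - q)%:E)%E.
Hypothesis tail : (mu [set x | (M < `|x|)%R] <= (q / 2)%:E)%E.
Hypothesis intX2 : mu.-integrable setT (fun x => (x ^+ 2)%:E).
Hypothesis s2E : \int[mu]_x (x ^+ 2) = s2.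
Hypothesis int1 : mu.-integrable setT (fun x => x%:E).
Hypothesis mean0 : \int[mu]_x x = 0.

(** The four exceptional events are summed: large energy, large derivative at a
    net point, small value on an arc, small value at another net point. *)
Lemma min_modulus_bound : exists (C : R) (n0 : nat),
  forall (d : measure_display) (T : measurableType d) (P : probability T R)
    (X : nat -> {RV P >-> R}), iid_with_law X mu ->
  forall n : nat, (n0 <= n)%N ->
  (P [set w | (min_modulus (random_poly X n w)
       (t / (n%:R ^+ 2 * Num.sqrt (ln n%:R) ^+ 6))
     <= t / (Num.sqrt n%:R * Num.sqrt (ln n%:R) ^+ 4))%R]
   <= (C / Num.sqrt (ln n%:R))%:E)%E.
Proof.
pose V := M + M; have V0 : 0 < V by exact: addr_gt0.
pose kap := nondeg gamma q; have kap0 : 0 < kap by exact: nondeg_gt0.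
pose pm := pair_mass q; have pm0 : 0 < pm by exact: pair_mass_gt0.
pose g := 1 + 64 / kap.
have t0 : 0 < t by exact: lt_le_trans t1.
pose B0 : R := 2 ^+ 24.
pose k3 := 2 * V ^+ 2 * B0 * 64 ^+ 13.
pose k4 := 3 * (4 ^+ 13 * 4 * 64 * 128) / pm.
pose k5 := 4096 * g ^+ 2 * V ^+ 2 * B0.
pose k6 := 64 * 16 * 84 ^+ 2 * g ^+ 2 * t ^+ 2.
pose k7 := 288 * (1 + kap^-1).
(* [K] dominates every coefficient that [m] has to beat when multiplied by a
   power of [r], of exponent at most 10. *)
pose ks := [:: 100; 42 * t; 4 * V; 42 * t / V; k3; k4; k5; k6; k7].
pose K := \sum_(k <- ks) `|k|.
have K0 : 0 <= K by apply: sumr_ge0.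
have Kge k : k \in ks -> k <= K.
  move=> kks; apply: (le_trans (ler_norm k)).
  by rewrite /K (big_rem k) //= lerDl sumr_ge0.
have [n1 hn1] := logs_small K0.
have [n2 hn2] := @sqrt_ln_large R (24 + `|s2|).
exists (8 + s2 + 32 * (84 ^+ 2 * g ^+ 2 * t ^+ 2)), (maxn n1 n2).
move=> d T P X iidX n; rewrite geq_max => /andP[nn1 nn2].
have [m /andP[mn nm]] := nat_root n (isT : (0 < 24)%N).
set r := Num.sqrt (ln n%:R).
have rK : K * r ^+ 10 <= m%:R by exact: hn1.
have rs : 24 + `|s2| <= r by exact: hn2.
have r24 : 24 <= r by have := normr_ge0 s2; lra.
have s2r : s2 <= r by have := ler_norm s2; lra.
have r1 : 1 <= r by apply: le_trans r24; rewrite ler1n.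
have r0 : 0 < r := lt_le_trans ltr01 r1.
have cr k j : (j <= 10)%N -> k \in ks -> k * r ^+ j <= m%:R.
  move=> j10 kk; apply: le_trans rK; have rj0 : 0 <= r ^+ j by exact: exprn_ge0 (ltW r0).
  apply: (@le_trans _ _ (K * r ^+ j)); first by rewrite ler_wpM2r // Kge.
  by rewrite ler_wpM2l // ler_weXn2l.
have inks i : (i < 9)%N -> nth 0 ks i \in ks by move=> h; exact: mem_nth.
have big1 : 100 * r ^+ 10 <= m%:R by apply: cr (inks 0%N isT).
have big2 : 42 * t <= m%:R by have := cr _ 0%N isT (inks 1%N isT); rewrite mulr1.
have bigV : 4 * V <= m%:R by have := cr _ 0%N isT (inks 2%N isT); rewrite mulr1.
have bigV' : 42 * t <= V * m%:R.
  have := cr _ 0%N isT (inks 3%N isT); rewrite mulr1 /= => h.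
  by rewrite [X in _ <= X]mulrC -ler_pdivrMr.
have big3 : 2 * V ^+ 2 * B0 * 64 ^+ 13 * r ^+ 8 <= m%:R.
  exact: (cr _ 8%N isT (inks 4%N isT)).
have big4 : 3 * r ^+ 2 * (4 ^+ 13 * 4 * 64 * 128) <= pm * m%:R.
  have := cr _ 2%N isT (inks 5%N isT); rewrite /= /k4; set c := _ * 128 => h.
  have -> : 3 * r ^+ 2 * c = pm * (3 * c / pm * r ^+ 2) by field; rewrite gt_eqF.
  by rewrite ler_wpM2l // ltW.
have big5 : 4096 * g ^+ 2 * V ^+ 2 * B0 * r ^+ 7 <= m%:R.
  exact: (cr _ 7%N isT (inks 6%N isT)).
have big6 : 64 * 16 * 84 ^+ 2 * g ^+ 2 * t ^+ 2 <= m%:R.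
  by have := cr _ 0%N isT (inks 7%N isT); rewrite mulr1.
have big7 : 288 * (1 + kap^-1) * r ^+ 3 <= m%:R.
  exact: (cr _ 3%N isT (inks 8%N isT)).
have m1 : 1 <= m%:R :> R.
  have r10 : 1 <= r ^+ 10 by exact: exprn_ege1.
  apply: (le_trans r10); apply: le_trans big1.
  by rewrite ler_peMl ?(le_trans ler01 r10) // ler1n.
have nR : n%:R <= B0 * m%:R ^+ 24 :> R.
  rewrite /B0 -exprMn; apply: (@le_trans _ _ (m.+1%:R ^+ 24)).
    by rewrite -natrX ler_nat ltnW.
  have m2 : m.+1%:R <= 2 * m%:R :> R by rewrite -natr1 mulr_natl mulr2n lerD2l.
  by apply: lerXn2r => //; rewrite nnegrE ?ler0n // mulr_ge0 ?ler0n.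
have mN : m%:R ^+ 24 <= n%:R :> R by rewrite -natrX ler_nat.
have n1' : 1 <= n%:R :> R by apply: le_trans mN; exact: exprn_ege1.
have rn : r ^+ 2 = ln n%:R by rewrite /r sqr_sqrtr // ln_ge0.
pose x := n%:R ^+ 2 * r ^+ 6.
have x1 : 1 <= x.
  by apply: mulr_ege1; exact: exprn_ege1.
pose N := (Num.truncn x).+1.
have N0 : (0 < N)%N by [].
have Nlow : n%:R ^+ 2 * r ^+ 6 <= N%:R by apply: ltW; exact: truncnS_gt.
have Nupp : N%:R <= 2 * (n%:R ^+ 2 * r ^+ 6).
  rewrite /N -natr1 -/x; have /andP[h _] := truncn_itv (le_trans ler01 x1).
  by rewrite mulr_natl mulr2n lerD.
pose eps := 21 * t / (Num.sqrt n%:R * r ^+ 4).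
have hnet := majorized_net_total iidX gamma0 q01 conc tail t1 mn nR Nlow Nupp
  rn r24 big1 big2 bigV bigV' big3 big4 V0 big5 big6.
have harc := majorized_arcs iidX M0 gamma0 q01 conc tail intX2 s2E int1 mean0 t1 mn
  Nupp N0 rn r24 s2r big1 big2 bigV big7.
have hder := majorized_deriv iidX intX2 s2E int1 mean0 mn Nupp rn r24 s2r big1.
have hen := majorized_energy iidX intX2 s2E mn r24 big1.
apply: majorized_prob.
  apply: measurable_min_modulus.
    have x0 : 0 < x := lt_le_trans ltr01 x1.
    apply/andP; split; first exact: divr_gt0.
    rewrite ltr_pdivrMr // mul1r.
    apply: (@lt_le_trans _ _ m%:R).
      apply: lt_le_trans big2; apply: (@lt_le_trans _ _ (2 * t)).
        by rewrite ltr_pMl // ltr1n.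
      by rewrite ler_pM2r // ler_nat.
    apply: (@le_trans _ _ n%:R).
      by apply: le_trans mN; rewrite -{1}[m%:R]expr1 ler_weXn2l.
    rewrite /x expr2 -mulrA ler_peMr ?ler0n //.
    by apply: mulr_ege1 => //; exact: exprn_ege1.
  by rewrite divr_ge0 ?(ltW t0) // mulr_ge0 ?sqrtr_ge0 // exprn_ge0 // ltW.
have hall := majorizedU (majorizedU hen hder) (majorizedU harc hnet).
apply: majorized_le hall.
  move=> w /= hw.
  have [ew|new] := pselect (\sum_(j < n) (X j w) ^+ 2 <= r * n%:R); last first.
    by left; left.
  set D := n%:R * Num.sqrt n%:R * r ^+ 2.
  have [dw|ndw] := pselect (exists k : 'I_N, D <= `|re_deriv X n (angle R N k) w| \/
     D <= `|im_deriv X n (angle R N k) w|).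
    by left; right.
  have hd (k : 'I_N) : `|re_deriv X n (angle R N k) w| <= D /\
      `|im_deriv X n (angle R N k) w| <= D.
    split; rewrite leNgt; apply/negP => /ltW h; apply: ndw; exists k; by [left|right].
  have [k [hre him]] := small_min_near_net t1 big2 mn r24 N0 Nlow hw ew hd.
  have [ak|nak] := pselect (arc n m N k).
    by right; left; split => //; exists k.
  by right; right; exists k.
rewrite le_eqVlt; apply/predU1P; left.
rewrite -/kap -/g; field; rewrite gt_eqF //.
Qed.

End fixed_law.

(** * The theorem *)

Section law_conditions.
Context (R : realType) (mu : probability R R).
Context (d : measure_display) (T : measurableType d) (P : probability T R).
Context (X : {RV P >-> R}).
Hypothesis lawX : has_law X mu.

Lemma law_conc (M gamma q : R) : concentration_condition X M gamma q ->
  (forall u, (mu [set x | `|x - u| <= gamma]%R <= (1 - q)%:E)%E) /\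
  (mu [set x | (M < `|x|)%R] <= (q / 2)%:E)%E.
Proof.
move=> [conc tail]; split => [u|].
  have mB : measurable [set x : R | `|x - u| <= gamma].
    have -> : [set x : R | `|x - u| <= gamma] = ~` [set x | - `|x - u| < - gamma].
      apply/seteqP; split => x /=; rewrite ltrN2 leNgt; first by move/negP.
      by move=> h; apply/negP.
    apply: measurableC; apply: measurable_lt; apply: measurable_funN.
    by apply: (measurableT_comp (@normr_measurable R setT)); apply: measurable_funB.
  rewrite -lawX //; apply: le_trans conc; apply: ereal_sup_ubound.
  by exists u.
have mB : measurable [set x : R | M < `|x|].
  have -> : [set x : R | M < `|x|] = [set x | - `|x| < - M].
    by apply/seteqP; split => x /=; rewrite ltrN2.
  by apply: measurable_lt; apply: measurable_funN; exact: normr_measurable.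
by rewrite -lawX.
Qed.

Lemma law_moments : ('E_P[X] = 0)%E -> ('E_P[(fun w => (X w ^+ 2)%R)] < +oo)%E ->
  [/\ mu.-integrable setT (fun x => (x ^+ 2)%:E),
    mu.-integrable setT (fun x => x%:E) & \int[mu]_x x = 0].
Proof.
rewrite unlock => E0 E2.
have mX : measurable_fun setT X by exact: measurable_funPT.
have msq : measurable_fun setT (fun x : R => (x ^+ 2)%:E).
  by apply/measurable_EFinP; exact: exprn_measurable.
have mid : measurable_fun setT (fun x : R => x%:E).
  by apply/measurable_EFinP; exact: measurable_id.
have transfer (f : R -> \bar R) :
    (\int[distribution P X]_x f x = \int[mu]_x f x)%E.
  by apply: eq_measure_integral => A mA _; exact: lawX.
have sqP : P.-integrable setT (fun w => (X w ^+ 2)%:E).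
  apply/integrableP; split.
    by apply/measurable_EFinP; exact: measurable_funX.
  rewrite (eq_integral (fun w => (X w ^+ 2)%:E)) //.
  by move=> w _; rewrite gee0_abs // lee_fin sqr_ge0.
have dom (y : R) : `|y| <= 1 + y ^+ 2.
  rewrite -[y ^+ 2]real_normK ?num_real //.
  have := sqr_ge0 (`|y| - 1); have := normr_ge0 y; nra.
have idP : P.-integrable setT (fun w => (X w)%:E).
  have i1 := integrableD measurableT (bm_integrable P (bm_cst T 1)) sqP.
  apply: le_integrable i1 => //; first exact/measurable_EFinP.
  move=> w _ /=; rewrite lee_fin; apply: le_trans (dom _) _.
  by rewrite ler_norm.
have sqmu : mu.-integrable setT (fun x => (x ^+ 2)%:E).
  apply/integrableP; split; first exact: msq.
  rewrite (eq_integral (fun x : R => (x ^+ 2)%:E)); last first.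
    by move=> x _; rewrite gee0_abs // lee_fin sqr_ge0.
  have ge0 (y : R) : (0 <= (y ^+ 2)%:E)%E by rewrite lee_fin sqr_ge0.
  rewrite -transfer (ge0_integral_distribution X msq ge0).
  exact: E2.
split => //.
  have i1 := integrableD measurableT (bm_integrable mu (bm_cst _ 1)) sqmu.
  apply: le_integrable i1 => //.
  move=> x _ /=; rewrite lee_fin; apply: le_trans (dom _) _.
  by rewrite ler_norm.
by rewrite /Rintegral -transfer integral_distribution //= E0.
Qed.

End law_conditions.

Theorem theorem1p1 (R : realType) (mu : probability R R) (t : R) (ht : 1 <= t) :
  exists (C : R) (n0 : nat),
    forall (d : measure_display) (T : measurableType d) (P : probability T R)
      (xi : nat -> {RV P >-> R}),
    iid_with_law xi mu ->
    non_degenerate (xi 0%N) ->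
    (exists M gamma q : R,
       [/\ 0 < M, 0 < gamma, 0 < q < 1
         & concentration_condition (xi 0%N) M gamma q]) ->
    ('E_P[xi 0%N] = 0)%E ->
    ('E_P[(fun w => (xi 0%N w ^+ 2)%R)] < +oo)%E ->
    forall n : nat, (n0 <= n)%N ->
      (P [set w | (min_modulus (random_poly xi n w)
                     (t * n%:R ^- 2 * (ln n%:R) ^- 3)
                   <= t * n%:R `^ (- (1 / 2)) * (ln n%:R) ^- 2)%R]
       <= (C * (ln n%:R) `^ (- (1 / 2)))%:E)%E.
Proof.
(* The constants may depend on the law only, so they are fixed before the
   random variables appear. A law without the required properties is the law of
   no sequence satisfying the hypotheses, and then any constants do. *)
pose admissible := exists M gamma q : R, [/\ 0 < M, 0 < gamma, 0 < q < 1,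
  forall u, (mu [set x | `|x - u| <= gamma]%R <= (1 - q)%:E)%E &
  (mu [set x | (M < `|x|)%R] <= (q / 2)%:E)%E].
pose moments := [/\ mu.-integrable setT (fun x => (x ^+ 2)%:E),
  mu.-integrable setT (fun x => x%:E) & \int[mu]_x x = 0].
have [[[M [gamma [q [M0 g0 q01 conc tail]]]] [i2 i1 m0]]|no] :=
  pselect (admissible /\ moments); last first.
  exists 0, 0%N => d T P xi [indep law] _ [M [gamma [q [M0 g0 q01 cc]]]] E0 E2.
  exfalso; apply: no; split; last exact: law_moments (law 0%N) E0 E2.
  have [conc tail] := law_conc (law 0%N) cc.
  by exists M, gamma, q.
have [C [n0 h]] := min_modulus_bound ht M0 g0 q01 conc tail i2 erefl i1 m0.
exists C, (maxn n0 1) => d T P xi iid _ _ _ _ n.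
rewrite geq_max => /andP[nn0 n1].
have nR : 1 <= n%:R :> R by rewrite ler1n.
have l0 : 0 <= ln n%:R :> R by exact: ln_ge0.
have half (a : R) : 0 <= a -> a `^ (- (1 / 2)) = (Num.sqrt a)^-1.
  by move=> a0; rewrite powRN div1r powR12_sqrt.
have sq : Num.sqrt (ln n%:R) ^+ 2 = ln n%:R :> R by rewrite sqr_sqrtr.
have := h d T P xi iid n nn0.
rewrite !half // -[in ln n%:R ^- 3]sq -[in ln n%:R ^- 2]sq -!exprM.
by rewrite !invfM !mulrA.
Qed.
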